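(* Let $0<p<q<1$ be fixed and let $F$ be a distribution function on $\mathbb R$ with continuous and positive derivative $f$ on the interval $[F^{-1}(p)-\varepsilon,F^{-1}(q)+\varepsilon]$ for some $\varepsilon>0$. Let $F_n$ be the empirical distribution function of an i.i.d. sample $X_1,\dots,X_n$ of size $n$ from $F$. Then $\left\{\frac{\sqrt n}{a(n)}(F_n^{-1}-F^{-1}),n\ge1\right\}$ satisfies the large deviation principle in $l_\infty[p,q]$ with speed $a^2(n)$ and rate function $$I^{EQ}(\phi)=\inf\left\{I_F(\alpha);\ -\frac{\alpha(F^{-1}(x))}{f(F^{-1}(x))}=\phi(x)\ \text{for all }x\in[p,q]\right\},$$ where $$I_F(\alpha)=\begin{cases}\dfrac12\displaystyle\int|\alpha'_F(x)|^2\,dF(x),&\text{if }\alpha\ll F\text{ and }\lim_{|t|\to\infty}|\alpha(t)|=0,\\ \infty,&\text{otherwise.}\end{cases}$$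
   Context: $a(n)$ is a sequence of positive reals with $a(n)\to\infty$ and $a(n)/\sqrt n\to0$. For a nondecreasing function $G$, $G^{-1}(p)=\inf\{x;G(x)\ge p\}$. $l_\infty[p,q]$ is the space of bounded real functions on $[p,q]$ with the sup-norm; on $l_\infty(T)$ the paper considers the $\sigma$-field generated by all balls and all coordinates. The infimum in $I^{EQ}$ is over functions $\alpha:\mathbb R\to\mathbb R$. For such $\alpha$, $\alpha\ll F$ means $\alpha(t)=\int_{(-\infty,t]}\alpha'_F\,dF$ for all $t$ for some $F$-integrable function $\alpha'_F=d\alpha/dF$. Large deviation principle (LDP). For (not necessarily measurable) maps $W_n$ from a probability space to a metric space $\mathcal X$, positive $\lambda(n)\to\infty$, and $I:\mathcal X\to[0,\infty]$ with $\{I\le L\}$ compact for all $L\in\mathbb R$ (rate function), $\{W_n\}$ satisfies the LDP with speed $\lambda(n)$ and rate function $I$ if $\liminf_n\frac1{\lambda(n)}\log P_*(W_n\in U)\ge-\inf_UI$ for every open measurable $U$ and $\limsup_n\frac1{\lambda(n)}\log P^*(W_n\in K)\le-\inf_KI$ for every closed measurable $K$, where $P_*$, $P^*$ are inner and outer probability ($\inf\emptyset=+\infty$, $\log 0=-\infty$). *)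

(* Defs.v *)
From HB Require Import structures.
From mathcomp Require Import all_boot all_order all_algebra finmap.
From mathcomp Require Import all_classical all_reals all_analysis.

Set Implicit Arguments.
Unset Strict Implicit.
Unset Printing Implicit Defensive.

Import Order.TTheory GRing.Theory Num.Theory.
Import numFieldNormedType.Exports.

Local Open Scope classical_set_scope.
Local Open Scope ring_scope.

Section inner_outer_probability.
Context d (T : measurableType d) (R : realType) (P : probability T R).
Local Open Scope ereal_scope.

Definition inner_probability (A : set T) : \bar R :=
  ereal_sup [set P B | B in [set B | measurable B /\ B `<=` A]].

Definition outer_probability (A : set T) : \bar R :=
  ereal_inf [set P B | B in [set B | measurable B /\ A `<=` B]].

End inner_outer_probability.

Definition rate_function (R : realType) (M : metricType R) (I : M -> \bar R) :=
  (forall x, 0 <= I x)%E /\ (forall L : R, compact [set x | (I x <= L%:E)%E]).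

(* [G] is the sigma-field on [M] with respect to which "measurable" is meant;
   sequences are indexed by n >= 1, their value at 0 is irrelevant. *)
Definition large_deviation_principle (R : realType)
    d (T : measurableType d) (P : probability T R)
    (M : metricType R) (G : set_system M)
    (W : nat -> T -> M) (lambda : nat -> R) (I : M -> \bar R) : Prop :=
  [/\ forall n, (0 < n)%N -> 0 < lambda n,
      lambda n @[n --> \oo] --> +oo,
      rate_function I,
      forall U : set M, open U -> G U ->
        (- ereal_inf (I @` U) <=
         limn_einf (fun n =>
           (lambda n)^-1%:E * lne (inner_probability P (W n @^-1` U))))%E &
      forall K : set M, closed K -> G K ->
        (limn_esup (fun n =>
           (lambda n)^-1%:E * lne (outer_probability P (W n @^-1` K)))
         <= - ereal_inf (I @` K))%E].

Definition bounded_functions (R : realType) (T : Type) : {pred T -> R} :=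
  mem (bounded_fun : set (T -> R)).
Arguments bounded_functions {R T}.

Record linfty (R : realType) (T : Type) := Linfty {
  linfty_val :> T -> R ;
  linfty_bounded : linfty_val \in bounded_functions }.

Section linfty_normed.
Context (R : realType) (T : Type).

HB.instance Definition _ := [isSub for @linfty_val R T].
HB.instance Definition _ := [Choice of linfty R T by <:].

Lemma bounded_funP (f : T -> R) :
  f \in bounded_functions <-> exists M, forall t, `|f t| <= M.
Proof.
rewrite inE; split => [[M [Mr fM]]|[M fM]].
  by exists (M + 1) => t; apply: fM => //; rewrite ltrDl.
exists M; split; first exact: num_real.
by move=> N MN t _ /=; rewrite (le_trans (fM t))// ltW.
Qed.

Lemma bounded_fun_submod_closed : submod_closed (@bounded_functions R T).
Proof.
split=> [|c f g].
  by apply/bounded_funP; exists 0 => t; rewrite normr0.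
move=> /bounded_funP[M fM] /bounded_funP[N gN]; apply/bounded_funP.
exists (`|c| * M + N) => t.
by rewrite (le_trans (ler_normD _ _))// lerD// normrM ler_wpM2l.
Qed.

HB.instance Definition _ :=
  GRing.isSubmodClosed.Build R (T -> R)
    bounded_functions bounded_fun_submod_closed.
HB.instance Definition _ := [SubChoice_isSubLmodule of linfty R T by <:].

Implicit Types (phi psi : linfty R T).

Definition sup_norm phi : R := sup (range (fun t => `|phi t|)).

Lemma has_ubound_linfty phi : has_ubound (range (fun t => `|phi t|)).
Proof.
by have /bounded_funP[M phiM] := linfty_bounded phi; exists M => _ [t _ <-].
Qed.

Lemma le_sup_norm phi t : `|phi t| <= sup_norm phi.
Proof. by apply: ub_le_sup; [exact: has_ubound_linfty|exists t]. Qed.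

Lemma sup_norm_le phi (M : R) :
  0 <= M -> (forall t, `|phi t| <= M) -> sup_norm phi <= M.
Proof.
move=> M0 phiM; rewrite /sup_norm; set A := (X in sup X).
have [->|/set0P A0] := eqVneq A set0; first by rewrite sup0.
by apply: ge_sup => // _ [t _ <-].
Qed.

Lemma sup_norm_ge0 phi : 0 <= sup_norm phi.
Proof.
rewrite /sup_norm; set A := (X in sup X).
have [->|/set0P[_ [t _ _]]] := eqVneq A set0; first by rewrite sup0.
by rewrite (le_trans (normr_ge0 (phi t)) (le_sup_norm phi t)).
Qed.

Lemma sup_normD phi psi : sup_norm (phi + psi) <= sup_norm phi + sup_norm psi.
Proof.
apply: sup_norm_le => [|t]; first by rewrite addr_ge0 ?sup_norm_ge0.
by rewrite (le_trans (ler_normD _ _))// lerD ?le_sup_norm.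
Qed.

Lemma sup_normZ_le c phi : sup_norm (c *: phi) <= `|c| * sup_norm phi.
Proof.
apply: sup_norm_le => [|t]; first by rewrite mulr_ge0 ?sup_norm_ge0.
by rewrite normrM ler_wpM2l ?le_sup_norm.
Qed.

Lemma sup_normZ c phi : sup_norm (c *: phi) = `|c| * sup_norm phi.
Proof.
apply/eqP; rewrite eq_le sup_normZ_le /=.
have [->|c0] := eqVneq c 0; first by rewrite normr0 mul0r sup_norm_ge0.
have := sup_normZ_le c^-1 (c *: phi).
by rewrite scalerA mulVf// scale1r normfV ler_pdivlMl ?normr_gt0.
Qed.

Lemma sup_norm_eq0 phi : sup_norm phi = 0 -> phi = 0.
Proof.
move=> phi0; apply: val_inj; apply/funext => t /=.
by apply/eqP; rewrite -normr_le0 -phi0 le_sup_norm.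
Qed.

HB.instance Definition _ := @Lmodule_isNormed.Build R (linfty R T)
  sup_norm sup_normD sup_normZ sup_norm_eq0.

Lemma ball_sup_normE phi e : ball phi e = [set psi | sup_norm (phi - psi) < e].
Proof. by []. Qed.

Lemma sup_dist_eq0 phi psi : sup_norm (phi - psi) = 0 -> phi = psi.
Proof. by move=> /sup_norm_eq0/eqP; rewrite subr_eq0 => /eqP. Qed.

HB.instance Definition _ := PseudoMetric_isMetric.Build R (linfty R T)
  (fun phi psi => sup_norm_ge0 (phi - psi)) sup_dist_eq0 ball_sup_normE.

End linfty_normed.

Definition ball_coord_sigma (R : realType) (T : Type) : set_system (linfty R T) :=
  <<s [set B | exists (phi : linfty R T) r, B = ball phi r] `|`
      [set B | exists t (A : set R),
         measurable A /\ B = (fun phi : linfty R T => phi t) @^-1` A] >>.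

Section independent_sample.
Context d (T : measurableType d) (R : realType) (P : probability T R).

Definition mutually_independent (X : nat -> {RV P >-> R}) : Prop :=
  forall (J : {fset nat}) (B : nat -> set R),
    (forall i, measurable (B i)) ->
    P (\bigcap_(i in [set` J]) X i @^-1` B i) =
      (\prod_(i <- J) P (X i @^-1` B i))%E.

(* The sample of size [n] is [X 0], .., [X n.-1]. *)
Definition iid_from (F : R -> R) (X : nat -> {RV P >-> R}) : Prop :=
  mutually_independent X /\ forall i x, cdf (X i) x = (F x)%:E.

Definition empirical_cdf (X : nat -> {RV P >-> R}) (n : nat) (t : T)
    (x : R) : R :=
  n%:R^-1 * \sum_(i < n) (X i t <= x)%R%:R.

End independent_sample.

Section quantile.
Context (R : realType).
Implicit Types (G : R -> R) (p q x : R).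

Definition quantile G p : R := inf [set x | p <= G x].

Lemma quantile_bounded G p q :
  [set x | q <= G x] !=set0 -> has_lbound [set x | p <= G x] ->
  (fun x : `[p, q]%classic => quantile G (val x))
    \in bounded_functions.
Proof.
move=> q0 lbp; apply/bounded_funP.
exists (Num.max `|quantile G p| `|quantile G q|) => -[x /=].
rewrite inE/= in_itv/= => /andP[px xq].
have lbx r : p <= r -> has_lbound [set y | r <= G y].
  by move=> pr; case: lbp => m mp; exists m => y /= /(le_trans pr); exact: mp.
have mono r s : p <= r -> r <= s -> s <= q -> quantile G r <= quantile G s.
  move=> pr rs sq; apply: lb_le_inf; last first.
    by move=> y /= /(le_trans rs) ry; apply: ge_inf => //; exact: lbx.
  by case: q0 => y /= qy; exists y => /=; exact: le_trans qy.
have pq := le_trans px xq.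
have h1 := mono _ _ (lexx _) px xq.
have h2 := mono _ _ px xq (lexx _).
rewrite le_max; have [x0|x0] := leP 0 (quantile G x).
  by rewrite (ger0_norm x0) [X in _ || X](le_trans h2 (ler_norm _)) orbT.
rewrite (ltr0_norm x0) [X in X || _](_ : _ = true)//.
by rewrite -normrN (le_trans _ (ler_norm _))// lerN2.
Qed.

Lemma cdf_quantile_bounded (F : cumulativeBounded (0 : R) (1 : R)) p q :
  0 < p -> q < 1 ->
  (fun x : `[p, q]%classic => quantile F (val x))
    \in bounded_functions.
Proof.
move=> p0 q1; apply: quantile_bounded.
  have /cvgrPdist_lt/(_ (1 - q)) := cumulativey F.
  rewrite subr_gt0 => /(_ q1) [M [_ MF]]; exists (M + 1) => /=.
  have := MF (M + 1); rewrite ltrDl ltr01 => /(_ isT).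
  by move=> /(le_lt_trans (ler_norm _)); rewrite ltrD2l ltrN2 => /ltW.
have /cvgrPdist_lt/(_ p p0) [M [_ MF]] := cumulativeNy F.
exists M => y /= py; rewrite leNgt; apply/negP => /MF.
by rewrite sub0r normrN => /(le_lt_trans (ler_norm _)); rewrite ltNge py.
Qed.

Lemma empirical_quantile_bounded d (T : measurableType d) (P : probability T R)
    (X : nat -> {RV P >-> R}) (n : nat) (t : T) p q :
  0 < p -> q < 1 ->
  (fun x : `[p, q]%classic => quantile (empirical_cdf X n t) (val x))
    \in bounded_functions.
Proof.
move=> p0 q1; have [->|n0] := eqVneq n 0%N.
  apply/bounded_funP; exists 0 => -[x /=].
  rewrite inE/= in_itv/= => /andP[px _].
  rewrite /quantile (_ : [set _ | _] = set0) ?inf0 ?normr0//.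
  apply/seteqP; split => // y /=; rewrite /empirical_cdf big_ord0 mulr0 => x0.
  by have := lt_le_trans p0 (le_trans px x0); rewrite ltxx.
pose M := \sum_(i < n) `|X i t|.
have XM (i : 'I_n) : `|X i t| <= M.
  by rewrite /M (bigD1 i)//= lerDl sumr_ge0.
apply: quantile_bounded.
  exists M => /=; rewrite /empirical_cdf.
  under eq_bigr do rewrite (le_trans (ler_norm _) (XM _)).
  by rewrite sumr_const card_ord mulVf ?pnatr_eq0// ltW.
exists (- M) => y /= py; rewrite leNgt; apply/negP => yM.
move: py; rewrite /empirical_cdf big1 ?mulr0 ?leNgt ?p0// => i _.
rewrite leNgt (lt_le_trans yM)// lerNl.
by rewrite (le_trans _ (XM i))// -normrN ler_norm.
Qed.

Lemma quantile_process_bounded d (T : measurableType d) (P : probability T R)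
    (F : cumulativeBounded (0 : R) (1 : R)) (X : nat -> {RV P >-> R})
    (c : R) (n : nat) (t : T) p q :
  0 < p -> q < 1 ->
  (fun x : `[p, q]%classic => c *
    (quantile (empirical_cdf X n t) (val x) - quantile F (val x)))
    \in bounded_functions.
Proof.
move=> p0 q1; apply/bounded_funP.
have /bounded_funP[M FM] := cdf_quantile_bounded F p0 q1.
have /bounded_funP[N XN] := empirical_quantile_bounded X n t p0 q1.
exists (`|c| * (N + M)) => x; rewrite normrM ler_wpM2l//.
by rewrite (le_trans (ler_normB _ _))// lerD// ?XN ?FM.
Qed.

Definition quantile_process d (T : measurableType d) (P : probability T R)
    (F : cumulativeBounded (0 : R) (1 : R)) (X : nat -> {RV P >-> R})
    (a : nat -> R) p q (p0 : 0 < p) (q1 : q < 1) (n : nat) (t : T) :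
    linfty R `[p, q]%classic :=
  Linfty (quantile_process_bounded F X (Num.sqrt n%:R / a n) n t p0 q1).

End quantile.

Section rate.
Context (R : realType) (F : cumulativeBounded (0 : R) (1 : R)).
Local Notation dF := (lebesgue_stieltjes_measure F).

(* [g] is a version of the derivative d alpha / dF *)
Definition is_derivative_wrt (alpha g : R -> R) : Prop :=
  dF.-integrable setT (EFin \o g) /\
  forall t, (alpha t)%:E = (\int[dF]_(x in `]-oo, t]) (g x)%:E)%E.

Definition dominated (alpha : R -> R) : Prop :=
  exists g, is_derivative_wrt alpha g.

(* a chosen version, the derivative being unique dF-almost everywhere *)
Definition derivative_wrt (alpha : R -> R) : R -> R :=
  xget (fun=> 0) [set g | is_derivative_wrt alpha g].

Definition I_F (alpha : R -> R) : \bar R :=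
  if `[< [/\ dominated alpha,
             `|alpha t| @[t --> +oo] --> 0 &
             `|alpha t| @[t --> -oo] --> 0] >]
  then (2^-1%:E * \int[dF]_x (`|derivative_wrt alpha x| ^+ 2)%:E)%E
  else +oo%E.

Definition I_EQ (f : R -> R) (p q : R) (phi : linfty R `[p, q]%classic) :
    \bar R :=
  ereal_inf [set I_F alpha | alpha in [set alpha : R -> R |
    forall x : `[p, q]%classic,
      - (alpha (quantile F (val x)) / f (quantile F (val x))) = phi x]].

End rate.

(* Main.v *)
Require Import Defs.
From HB Require Import structures.
From mathcomp Require Import all_boot all_order all_algebra finmap.
From mathcomp Require Import all_classical all_reals all_analysis.
From mathcomp Require Import measurable_realfun ring lra.

Set Implicit Arguments.
Unset Strict Implicit.
Unset Printing Implicit Defensive.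

Import Order.TTheory GRing.Theory Num.Theory.
Import numFieldNormedType.Exports.

Local Open Scope classical_set_scope.
Local Open Scope ring_scope.

(** Write [u_n = a(n) / sqrt n], so that [n u_n^2 = a(n)^2] and every
    exponential rate below is in units of [a(n)^2], let
    [A_n = (F_n - F) / u_n], and let [W_n] be the rescaled quantile process.

    The quantile process is read off the empirical process.  On the scale [u_n]
    around [y = F^-1(x)] the function [F] is linear with slope [f(y)], and [A_n]
    is nearly constant there, outside an event of probability
    [exp (- M a(n)^2)] with [M] as large as one likes: chaining along dyadic
    levels with Bernstein's inequality ([oscillation_bound]).  Hence [F_n]
    crosses the level [x] near [y - u_n A_n(y) / f(y)], that is, [W_n(x)] is
    uniformly close to [- A_n(y) / f(y)] ([ev_bahadur]).  By the same
    oscillation bound it is enough to control [A_n] at the finitely many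
    points [F^-1(x_i)], with [x_i] in a fine grid of [p, q]
    ([ev_close_on_knots]).

    These points cut the line into cells of masses [w_j > 0], and [A_n] at
    them depends only on the numbers of sample points in the cells, that is,
    on a word of [n] independent letters.  If [v_j] is the increment of [A_n]
    over the [j]-th cell, the probability of [v] is roughly
    [exp (- a(n)^2 sum_j v_j^2 / (2 w_j))].  For the upper bound
    ([upper_bound]), a bounded part of [{v | sum_j v_j^2 / w_j > 2 L}] is
    covered by finitely many half-spaces, to each of which the exponential
    Markov inequality applies ([word_halfspace]).  For the lower bound
    ([lower_bound]), the letters are tilted so that the wanted increments
    become typical ([word_tilt]).  Finally [sum_j v_j^2 / w_j] is the energy
    of the step function equal to [v_j / w_j] on the [j]-th cell, which by
    Cauchy-Schwarz is the least energy of a density with these cell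
    integrals; so the discrete rate is the discretization of [I_F].

    The rate function has compact sublevel sets because the densities of
    bounded energy are weakly compact, a limit being built from the integrals
    over measurable sets by the Radon-Nikodym theorem ([weak_compactness]),
    and because the paths of bounded energy are equicontinuous, so that
    pointwise convergence of paths is uniform ([rate_function_I_EQ]).  The
    compactness also gives the upper bound for a closed set [K]: if [I_EQ] is
    larger than [L] on [K], then [K] stays at a positive distance from
    [{I_EQ <= L}], while outside an event of probability
    [exp (- a(n)^2 (L - e))] the process [W_n] is closer to that set. *)

(** * Exponential inequalities *)

Section exp_bounds.
Context {R : realType}.
Implicit Types x y : R.

Lemma mean_value (f df : R -> R) (a b : R) : a <= b ->
  (forall x, a <= x <= b -> is_derive x 1 f (df x)) ->
  exists2 c, a <= c <= b & f b - f a = df c * (b - a).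
Proof.
move=> ab fd.
have [c] := @MVT_segment _ f df a b ab
  (fun x xab => fd x (ltac:(move: xab; rewrite in_itv/= => /andP[/ltW -> /ltW ->]//)))
  ltac:(apply: derivable_within_continuous => x; rewrite in_itv/= => xab; have := fd x xab; by case).
by rewrite in_itv/= => cab fE; exists c.
Qed.

Lemma ge0_der_le (f df : R -> R) (a b : R) : a <= b ->
  (forall x, a <= x <= b -> is_derive x 1 f (df x)) ->
  (forall x, a <= x <= b -> 0 <= df x) -> f a <= f b.
Proof.
move=> ab fd df0; have [c cab fE] := mean_value ab fd.
by rewrite -subr_ge0 fE mulr_ge0 ?subr_ge0 ?df0.
Qed.

(** The quotient of a polynomial by [expR] is [1] at [0], nondecreasing on
    [0, 1] if the cubic coefficient is [1], and nonincreasing on the negative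
    half-line if it is [0]. *)
Lemma expR_le_cubic x : `|x| <= 1 -> expR x <= 1 + x + x ^+ 2 / 2 + `|x| ^+ 3.
Proof.
move=> x1.
pose k c y := (1 + y + y ^+ 2 / 2 + c * y ^+ 3) * expR (- y).
have dk c y : is_derive y 1 (k c) (expR (- y) * y ^+ 2 * (3 * c - 1 / 2 - c * y)).
  by apply: is_derive_eq; rewrite /GRing.scale/= ?mulr0; field.
suff : 1 <= k (if 0 <= x then 1 else 0) x.
  rewrite /k expRN ler_pdivlMr ?expR_gt0// mul1r => /le_trans; apply.
  rewrite lerD2l; case: ifPn => [x0|_]; first by rewrite mul1r (ger0_norm x0).
  by rewrite mul0r exprn_ge0.
have k0 c : k c 0 = 1 by rewrite /k oppr0 expR0; ring.
case: ifPn => [x0|/negbTE x0].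
  rewrite -[leLHS](k0 1); apply: (ge0_der_le x0 (fun y _ => dk 1 y)) => y /andP[y0 yx].
  apply: mulr_ge0; first by rewrite mulr_ge0 ?expR_ge0 ?sqr_ge0.
  have := le_trans yx (le_trans (ler_norm x) x1); lra.
have {}x0 : x <= 0 by rewrite leNgt; apply/negP => /ltW; rewrite x0.
rewrite -(k0 0) -lerN2.
apply: (@ge0_der_le (fun y => - k 0 y) (fun y => - (expR (- y) * y ^+ 2 * (3 * 0 - 1 / 2 - 0 * y)))) => // y _.
rewrite -mulrN; apply: mulr_ge0; first by rewrite mulr_ge0 ?expR_ge0 ?sqr_ge0.
lra.
Qed.

Lemma expR_le_quad x : `|x| <= 1 / 2 -> expR x <= 1 + x + x ^+ 2.
Proof.
move=> x2; have x1 : `|x| <= 1 by lra.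
apply: (le_trans (expR_le_cubic x1)).
have <- : `|x| ^+ 2 = x ^+ 2 by rewrite -normrX ger0_norm ?sqr_ge0.
have := normr_ge0 x; nra.
Qed.

(** Same method as for [expR_le_cubic], with the logarithm of both sides. *)
Lemma le1Dx_expR_cubic x : `|x| <= 1 / 2 ->
  1 + x <= expR (x - x ^+ 2 / 2 + `|x| ^+ 3).
Proof.
move=> x2.
have xge : - (1 / 2) <= x by have := ler_norm (- x); rewrite normrN; lra.
pose k c y := y - y ^+ 2 / 2 + c * y ^+ 3 - ln (1 + y).
have dk c y : - (1 / 2) <= y ->
    is_derive y 1 (k c) ((3 * c - 1 + 3 * c * y) * y ^+ 2 / (1 + y)).
  move=> y2; have y1 : 0 < 1 + y by lra.
  have dl := is_derive1_comp (is_derive1_ln y1) (_ : is_derive y 1 (fun y => 1 + y) 1).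
  have {}dl : is_derive y 1 (fun y => ln (1 + y)) ((1 + y)^-1).
    rewrite -[(1 + y)^-1]mulr1; apply: dl.
    have := @is_deriveD R R^o R^o (cst (1 : R)) id y 1 0 1 (is_derive_cst _ _ _) (is_derive_id _ _).
    by rewrite add0r.
  apply: is_derive_eq; rewrite /GRing.scale/= ?mulr0; field.
  by rewrite gt_eqF.
have y1 : 0 < 1 + x by lra.
rewrite -[leLHS]lnK ?posrE// ler_expR -subr_ge0.
have k0 c : k c 0 = 0 by rewrite /k addr0 ln1; ring.
have [x0|x0] := leP 0 x.
  rewrite (ger0_norm x0) -(mul1r (x ^+ 3)) -/(k 1 x) -[leLHS](k0 1).
  apply: (ge0_der_le x0 (fun y yx => dk 1 y _)) => y /andP[y0 yx]; last first.
    rewrite divr_ge0//; last lra.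
    by rewrite mulr_ge0 ?sqr_ge0//; lra.
  lra.
apply: (@le_trans _ _ (k 0 x)); last first.
  by rewrite /k mul0r addr0 lerD2r lerDl exprn_ge0.
rewrite -[leLHS](k0 0) -lerN2.
have dN y : - (1 / 2) <= y -> is_derive y 1 (fun y => - k 0 y)
    (- ((3 * 0 - 1 + 3 * 0 * y) * y ^+ 2 / (1 + y))).
  by move=> y2; have := dk 0 y y2; exact: is_deriveN.
apply: (@ge0_der_le (fun y => - k 0 y) _ _ _ (ltW x0) (fun y yx => dN y _)) => y /andP[y0 yx].
  by lra.
rewrite -mulNr divr_ge0//; last lra.
have := sqr_ge0 y; lra.
Qed.

End exp_bounds.

(** * Words of independent letters *)

Section words.
Context {R : realType} {I : finType}.
Implicit Types (w g : I -> R) (u s : R).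

Definition word_prob w n (S : pred {ffun 'I_n -> I}) : R :=
  \sum_(k | S k) \prod_(l < n) w (k l).
Arguments word_prob w {n} S.

Definition letter_count n (k : {ffun 'I_n -> I}) (D : pred I) : R :=
  \sum_(l < n) (D (k l))%:R.

Lemma word_sum w n :
  \sum_(k : {ffun 'I_n -> I}) \prod_(l < n) w (k l) = (\sum_j w j) ^+ n.
Proof.
by rewrite -(bigA_distr_bigA (fun (l : 'I_n) j => w j)) prodr_const card_ord.
Qed.

Lemma le_word_prob w n (S S' : pred {ffun 'I_n -> I}) :
  (forall j, 0 <= w j) -> (forall k, S k -> S' k) ->
  word_prob w S <= word_prob w S'.
Proof.
move=> w0 SS'; rewrite /word_prob [leRHS](bigID S)/=.
rewrite [X in _ <= X + _](eq_bigl S) => [|k]; last first.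
  by case Sk: (S k); rewrite ?andbF// (SS' _ Sk).
by rewrite lerDl sumr_ge0// => k _; apply: prodr_ge0.
Qed.

Lemma word_prob_or w n (S S' : pred {ffun 'I_n -> I}) :
  (forall j, 0 <= w j) ->
  word_prob w (predU S S') <= word_prob w S + word_prob w S'.
Proof.
move=> w0; rewrite /word_prob (bigID S)/= lerD//.
  by rewrite (eq_bigl S)// => k /=; case: (S k); rewrite ?andbF.
apply: (@le_word_prob w n _ S' w0) => k /=.
by case: (S k); rewrite //= andbT.
Qed.

Lemma word_prob_exists w n (J : finType) (S : J -> pred {ffun 'I_n -> I}) :
  (forall j, 0 <= w j) ->
  word_prob w (fun k => [exists j, S j k]) <= \sum_j word_prob w (S j).
Proof.
move=> w0; rewrite /word_prob.
rewrite (eq_bigr (fun j => \sum_k (S j k)%:R * \prod_(l < n) w (k l))); last first.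
  move=> j _; rewrite [LHS]big_mkcond/=; apply: eq_bigr => k _.
  by case: ifP; rewrite ?mul1r ?mul0r.
rewrite exchange_big/= big_mkcond/=; apply: ler_sum => k _.
rewrite -mulr_suml; have p0 : 0 <= \prod_(l < n) w (k l) by exact: prodr_ge0.
case: ifPn => [/existsP[j Sjk]|_]; last by rewrite mulr_ge0// sumr_ge0.
by rewrite ler_peMl// (bigD1 j)//= Sjk lerDl sumr_ge0.
Qed.

(** Exponential Markov inequality: on [S] the factor
    [expR (\sum_l g (k l) - s)] is at least [1], and the sum over all words of
    a product over the letters factorizes. *)
Lemma word_chernoff w n g s (S : pred {ffun 'I_n -> I}) :
  (forall j, 0 <= w j) -> (forall k, S k -> s <= \sum_(l < n) g (k l)) ->
  word_prob w S <= expR (- s) * (\sum_j w j * expR (g j)) ^+ n.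
Proof.
move=> w0 Ss; rewrite -(word_sum (fun j => w j * expR (g j))) mulr_sumr.
rewrite /word_prob big_mkcond/=; apply: ler_sum => k _.
have p0 : 0 <= \prod_(l < n) w (k l) by exact: prodr_ge0.
rewrite big_split/= -expR_sum mulrCA -expRD.
case: ifPn => [/Ss h|_]; last by rewrite mulr_ge0 ?expR_ge0.
by rewrite ler_peMr// -expR0 ler_expR addrC subr_ge0.
Qed.

(** Chernoff bound with exponent [u * g].  At the scale [u] the logarithm of
    the moment generating function of a letter is its mean plus half its second
    moment, up to the cubic term; [s] is the height of the half-space in units
    of [n * u]. *)
Lemma word_halfspace w n g (G : R) u s (S : pred {ffun 'I_n -> I}) :
  (forall j, 0 <= w j) -> \sum_j w j = 1 ->
  (forall j, `|g j| <= G) -> 0 <= u -> u * G <= 1 ->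
  (forall k, S k ->
    n%:R * \sum_j w j * g j + n%:R * u * s <= \sum_(l < n) g (k l)) ->
  word_prob w S <=
    expR (- (n%:R * u ^+ 2 * (s - (\sum_j w j * g j ^+ 2) / 2 - u * G ^+ 3))).
Proof.
move=> w0 w1 gG u0 uG Ss.
set c := \sum_j w j * g j; set v := \sum_j w j * g j ^+ 2.
have := @word_chernoff w n (fun j => u * g j) (u * (n%:R * c + n%:R * u * s)) S w0.
move=> /(_ _)/le_trans; apply.
  by move=> k /Ss h; rewrite -mulr_sumr ler_wpM2l.
have mgf : \sum_j w j * expR (u * g j) <= expR (u * c + u ^+ 2 * (v / 2) + u ^+ 3 * G ^+ 3).
  apply: le_trans (expR_ge1Dx _).
  rewrite [leRHS](_ : _ = \sum_j w j * (1 + u * g j + u ^+ 2 * g j ^+ 2 / 2 + u ^+ 3 * G ^+ 3)).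
    apply: ler_sum => j _; apply: ler_wpM2l => //.
    have ug : `|u * g j| <= u * G by rewrite normrM (ger0_norm u0) ler_wpM2l.
    apply: (le_trans (expR_le_cubic (le_trans ug uG))).
    rewrite exprMn lerD2l -exprMn lerXn2r// nnegrE ?normr_ge0//.
    by apply: le_trans ug.
  under [RHS]eq_bigr => j _.
    rewrite (_ : w j * _ = w j * (1 + u ^+ 3 * G ^+ 3) + u * (w j * g j)
      + (u ^+ 2 / 2) * (w j * g j ^+ 2)); last by ring.
    over.
  by rewrite !big_split/= -mulr_suml -!mulr_sumr w1 -/c -/v; field.
have s0 : 0 <= \sum_j w j * expR (u * g j).
  by apply: sumr_ge0 => j _; rewrite mulr_ge0 ?expR_ge0.
apply: (@le_trans _ _ (expR (- (u * (n%:R * c + n%:R * u * s))) *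
    expR (u * c + u ^+ 2 * (v / 2) + u ^+ 3 * G ^+ 3) ^+ n)).
  rewrite ler_wpM2l ?expR_ge0// lerXn2r// nnegrE ?expR_ge0//.
rewrite -expRM_natl -expRD ler_expR le_eqVlt; apply/orP; left; apply/eqP; ring.
Qed.

(** The exponent is [u * t] on the letters of [D], where [t] is left free to be
    optimized.  The second moment of an indicator is its mean, so that a set of
    small mass has a small variance. *)
Lemma word_bernstein w n (D : pred I) u (t : R) s :
  (forall j, 0 <= w j) -> \sum_j w j = 1 ->
  0 <= u -> 0 <= t -> u * t <= 1 / 2 ->
  word_prob w (fun k : {ffun 'I_n -> I} =>
      n%:R * u * s <= `|letter_count k D - n%:R * \sum_(j | D j) w j|) <=
    2 * expR (- (n%:R * u ^+ 2 * (t * s - t ^+ 2 * \sum_(j | D j) w j))).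
Proof.
move=> w0 w1 u0 t0 ut.
set h := \sum_(j | D j) w j.
have h0 : 0 <= h by apply: sumr_ge0.
have one (e : R) : e ^+ 2 = 1 ->
  word_prob w (fun k : {ffun 'I_n -> I} =>
     n%:R * u * s <= e * (letter_count k D - n%:R * h)) <=
  expR (- (n%:R * u ^+ 2 * (t * s - t ^+ 2 * h))).
  move=> e1.
  have ne : `|e| = 1.
    have : `|e| ^+ 2 = 1 by rewrite -normrX e1 normr1.
    by move/eqP; rewrite sqrp_eq1// => /eqP.
  have := @word_chernoff w n (fun j => e * (u * t) * (D j)%:R)
    (u * t * (n%:R * u * s + e * n%:R * h))
    (fun k => n%:R * u * s <= e * (letter_count k D - n%:R * h)) w0.
  move=> /(_ _)/le_trans; apply.
    move=> k; rewrite mulrBr lerBrDr => h1.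
    rewrite -mulr_sumr -/(letter_count k D).
    rewrite (_ : e * (u * t) * _ = (u * t) * (e * letter_count k D)); last by ring.
    by rewrite ler_wpM2l ?mulr_ge0// -(mulrA e).
  have mgf : \sum_j w j * expR (e * (u * t) * (D j)%:R) <= expR (e * (u * t) * h + (u * t) ^+ 2 * h).
    apply: le_trans (expR_ge1Dx _).
    rewrite [leRHS](_ : _ = \sum_j w j * (1 + (D j)%:R * (e * (u * t) + (u * t) ^+ 2))).
      apply: ler_sum => j _; apply: ler_wpM2l => //.
      case: (D j); rewrite ?mulr1 ?mul1r ?mulr0 ?mul0r ?expR0 ?addr0//.
      have := @expR_le_quad R (e * (u * t)).
      rewrite normrM ne (ger0_norm (mulr_ge0 u0 t0)) (mul1r (u * t)) => /(_ ut).
      by rewrite exprMn e1 mul1r addrA.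
    under [RHS]eq_bigr do rewrite mulrDr mulr1 mulrA.
    rewrite big_split/= w1 -mulr_suml.
    have -> : \sum_j w j * (D j)%:R = h.
      rewrite /h [RHS]big_mkcond/=; apply: eq_bigr => j _.
      by case: (D j); rewrite ?mulr1 ?mulr0.
    ring.
  have s0 : 0 <= \sum_j w j * expR (e * (u * t) * (D j)%:R).
    by apply: sumr_ge0 => j _; rewrite mulr_ge0 ?expR_ge0.
  apply: (@le_trans _ _ (expR (- (u * t * (n%:R * u * s + e * n%:R * h))) *
      expR (e * (u * t) * h + (u * t) ^+ 2 * h) ^+ n)).
    by rewrite ler_wpM2l ?expR_ge0// lerXn2r// nnegrE ?expR_ge0.
  rewrite -expRM_natl -expRD ler_expR le_eqVlt; apply/orP; left; apply/eqP; ring.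
have := lerD (one 1 (expr1n _ _)) (one (- 1) (ltac:(by rewrite sqrrN expr1n))).
move=> h2; rewrite [2 * _]mulr_natl mulr2n; apply: le_trans h2.
apply: le_trans (word_prob_or _ _ w0).
apply: le_word_prob => // k /=.
rewrite ler_normr mul1r mulN1r => /orP[->//|->]; by rewrite orbT.
Qed.

Lemma letter_countE n (k : {ffun 'I_n -> I}) g :
  \sum_(l < n) g (k l) = \sum_j letter_count k (pred1 j) * g j.
Proof.
under eq_bigr do rewrite /letter_count.
under [RHS]eq_bigr do rewrite /letter_count mulr_suml.
rewrite exchange_big/=; apply: eq_bigr => l _.
rewrite (bigD1 (k l))//= eqxx mul1r big1 ?addr0// => j.
by rewrite eq_sym => /negbTE ->; rewrite mul0r.
Qed.

Lemma word_probC w n (S : pred {ffun 'I_n -> I}) : \sum_j w j = 1 ->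
  word_prob w S = 1 - word_prob w (predC S).
Proof.
move=> w1; rewrite -[X in X - _](expr1n _ n) -w1 -word_sum.
by rewrite [X in _ = X - _](bigID S)/= addrK.
Qed.

Lemma sum_cst (x : R) : \sum_(j : I) x = #|I|%:R * x.
Proof. by rewrite sumr_const mulr_natl. Qed.

(** Change of measure.  Under the weights [w j * (1 + u * g j)] the words that
    have the expected letter counts up to [n * u * e] are typical, by
    [word_bernstein]; and on these words the likelihood ratio is nearly
    deterministic, since it depends on the letter counts only. *)
Lemma word_tilt w n g (G u e : R) :
  (forall j, 0 <= w j) -> \sum_j w j = 1 -> \sum_j w j * g j = 0 ->
  0 <= G -> (forall j, `|g j| <= G) -> 0 <= u -> u * G <= 1 / 2 ->
  0 <= e -> u * e <= 1 ->
  (1 - #|I|%:R * (2 * expR (- (n%:R * u ^+ 2 * (e ^+ 2 / 4))))) *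
    expR (- (n%:R * u ^+ 2 * ((\sum_j w j * g j ^+ 2) / 2 + e * (#|I|%:R * G)
      + u * (2 * G ^+ 3 + e * (#|I|%:R * G ^+ 2))))) <=
  word_prob w (fun k : {ffun 'I_n -> I} =>
     [forall j, `|letter_count k (pred1 j) - n%:R * (w j * (1 + u * g j))| <= n%:R * u * e]).
Proof.
move=> w0 w1 wg0 G0 gG u0 uG e0 ue.
set S := (X in word_prob w X); set v := \sum_j w j * g j ^+ 2.
pose w' j := w j * (1 + u * g j).
have ug j : `|u * g j| <= 1 / 2.
  by rewrite normrM (ger0_norm u0); apply: le_trans uG; rewrite ler_wpM2l.
have ugN j : - (1 / 2) <= u * g j by have := ug j; rewrite ler_norml => /andP[].
have w'0 j : 0 <= w' j by rewrite mulr_ge0//; have := ugN j; lra.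
have w'1 : \sum_j w' j = 1.
  rewrite /w'; under eq_bigr do rewrite mulrDr mulr1 mulrCA.
  by rewrite big_split/= w1 -mulr_sumr wg0 mulr0 addr0.
(* a count farther than [n * u * e] from its mean: Bernstein with [t = e / 2] *)
have PS : 1 - #|I|%:R * (2 * expR (- (n%:R * u ^+ 2 * (e ^+ 2 / 4)))) <= word_prob w' S.
  rewrite word_probC// lerD2l lerN2.
  apply: (@le_trans _ _ (word_prob w' (fun k : {ffun 'I_n -> I} => [exists j,
      n%:R * u * e <= `|letter_count k (pred1 j) - n%:R * (\sum_(i | pred1 j i) w' i)|]))).
    apply: le_word_prob => // k /=; rewrite negb_forall => /existsP[j].
    by rewrite -ltNge => /ltW h; apply/existsP; exists j; rewrite big_pred1_eq.
  apply: (le_trans (word_prob_exists _ w'0)).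
  rewrite -sum_cst; apply: ler_sum => j _.
  apply: (le_trans (@word_bernstein w' n (pred1 j) u (e / 2) e w'0 w'1 u0 _ _)).
  - lra.
  - by rewrite mulrA; lra.
  rewrite ler_wpM2l// ler_expR lerN2 ler_wpM2l//; first by rewrite mulr_ge0 ?exprn_ge0.
  rewrite big_pred1_eq.
  have : w' j <= 1 by rewrite -w'1 (bigD1 j)//= lerDl sumr_ge0.
  by have := sqr_ge0 e; nra.
set E := v / 2 + e * (#|I|%:R * G) + u * (2 * G ^+ 3 + e * (#|I|%:R * G ^+ 2)).
suff : word_prob w' S <= expR (n%:R * u ^+ 2 * E) * word_prob w S.
  move=> h; rewrite [X in _ * X]expRN ler_pdivrMr ?expR_gt0// [leRHS]mulrC.
  exact: le_trans h.
(* the likelihood ratio on [S]: [ln (1 + y) <= y - y^2 / 2 + |y|^3] is summed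
   over the letters of the word, and the sums are read off the letter counts *)
rewrite /word_prob mulr_sumr; apply: ler_sum => k /forallP Sk.
rewrite /w' big_split/= mulrC ler_wpM2r//; first exact: prodr_ge0.
apply: (@le_trans _ _ (\prod_(l < n) expR (u * g (k l) - (u * g (k l)) ^+ 2 / 2 + `|u * g (k l)| ^+ 3))).
  apply: ler_prod => l _; rewrite le1Dx_expR_cubic// andbT.
  by have := ugN (k l); lra.
rewrite -expR_sum ler_expR !big_split/=.
pose c j := letter_count k (pred1 j); pose r j := c j - n%:R * w' j.
have cE j : c j = n%:R * w' j + r j by rewrite /r addrC subrK.
have rle j : `|r j| <= n%:R * u * e by exact: Sk.
have sumle (h : I -> R) H : (forall j, `|h j| <= H) ->
    \sum_j r j * h j <= n%:R * u * e * (#|I|%:R * H).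
  move=> hH; rewrite mulrCA -sum_cst; apply: ler_sum => j _.
  apply: (le_trans (ler_norm _)); rewrite normrM ler_pM//.
have A1 : \sum_(l < n) u * g (k l) <= n%:R * u ^+ 2 * (v + e * (#|I|%:R * G)).
  rewrite (letter_countE k (fun j => u * g j)).
  rewrite (eq_bigr (fun j => n%:R * u * (w j * g j) + n%:R * u ^+ 2 * (w j * g j ^+ 2) + u * (r j * g j))); last first.
    by move=> j _; rewrite -/(c j) cE /w'; ring.
  rewrite !big_split/= -!mulr_sumr wg0 mulr0 add0r mulrDr lerD2l.
  apply: le_trans (ler_wpM2l u0 (sumle g G gG)) _.
  rewrite le_eqVlt; apply/orP; left; apply/eqP; ring.
have A2 : \sum_(l < n) - ((u * g (k l)) ^+ 2 / 2) <= n%:R * u ^+ 2 *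
    (- (v / 2) + u * (G ^+ 3 + e * (#|I|%:R * G ^+ 2))).
  rewrite (letter_countE k (fun j => - ((u * g j) ^+ 2 / 2))).
  rewrite (eq_bigr (fun j => - (n%:R * u ^+ 2 / 2) * (w j * g j ^+ 2) + (n%:R * u ^+ 3 / 2) * - (w j * g j ^+ 3) + u ^+ 2 / 2 * (r j * - g j ^+ 2))); last first.
    by move=> j _; rewrite -/(c j) cE /w'; ring.
  rewrite !big_split/= -!mulr_sumr -/v.
  have B1 : \sum_j - (w j * g j ^+ 3) <= G ^+ 3.
    rewrite -[leRHS]mul1r -w1 mulr_suml; apply: ler_sum => j _.
    rewrite -mulrN ler_wpM2l// (le_trans (ler_norm _))// normrN normrX.
    by rewrite lerXn2r// nnegrE.
  have B2 := sumle (fun j => - g j ^+ 2) (G ^+ 2) _.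
  have {}B2 : \sum_j r j * - g j ^+ 2 <= n%:R * u * e * (#|I|%:R * G ^+ 2).
    by apply: B2 => j; rewrite normrN normrX lerXn2r// nnegrE.
  have C1 : n%:R * u ^+ 3 / 2 * \sum_j - (w j * g j ^+ 3) <= n%:R * u ^+ 3 / 2 * G ^+ 3.
    by rewrite ler_wpM2l// divr_ge0 ?mulr_ge0 ?exprn_ge0.
  have C2 : u ^+ 2 / 2 * (\sum_j r j * - g j ^+ 2) <= u ^+ 2 / 2 * (n%:R * u * e * (#|I|%:R * G ^+ 2)).
    by rewrite ler_wpM2l// divr_ge0 ?exprn_ge0.
  have D1 : 0 <= n%:R * u ^+ 3 * G ^+ 3 by rewrite !mulr_ge0 ?exprn_ge0.
  have D2 : 0 <= n%:R * u ^+ 3 * (e * (#|I|%:R * G ^+ 2)) by rewrite !mulr_ge0 ?exprn_ge0.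
  rewrite [leRHS](_ : _ = - (n%:R * u ^+ 2 / 2) * v + n%:R * u ^+ 3 * G ^+ 3 +
    n%:R * u ^+ 3 * (e * (#|I|%:R * G ^+ 2))); last by field.
  rewrite (_ : u ^+ 2 / 2 * (n%:R * u * e * (#|I|%:R * G ^+ 2)) = n%:R * u ^+ 3 * (e * (#|I|%:R * G ^+ 2)) / 2) in C2; last by field.
  lra.
have A3 : \sum_(l < n) `|u * g (k l)| ^+ 3 <= n%:R * u ^+ 2 * (u * G ^+ 3).
  rewrite (_ : n%:R * _ * _ = n%:R * (u * G) ^+ 3); last by ring.
  rewrite -[in leRHS](card_ord n) mulr_natl -sumr_const; apply: ler_sum => l _.
  rewrite lerXn2r ?nnegrE ?mulr_ge0// normrM (ger0_norm u0) ler_wpM2l//.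
apply: le_trans (lerD (lerD A1 A2) A3) _.
rewrite le_eqVlt; apply/orP; left; apply/eqP; rewrite /E; by field.
Qed.

End words.

(** * Square-integrable functions and their weak limits *)

Section ultralimit.
Context {R : realType} {X : Type}.

(** The image ultrafilter lives in a compact segment, so it has a cluster
    point, and an ultrafilter converges to its cluster points. *)
Lemma ultra_cvg (U : set_system X) (UU : UltraFilter U) (f : X -> R) (C : R) :
  (\forall x \near U, `|f x| <= C) -> cvg (f x @[x --> U]).
Proof.
move=> fC; have UF : ProperFilter U by exact: ultra_proper.
have := @segment_compact R (- C) C.
move=> /(_ (f x @[x --> U]) _) -[].
  by apply: filterS fC => x /=; rewrite in_itv/= ler_norml.
move=> l [_ cl]; apply/cvg_ex; exists l => B Bl.
have [//|nB] := in_ultra_setVsetC (f @^-1` B) UU.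
have [y [/= nBy By]] := cl (~` B) B nB Bl.
by exfalso; exact: nBy.
Qed.

Lemma cvg_finsum (U : set_system X) (UF : ProperFilter U) (I : Type) (s : seq I)
    (f : I -> X -> R) (l : I -> R) :
  (forall i, f i x @[x --> U] --> l i) ->
  \sum_(i <- s) f i x @[x --> U] --> \sum_(i <- s) l i.
Proof.
move=> fl; elim: s => [|i s IH].
  by under eq_fun do rewrite big_nil; rewrite big_nil; exact: cvg_cst.
by under eq_fun do rewrite big_cons; rewrite big_cons; exact: cvgD.
Qed.

Lemma cvg_le_bound (U : set_system X) (UF : ProperFilter U) (f : X -> R) (l M : R) :
  f x @[x --> U] --> l -> (\forall x \near U, f x <= M) -> l <= M.
Proof.
move=> fl fM; rewrite -(cvg_lim _ fl)//; apply: limr_le => //.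
by apply/cvg_ex; exists l.
Qed.

End ultralimit.

Section square_integrable.
Context d (T : measurableType d) (R : realType) (mu : probability T R).
Implicit Types (g : T -> R) (A : set T) (B c : R).

(** A bound on the energy rather than its value: bounds pass to weak limits,
    values do not. *)
Definition sq_le g B := measurable_fun setT g /\
  (\int[mu]_x (g x ^+ 2)%:E <= B%:E)%E.

Lemma sq_le_ge0 g B : sq_le g B -> 0 <= B.
Proof.
by move=> [_]; rewrite -lee_fin; apply: le_trans; apply: integral_ge0 => x _; rewrite lee_fin sqr_ge0.
Qed.

Lemma sq_le_integrable2 g B A : measurable A -> sq_le g B ->
  mu.-integrable A (EFin \o (fun x => g x ^+ 2)).
Proof.
move=> mA [mg gB]; apply: (@integrableS _ _ _ mu setT) => //.
apply/integrableP; split.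
  by apply/measurable_EFinP; exact: measurable_funX.
apply: (@le_lt_trans _ _ (B%:E)); last exact: ltry.
rewrite (le_trans _ gB)// le_eqVlt; apply/orP; left; apply/eqP.
by apply: eq_integral => x _ /=; rewrite ger0_norm ?sqr_ge0.
Qed.

Lemma integrable_cstP c A : measurable A -> mu.-integrable A (EFin \o cst c).
Proof.
by move=> mA; apply: finite_measure_integrable_cst.
Qed.

Lemma sq_le_integrable g B A : measurable A -> sq_le g B ->
  mu.-integrable A (EFin \o g).
Proof.
move=> mA sg; have [mg _] := sg; apply: (@integrableS _ _ _ mu setT) => //.
apply: (@le_integrable _ _ _ mu _ measurableT _ (EFin \o (fun x => 1 + g x ^+ 2))).
- exact/measurable_EFinP.
- move=> x _ /=; rewrite lee_fin [leRHS]ger0_norm; last by rewrite addr_ge0 ?sqr_ge0.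
  have : `|g x| ^+ 2 = g x ^+ 2 by rewrite -normrX ger0_norm ?sqr_ge0.
  have := normr_ge0 (g x); nra.
- have := integrableD measurableT (integrable_cstP 1 measurableT) (sq_le_integrable2 measurableT sg).
  by apply: eq_integrable.
Qed.

(** The integral of [(g - c)^2] is nonnegative.  The left-hand side is linear
    in [g], hence continuous for weak convergence; the optimal [c] gives the
    Cauchy-Schwarz inequality. *)
Lemma young g B A c : measurable A -> sq_le g B ->
  2 * c * \int[mu]_(x in A) g x <= \int[mu]_(x in A) (g x ^+ 2) + c ^+ 2 * fine (mu A).
Proof.
move=> mA sg; have i1 := sq_le_integrable mA sg; have i2 := sq_le_integrable2 mA sg.
rewrite -RintegralZl// -Rintegral_cst// -RintegralD//; last exact: integrable_cstP.
apply: le_Rintegral => //.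
- by have := integrableZl mA (2 * c) i1; apply: eq_integrable.
- by have := integrableD mA i2 (integrable_cstP (c ^+ 2) mA); apply: eq_integrable.
- by move=> x _; rewrite -subr_ge0 (_ : _ - _ = (g x - c) ^+ 2) ?sqr_ge0//; ring.
Qed.

Lemma Rintegral_sq_le g B A : measurable A -> sq_le g B ->
  \int[mu]_(x in A) (g x ^+ 2) <= B.
Proof.
move=> mA sg; have [mg gB] := sg.
rewrite -lee_fin /Rintegral fineK; last exact: integrable_fin_num (sq_le_integrable2 mA sg).
apply: le_trans gB; apply: ge0_subset_integral => //.
- by apply/measurable_EFinP; exact: measurable_funX.
- by move=> x _; rewrite lee_fin sqr_ge0.
Qed.

(** The optimal [c] is [x / m]; if [m = 0], letting [c] grow forces [x = 0]. *)
Lemma discriminant_le (x y m : R) : 0 <= m ->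
  (forall c, 2 * c * x <= y + c ^+ 2 * m) -> x ^+ 2 <= m * y.
Proof.
move=> m0 h; have [m_eq|m_neq] := eqVneq m 0.
  rewrite m_eq mul0r; have [->|x0] := eqVneq x 0; first by rewrite expr0n.
  have := h ((y + 1) / (2 * x)); rewrite m_eq mulr0 addr0.
  rewrite (_ : 2 * _ * x = y + 1); last by field.
  by move=> ?; exfalso; lra.
have m_gt : 0 < m by rewrite lt_neqAle eq_sym m_neq.
have := h (x / m).
rewrite (_ : 2 * (x / m) * x = 2 * (x ^+ 2 / m)); last by ring.
rewrite (_ : (x / m) ^+ 2 * m = x ^+ 2 / m); last by field.
move=> h1; have : x ^+ 2 / m <= y by lra.
by rewrite ler_pdivrMr// mulrC.
Qed.

Lemma cauchy_schwarz g B A : measurable A -> sq_le g B ->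
  (\int[mu]_(x in A) g x) ^+ 2 <= fine (mu A) * \int[mu]_(x in A) (g x ^+ 2).
Proof.
move=> mA sg; apply: discriminant_le => [|c]; first exact: fine_ge0.
exact: young sg.
Qed.

Lemma cauchy_schwarz_le g B A : measurable A -> sq_le g B ->
  (\int[mu]_(x in A) g x) ^+ 2 <= fine (mu A) * B.
Proof.
move=> mA sg; apply: le_trans (cauchy_schwarz mA sg) _.
by apply: ler_wpM2l (Rintegral_sq_le mA sg); exact: fine_ge0.
Qed.

Lemma sum_Rintegral_sq_le g B (I : finType) (A : I -> set T) :
  (forall i, measurable (A i)) -> trivIset setT A -> sq_le g B ->
  \sum_i \int[mu]_(x in A i) (g x ^+ 2) <= B.
Proof.
move=> mA tA sg; have [mg gB] := sg.
have mg2 : measurable_fun setT (fun x => (g x ^+ 2)%:E).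
  by apply/measurable_EFinP; exact: measurable_funX.
have mD : measurable (\big[setU/set0]_(i <- index_enum I) A i).
  exact: bigsetU_measurable.
rewrite -lee_fin; apply: le_trans gB.
apply: (@le_trans _ _ (\int[mu]_(x in \big[setU/set0]_(i <- index_enum I) A i) (g x ^+ 2)%:E)%E); last first.
  by apply: ge0_subset_integral => // x _; rewrite lee_fin sqr_ge0.
rewrite ge0_integral_bigsetU//=.
- rewrite -sumEFin le_eqVlt; apply/orP; left; apply/eqP; apply: eq_bigr => i _.
  by rewrite /Rintegral fineK//; exact: integrable_fin_num (sq_le_integrable2 (mA i) sg).
- exact: index_enum_uniq.
- exact: sub_trivIset tA.
- exact: measurable_funTS.
- by move=> x _; rewrite lee_fin sqr_ge0.
Qed.

Lemma sum_fine_measure (I : finType) (A : I -> set T) :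
  (forall i, measurable (A i)) -> trivIset setT A -> \sum_i fine (mu (A i)) <= 1.
Proof.
move=> mA tA; have s1 : sq_le (cst 1) 1.
  split; first exact: measurable_cst.
  rewrite (eq_integral (cst 1%E)); last by move=> x _ /=; rewrite expr1n.
  by rewrite integral_cst// mul1e probability_le1.
have := sum_Rintegral_sq_le mA tA s1; apply: le_trans.
apply: ler_sum => i _; rewrite /cst/= expr1n.
by rewrite Rintegral_cst ?mul1r.
Qed.

End square_integrable.

Section weak_limit.
Context d (T : measurableType d) (R : realType) (mu : probability T R).
Context (X : Type) (U : set_system X) (UU : UltraFilter U).
Context (G : X -> T -> R) (B : R) (GB : \forall x \near U, sq_le mu (G x) B).

Let UF : ProperFilter U := ultra_proper.

Let B0 : 0 <= B.
Proof. by have [x /sq_le_ge0] := filter_ex GB. Qed.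

(** The limits of the integrals over measurable sets.  By [N_sq] they are
    absolutely continuous with respect to [mu], so they form a charge with a
    density, the weak limit. *)
Let N (A : set T) : R := lim (\int[mu]_(y in A) G x y @[x --> U]).

Let N_cvg A : measurable A -> \int[mu]_(y in A) G x y @[x --> U] --> N A.
Proof.
move=> mA; apply: (@ultra_cvg _ _ _ UU _ (B + 1)).
apply: filterS GB => x sx.
rewrite -(@ler_pXn2r _ 2)// ?nnegrE ?addr_ge0// -normrX ger0_norm ?sqr_ge0//.
apply: (le_trans (cauchy_schwarz_le mA sx)).
have mA1 : fine (mu A) <= 1.
  by rewrite -lee_fin fineK ?fin_num_measure// probability_le1.
apply: (@le_trans _ _ (1 * B)); first by rewrite ler_wpM2r.
have := B0; nra.
Qed.

Let N_sq A : measurable A -> N A ^+ 2 <= fine (mu A) * B.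
Proof.
move=> mA; have h : (\int[mu]_(y in A) G x y) ^+ 2 @[x --> U] --> N A ^+ 2.
  by rewrite !expr2; apply: cvgM; exact: N_cvg.
have H : \forall x \near U, (\int[mu]_(y in A) G x y) ^+ 2 <= fine (mu A) * B.
  by apply: filterS GB => x; exact: cauchy_schwarz_le.
exact: (cvg_le_bound UF h H).
Qed.

Let N_add A A' : measurable A -> measurable A' -> [disjoint A & A'] ->
  N (A `|` A') = N A + N A'.
Proof.
move=> mA mA' AA'; apply: (@cvg_unique R _ (\int[mu]_(y in A `|` A') G x y @[x --> U]) _ _ _ (N_cvg (measurableU _ _ mA mA'))) => //.
apply: cvg_trans (cvgD (N_cvg mA) (N_cvg mA')).
apply: near_eq_cvg; apply: filterS GB => x sx.
by rewrite Rintegral_setU//; apply: sq_le_integrable sx; exact: measurableU.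
Qed.

Let N0 : N set0 = 0.
Proof.
have := N_sq measurable0; rewrite measure0 mul0r => h.
by apply/eqP; rewrite -sqrf_eq0 eq_le h sqr_ge0.
Qed.

Let nu (A : set T) : \bar R := (N A)%:E.

(** The remainders of a countable union have [mu]-masses tending to [0], and
    [N_sq] bounds the square of [N] by a multiple of this mass. *)
Let nu_sigma_additive : semi_sigma_additive nu.
Proof.
move=> F mF tF mUF.
pose S n := \big[setU/set0]_(i < n) F i.
have mS n : measurable (S n) by exact: bigsetU_measurable.
have SU n : S n `<=` \bigcup_i F i by exact: bigsetU_bigcup.
have NS n : \sum_(0 <= i < n) N (F i) = N (S n).
  elim: n => [|n IH]; first by rewrite big_geq// /S big_ord0 N0.
  rewrite big_nat_recr//= IH /S big_ord_recr/= N_add//; first exact: mS.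
  by rewrite disj_set2E; apply/eqP; rewrite (@trivIset_bigsetUI _ predT)//; exact: sub_trivIset tF.
have ND n : N (\bigcup_i F i) - N (S n) = N ((\bigcup_i F i) `\` S n).
  rewrite -{1}(setDUK (SU n)) N_add//; first by rewrite addrC addKr.
    exact: measurableD.
  by rewrite disj_set2E; apply/eqP; rewrite setDIK.
have muD : fine (mu ((\bigcup_i F i) `\` S n)) @[n --> \oo] --> 0.
  have h := @measure_semi_sigma_additive _ _ _ mu F mF tF mUF.
  have : (mu (\bigcup_i F i) - \sum_(0 <= i < n) mu (F i))%E @[n --> \oo] -->
      (mu (\bigcup_i F i) - mu (\bigcup_i F i))%E.
    apply: cvgeB => //; last exact: cvg_cst.
    by rewrite fin_num_adde_defl// fin_numN fin_num_measure.
  rewrite subee ?fin_num_measure//.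
  rewrite (_ : (fun _ => _) = (fun n => mu ((\bigcup_i F i) `\` S n))).
    by move=> /fine_cvgP[].
  apply/funext => n; rewrite measureD//; last by rewrite -ge0_fin_numE ?fin_num_measure.
  rewrite setIidr//; congr (_ - _)%E; rewrite measure_bigsetU//=.
  by rewrite big_mkord.
rewrite /nu; under eq_fun do rewrite sumEFin.
apply: cvg_EFin; first by near=> n.
apply/cvgrPdist_le => e e0.
have B1 : 0 < B + 1 by have := B0; lra.
have eB : 0 < e ^+ 2 / (B + 1) by rewrite divr_gt0 ?exprn_gt0.
move/cvgrPdist_le : muD => /(_ _ eB) muD.
near=> n; rewrite /= NS ND.
have h : `|0 - fine (mu ((\bigcup_i F i) `\` S n))| <= e ^+ 2 / (B + 1) by near: n.
rewrite sub0r normrN ger0_norm ?fine_ge0// in h.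
rewrite -(@ler_pXn2r _ 2)// ?nnegrE ?(ltW e0)// -normrX ger0_norm ?sqr_ge0//.
apply: le_trans (N_sq (measurableD mUF (mS n))) _.
move: h; rewrite ler_pdivlMr//.
have := fine_ge0 (measure_ge0 mu ((\bigcup_i F i) `\` S n)); nra.
Unshelve. all: by end_near. Qed.

Let N_density : exists g : T -> R, mu.-integrable setT (EFin \o g) /\
  forall A, measurable A -> \int[mu]_(y in A) g y = N A.
Proof.
pose nuC : {charge set T -> \bar R} := HB.pack nu
  (isCharge.Build _ _ _ nu (congr1 EFin N0) (fun A _ => erefl) nu_sigma_additive).
have numu : nuC `<< mu.
  apply/null_content_dominatesP => A mA muA.
  have := N_sq mA; rewrite muA mul0r => h.
  rewrite /= /nu (_ : N A = 0)//.
  by apply/eqP; rewrite -sqrf_eq0 eq_le h sqr_ge0.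
pose g x := fine (Radon_Nikodym nuC mu x).
have gE x : (g x)%:E = Radon_Nikodym nuC mu x.
  by rewrite /g fineK// Radon_Nikodym_fin_num.
have ig : mu.-integrable setT (EFin \o g).
  by have := Radon_Nikodym_integrable numu; apply: eq_integrable => // x _ /=; rewrite gE.
exists g; split=> // A mA.
rewrite /Rintegral; under eq_integral do rewrite gE.
by rewrite -Radon_Nikodym_integral.
Qed.

(** The energy bound for the limit density [g]: on a cell where [g] is within
    [e] of a constant [c], [g^2 <= 2 c g - c^2 + e^2], and [2 c] times the
    integral of [g] is the limit of integrals that [young] bounds by the
    energies of the [G x]. *)
Lemma weak_compactness : exists g, sq_le mu g B /\
  forall A, measurable A ->
    \int[mu]_(y in A) G x y @[x --> U] --> \int[mu]_(y in A) g y.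
Proof.
have [g [ig gN]] := N_density.
have mg : measurable_fun setT g by apply/measurable_EFinP; exact: measurable_int ig.
exists g; split; last by move=> A mA; rewrite gN//; exact: N_cvg.
split => //.
have mg2 : measurable_fun setT (fun x => (g x ^+ 2)%:E).
  by apply/measurable_EFinP; exact: measurable_funX.
(* the part of the energy where [g] takes values in [-K e, K e[, cut into
   slices on which [g] is within [e] of the constant [c j] *)
have cell (e : R) (K : nat) : 0 < e ->
    (\int[mu]_(x in [set x | (- (K%:R * e) <= g x < K%:R * e)%R]) (g x ^+ 2)%:E <= (B + e ^+ 2)%:E)%E.
  move=> e0.
  pose c (j : 'I_(K + K)) : R := (j%:R - K%:R) * e.
  pose A (j : 'I_(K + K)) := [set x | c j <= g x < c j + e].
  have mA j : measurable (A j).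
    rewrite [A j](_ : _ = g @^-1` `[c j, c j + e[%classic).
      by rewrite -[X in measurable X]setTI; exact: mg.
    by apply/seteqP; split => x /=; rewrite in_itv.
  have tA : trivIset setT A.
    apply/trivIsetP => i j _ _ ij; apply/seteqP; split => // x [/= /andP[i1 i2] /andP[j1 j2]].
    have aux (a b : 'I_(K + K)) : c a <= g x -> g x < c b + e -> (a <= b)%N.
      move=> h1 h2; have : c a < c b + e by exact: le_lt_trans h2.
      rewrite /c -{3}(mul1r e) -mulrDl ltr_pM2r// => h.
      have : a%:R < b%:R + 1 :> R by lra.
      by rewrite natr1 ltr_nat ltnS.
    by move/negP: ij; apply; apply/eqP/val_inj/eqP; rewrite eqn_leq /= (aux i j)// aux.
  have key : \sum_j 2 * c j * \int[mu]_(y in A j) g y <= B + \sum_j c j ^+ 2 * fine (mu (A j)).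
    have h : \sum_j 2 * c j * \int[mu]_(y in A j) G x y @[x --> U] -->
       \sum_j 2 * c j * \int[mu]_(y in A j) g y.
      apply: cvg_finsum => j; apply: cvgM; first exact: cvg_cst.
      by rewrite gN//; exact: N_cvg.
    have H : \forall x \near U, \sum_j 2 * c j * \int[mu]_(y in A j) G x y <=
        B + \sum_j c j ^+ 2 * fine (mu (A j)).
      apply: filterS GB => x sx; apply: (@le_trans _ _ (\sum_j \int[mu]_(y in A j) (G x y ^+ 2) + \sum_j c j ^+ 2 * fine (mu (A j)))).
        by rewrite -big_split/=; apply: ler_sum => j _; exact: young sx.
      by rewrite lerD2r; exact: sum_Rintegral_sq_le.
    exact: (cvg_le_bound UF h H).
  have igA j : mu.-integrable (A j) (EFin \o (fun x => g x ^+ 2)).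
    apply: measurable_bounded_integrable => //.
    - by rewrite ltey_eq fin_num_measure.
    - by apply: measurable_funTS; exact: measurable_funX.
    - exists ((`|c j| + e) ^+ 2); split; first exact: num_real.
      move=> M hM x /= /andP[h1 h2]; apply: ltW; apply: le_lt_trans hM.
      rewrite normrX lerXn2r ?nnegrE ?addr_ge0 ?(ltW e0)// ler_norml.
      by have := ler_norm (c j); have := ler_norm (- c j); rewrite normrN; lra.
  have ig1 j : mu.-integrable (A j) (EFin \o g) by exact: (@integrableS _ _ _ mu setT).
  have pc j : \int[mu]_(y in A j) (g y ^+ 2) <=
     2 * c j * \int[mu]_(y in A j) g y - c j ^+ 2 * fine (mu (A j)) + e ^+ 2 * fine (mu (A j)).
    rewrite (_ : _ + _ = 2 * c j * \int[mu]_(y in A j) g y +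
      (- c j ^+ 2 + e ^+ 2) * fine (mu (A j))); last by ring.
    rewrite -RintegralZl// -Rintegral_cst// -RintegralD//; last 2 first.
      by have := integrableZl (mA j) (2 * c j) (ig1 j); apply: eq_integrable.
      exact: integrable_cstP.
    apply: le_Rintegral => //.
      have := integrableD (mA j) (integrableZl (mA j) (2 * c j) (ig1 j)) (integrable_cstP mu (- c j ^+ 2 + e ^+ 2) (mA j)).
      by apply: eq_integrable.
    move=> x /= /andP[h1 h2]; nra.
  have tot : \sum_j \int[mu]_(y in A j) (g y ^+ 2) <= B + e ^+ 2.
    apply: le_trans (ler_sum _ (fun j _ => pc j)) _.
    rewrite !big_split/= sumrN -mulr_sumr.
    have := sum_fine_measure mu mA tA; have := sqr_ge0 e; nra.
  have mD : measurable (\big[setU/set0]_(j <- index_enum 'I_(K + K)) A j).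
    exact: bigsetU_measurable.
  apply: (@le_trans _ _ (\int[mu]_(x in \big[setU/set0]_(j <- index_enum 'I_(K + K)) A j) (g x ^+ 2)%:E)%E).
    apply: ge0_subset_integral => //.
    - rewrite (_ : [set _ | _] = g @^-1` `[- (K%:R * e), K%:R * e[%classic).
        by rewrite -[X in measurable X]setTI; exact: mg.
      by apply/seteqP; split => x /=; rewrite in_itv.
    - exact: measurable_funTS.
    - by move=> x _; rewrite lee_fin sqr_ge0.
    move=> x /= /andP[h1 h2].
    have z0 : 0 <= g x / e + K%:R.
      by rewrite -lerBlDr sub0r ler_pdivlMr// mulNr.
    have zlt : g x / e + K%:R < (K + K)%:R.
      by rewrite natrD ltrD2r ltr_pdivrMr.
    have [k1 k2] := andP (truncn_itv z0).
    have kK : (Num.truncn (g x / e + K%:R) < K + K)%N.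
      by rewrite -(ltr_nat R); exact: le_lt_trans zlt.
    rewrite -bigcup_seq; exists (Ordinal kK); first by rewrite /= mem_index_enum.
    rewrite /A /c /=.
    rewrite -ler_pdivlMr// lerBlDr k1 /=.
    rewrite -[X in _ + X](mul1r e) -mulrDl -ltr_pdivrMr//.
    by move: k2; rewrite -natr1; lra.
  rewrite ge0_integral_bigsetU//=.
  - rewrite (eq_bigr (fun j => (\int[mu]_(y in A j) (g y ^+ 2))%:E)); last first.
      by move=> j _; rewrite /Rintegral fineK//; exact: integrable_fin_num (igA j).
    by rewrite sumEFin lee_fin.
  - exact: index_enum_uniq.
  - exact: sub_trivIset tA.
  - exact: measurable_funTS.
  - by move=> x _; rewrite lee_fin sqr_ge0.
have tote (e : R) : 0 < e -> (\int[mu]_x (g x ^+ 2)%:E <= (B + e ^+ 2)%:E)%E.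
  move=> e0.
  pose F (K : nat) := [set x | - (K%:R * e) <= g x < K%:R * e].
  have FT : \bigcup_K F K = setT.
    apply/seteqP; split => // x _; exists (Num.truncn (`|g x| / e)).+1 => //; rewrite /F/=.
    have := truncnS_gt (`|g x| / e); rewrite ltr_pdivrMr// ltr_norml.
    by move=> /andP[h1 ->]; rewrite (ltW h1).
  have mF K : measurable (F K).
    rewrite (_ : F K = g @^-1` `[- (K%:R * e), K%:R * e[%classic).
      by rewrite -[X in measurable X]setTI; exact: mg.
    by apply/seteqP; split => x /=; rewrite in_itv.
  have ndF : nondecreasing_seq F.
    move=> K L KL; apply/subsetPset => x /= /andP[h1 h2].
    have KLe : K%:R * e <= L%:R * e by rewrite ler_pM2r// ler_nat.
    by apply/andP; split; [apply: le_trans h1; rewrite lerN2|exact: lt_le_trans KLe].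
  have F0 K x : F K x -> (0 <= (g x ^+ 2)%:E)%E by rewrite lee_fin sqr_ge0.
  have mgF K : measurable_fun (F K) (fun x => (g x ^+ 2)%:E) by exact: measurable_funTS.
  rewrite -FT; have := ge0_nondecreasing_set_cvg_integral (mu := mu) ndF mF mgF F0.
  move=> /cvg_lim <-//; apply: lime_le; last by near=> K; exact: cell.
  by apply: ereal_nondecreasing_is_cvgn; exact: ge0_nondecreasing_set_nondecreasing_integral.
apply/lee_addgt0Pr => e e0.
have := tote (Num.sqrt e); rewrite sqrtr_gt0 => /(_ e0).
by rewrite sqr_sqrtr ?(ltW e0).
Unshelve. all: by end_near. Qed.

End weak_limit.

(** * Primitives with respect to the distribution and their energy *)

Section energy.
Context (R : realType) (F : cumulativeBounded (0 : R) (1 : R)).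
Implicit Types (g h k : R -> R) (A : set R) (B : R).

Let mu : probability (measurableTypeR R) R := lebesgue_stieltjes_measure F.

Lemma stieltjes_ray t : mu `]-oo, t]%classic = (F t)%:E.
Proof.
by have := cdf_lebesgue_stieltjes_id F t; rewrite /cdf /distribution /pushforward preimage_id.
Qed.

Lemma measurable_ray (t : R) : measurable (`]-oo, t]%classic : set (measurableTypeR R)).
Proof. exact: measurable_itv. Qed.

Lemma measurable_oc (s t : R) : measurable (`]s, t]%classic : set (measurableTypeR R)).
Proof. exact: measurable_itv. Qed.

Lemma ray_setD (s t : R) : s <= t ->
  `]-oo, t]%classic `\` `]-oo, s]%classic = `]s, t]%classic :> set R.
Proof.
move=> st; apply/seteqP; split => x /=; rewrite !in_itv/= => h.
  by case: h => -> /negP; rewrite -ltNge => ->.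
by move: h => /andP[h ->]; split => //; apply/negP; rewrite -ltNge.
Qed.

Lemma ray_setU (s t : R) : s <= t ->
  `]-oo, t]%classic = `]-oo, s]%classic `|` `]s, t]%classic :> set R.
Proof.
move=> st; rewrite -(ray_setD st) setDUK// => x /=; rewrite !in_itv/= => xs.
exact: le_trans st.
Qed.

Lemma ray_disj (s t : R) : [disjoint `]-oo, s]%classic & `]s, t]%classic].
Proof.
rewrite disj_set2E; apply/eqP; apply/seteqP; split => // x [/=].
by rewrite !in_itv/= => xs /andP[/(le_lt_trans xs)]; rewrite ltxx.
Qed.

Lemma stieltjes_oc s t : s <= t -> mu `]s, t]%classic = (F t - F s)%:E.
Proof.
move=> st; rewrite -(ray_setD st) measureD//.
- rewrite setIidr; last first.
    by move=> x /=; rewrite !in_itv/= => xs; exact: le_trans st.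
  by rewrite EFinB; congr (_ - _)%E; exact: stieltjes_ray.
- by have := stieltjes_ray t => /= ->; rewrite ltry.
Qed.

Definition primitive g (t : R) : R := \int[mu]_(x in `]-oo, t]%classic) g x.

Lemma primitive_increment g B s t : sq_le mu g B -> s <= t ->
  primitive g t - primitive g s = \int[mu]_(x in `]s, t]%classic) g x.
Proof.
move=> sg st; rewrite /primitive (ray_setU st) Rintegral_setU//.
- by rewrite addrC addKr.
- rewrite -ray_setU//; apply: sq_le_integrable sg; exact: measurable_ray.
- exact: ray_disj.
Qed.

(** Cauchy-Schwarz on the interval between [s] and [t], of mass
    [`|F t - F s|]. *)
Lemma primitive_modulus g B s t : sq_le mu g B ->
  (primitive g t - primitive g s) ^+ 2 <= `|F t - F s| * B.
Proof.
move=> sg; wlog st : s t / s <= t.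
  move=> H; have [/H//|/ltW ts] := leP s t.
  by rewrite -sqrrN opprB distrC; exact: H.
rewrite (primitive_increment sg st).
apply: le_trans (cauchy_schwarz_le (measurable_oc s t) sg) _.
have : fine (mu `]s, t]%classic) = F t - F s by rewrite stieltjes_oc.
move=> ->; rewrite ger0_norm// subr_ge0; exact: cumulative_is_nondecreasing.
Qed.

Lemma primitive_small g B t : sq_le mu g B -> primitive g t ^+ 2 <= F t * B.
Proof.
move=> sg; apply: le_trans (cauchy_schwarz_le (measurable_ray t) sg) _.
by have -> : fine (mu `]-oo, t]%classic) = F t by rewrite stieltjes_ray.
Qed.

Lemma primitive_tail g B t : sq_le mu g B ->
  (\int[mu]_x g x - primitive g t) ^+ 2 <= (1 - F t) * B.
Proof.
move=> sg.
have mr := measurable_ray t.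
have mrC : measurable (~` (`]-oo, t]%classic : set (measurableTypeR R))) by exact: measurableC.
have -> : \int[mu]_x g x - primitive g t = \int[mu]_(x in ~` `]-oo, t]%classic) g x.
  rewrite -(setUv (`]-oo, t]%classic : set R)) Rintegral_setU//.
  - by rewrite addrC addKr.
  - by rewrite setUv; apply: sq_le_integrable sg.
  - by rewrite disj_set2E setICr.
apply: le_trans (cauchy_schwarz_le mrC sg) _.
have -> : fine (mu (~` `]-oo, t]%classic)) = 1 - F t; last by [].
have := probability_setC mu mr => /(congr1 fine)/= ->.
by rewrite stieltjes_ray.
Qed.

Lemma cumulative_le1 t : F t <= 1.
Proof. by rewrite -lee_fin -stieltjes_ray probability_le1//; exact: measurable_ray. Qed.

Lemma cumulative_ge0 t : 0 <= F t.
Proof. by rewrite -lee_fin -stieltjes_ray. Qed.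

Lemma sqr_cvg0 (T : Type) (U : set_system T) (FU : Filter U) (a b : T -> R) C :
  (\forall x \near U, a x ^+ 2 <= b x * C) -> b x @[x --> U] --> 0 ->
  `|a x| @[x --> U] --> 0.
Proof.
move=> ab b0; have bC : b x * C @[x --> U] --> 0.
  by rewrite -(mul0r C); apply: cvgM b0 _; exact: cvg_cst.
apply/cvgrPdist_le => e e0; move/cvgrPdist_le : bC => /(_ _ (exprn_gt0 2 e0)) bC.
near=> x; rewrite sub0r normrN normr_id.
rewrite -(@ler_pXn2r _ 2)// ?nnegrE ?(ltW e0)// -normrX ger0_norm ?sqr_ge0//.
apply: (@le_trans _ _ (b x * C)); first by near: x.
have : `|0 - b x * C| <= e ^+ 2 by near: x.
by rewrite sub0r normrN; apply: le_trans; exact: ler_norm.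
Unshelve. all: by end_near. Qed.

Lemma primitive_cvgNy g B : sq_le mu g B -> `|primitive g t| @[t --> -oo] --> 0.
Proof.
move=> sg; apply: (@sqr_cvg0 _ _ _ _ F B) (cumulativeNy F).
by apply: nearW => t; exact: primitive_small.
Qed.

Lemma primitive_cvgy g B : sq_le mu g B ->
  `|\int[mu]_x g x - primitive g t| @[t --> +oo] --> 0.
Proof.
move=> sg; apply: (@sqr_cvg0 _ _ _ _ (fun t => 1 - F t) B).
  by apply: nearW => t; exact: primitive_tail.
have : 1 - F x @[x --> +oo] --> (1 - 1 : R).
  by apply: cvgB; [exact: cvg_cst|exact: cumulativey].
by rewrite subrr.
Qed.

Lemma nondecreasing_cvg_Rintegral k (A : nat -> set (measurableTypeR R)) :
  mu.-integrable setT (EFin \o k) -> (forall n, measurable (A n)) ->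
  nondecreasing_seq A ->
  \int[mu]_(x in A n) k x @[n --> \oo] --> \int[mu]_(x in \bigcup_n A n) k x.
Proof.
move=> ik mA ndA.
have mU : measurable (\bigcup_n A n) by exact: bigcup_measurable.
have mk : measurable_fun setT (EFin \o k) by exact: measurable_int ik.
have m1 n : measurable_fun setT ((EFin \o k) \_ (A n)).
  by apply/(measurable_restrictT _ _).1 => //; exact: measurable_funTS.
have m2 : measurable_fun setT ((EFin \o k) \_ (\bigcup_n A n)).
  by apply/(measurable_restrictT _ _).1 => //; exact: measurable_funTS.
have c1 : {ae mu, forall x, setT x ->
    ((EFin \o k) \_ (A n)) x @[n --> \oo] --> ((EFin \o k) \_ (\bigcup_n A n)) x}.
  apply: aeW => x _; apply: cvg_near_cst.
  have [[m _ Amx]|nU] := pselect ((\bigcup_n A n) x).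
    near=> n; rewrite !patchE !mem_set//; first by exists m.
    have mn : (m <= n)%N by near: n; exact: nbhs_infty_ge.
    by have /subsetPset := ndA _ _ mn; apply.
  near=> n; rewrite !patchE !memNset// => Anx; by apply: nU; exists n.
have b1 : {ae mu, forall x, forall n, setT x ->
    (`|((EFin \o k) \_ (A n)) x| <= `|(EFin \o k) x|)%E}.
  by apply: aeW => x n _; rewrite patchE; case: ifPn => // _; rewrite abse0.
have [_ _] := dominated_convergence measurableT m1 m2 c1 (integrable_abse ik) b1.
rewrite -integral_mkcond => h.
rewrite (_ : (fun n => _) = (fun n => fine (\int[mu]_x ((EFin \o k) \_ (A n)) x)%E)); last first.
  by apply/funext => n; rewrite /Rintegral integral_mkcond.
apply: fine_cvg; rewrite /Rintegral fineK; first exact: h.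
by apply: (integrable_fin_num mU); exact: integrableS ik.
Unshelve. all: by end_near. Qed.

(** The measurable sets over which [k] has integral [0] form a lambda-system
    that contains the intervals [`]s, t]]. *)
Lemma primitive_inj k : mu.-integrable setT (EFin \o k) ->
  (forall t, primitive k t = 0) ->
  forall A : set (measurableTypeR R), measurable A -> \int[mu]_(x in A) k x = 0.
Proof.
move=> ik k0 A mA.
pose H : set (set (measurableTypeR R)) :=
  [set A | measurable A /\ \int[mu]_(x in A) k x = 0].
suff : H A by case.
have ndH : ndseq_closed H.
  move=> S ndS HS; have mS n : measurable (S n) by have [] := HS n.
  split; first exact: bigcup_measurable.
  have := nondecreasing_cvg_Rintegral ik mS ndS.
  rewrite (_ : (fun n => _) = cst 0); last by apply/funext => n; have [] := HS n.
  by move=> /cvg_lim <-//; rewrite lim_cst.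
apply: (@lambda_system_subset _ (@ocitv R) _ setT H) mA.
- exact: ocitvI.
- split => //.
  + have -> : [set: R] = \bigcup_n `]-oo, n%:R]%classic.
      apply/seteqP; split => // x _; exists (Num.truncn `|x|).+1 => //=.
      by rewrite in_itv/= (le_trans (ler_norm x))// ltW// truncnS_gt.
    apply: ndH => [m n mn|n].
      by apply/subsetPset => x /=; rewrite !in_itv/= => /le_trans; apply; rewrite ler_nat.
    by split; [exact: measurable_ray|exact: k0].
  + move=> S S' S'S [mS S0] [mS' S'0]; split; first exact: measurableD.
    have : \int[mu]_(x in S) k x = \int[mu]_(x in S') k x + \int[mu]_(x in S `\` S') k x.
      rewrite -{1}(setDUK S'S) Rintegral_setU//.
      * exact: measurableD.
      * by rewrite setDUK//; exact: integrableS ik.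
      * by rewrite disj_set2E setDIK.
    by rewrite S0 S'0 add0r.
- move=> _ [[s t] _ /= <-].
  split; first exact: measurable_oc.
  have [st|ts] := leP s t; last by rewrite set_itv_ge ?Rintegral_set0// bnd_simp -leNgt ltW.
  have := k0 t; rewrite /primitive (ray_setU st) Rintegral_setU//.
  + by rewrite -/(primitive k s) k0 add0r.
  + by apply: integrableS ik => //; apply: measurableU; [exact: measurable_ray|exact: measurable_oc].
  + exact: ray_disj.
- by [].
Qed.

(** Two derivatives have the same integrals over all measurable sets, by
    [primitive_inj], so they are equal almost everywhere: the energy in [I_F]
    does not depend on the version chosen there. *)
Lemma is_derivative_wrt_sq_unique (alpha g h : R -> R) :
  is_derivative_wrt F alpha g -> is_derivative_wrt F alpha h ->
  (\int[mu]_x (`|g x| ^+ 2)%:E = \int[mu]_x (`|h x| ^+ 2)%:E)%E.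
Proof.
move=> [ig ga] [ih ha].
have mg := measurable_int _ ig; have mh := measurable_int _ ih.
have mg' : measurable_fun setT (g : measurableTypeR R -> R) by exact/measurable_EFinP.
have mh' : measurable_fun setT (h : measurableTypeR R -> R) by exact/measurable_EFinP.
have iS (k : R -> R) (A : set (measurableTypeR R)) : mu.-integrable setT (EFin \o k) ->
    measurable A -> mu.-integrable A (EFin \o k).
  by move=> ik mA; exact: integrableS ik.
have gh0 (A : set (measurableTypeR R)) : measurable A ->
    \int[mu]_(x in A) g x = \int[mu]_(x in A) h x.
  move=> mA; apply/eqP; rewrite -subr_eq0 -RintegralB//; [|exact: iS|exact: iS].
  apply/eqP; apply: primitive_inj mA.
    by have := integrableB measurableT ig ih; apply: eq_integrable.
  move=> t; rewrite /primitive RintegralB//;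
    [|by apply: iS => //; exact: measurable_ray|by apply: iS => //; exact: measurable_ray].
  have := ga t; rewrite ha /Rintegral => ->; exact: subrr.
have gh : ae_eq mu setT (EFin \o g) (EFin \o h).
  apply: integral_ae_eq => // E _ mE.
  rewrite -[LHS]fineK; last exact: (integrable_fin_num mE (iS _ _ ig mE)).
  rewrite -[RHS]fineK; last exact: (integrable_fin_num mE (iS _ _ ih mE)).
  by congr EFin; exact: gh0.
apply: ge0_ae_eq_integral => //.
- by apply/measurable_EFinP; apply: measurable_funX; exact: measurableT_comp.
- by apply/measurable_EFinP; apply: measurable_funX; exact: measurableT_comp.
- by apply: filterS gh => x /= /(_ I) [->].
Qed.

Lemma primitiveE g B t : sq_le mu g B ->
  (primitive g t)%:E = (\int[mu]_(x in `]-oo, t]%classic) (g x)%:E)%E.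
Proof.
move=> sg; rewrite /primitive /Rintegral fineK//.
apply: (integrable_fin_num (measurable_ray t)).
by apply: sq_le_integrable sg; exact: measurable_ray.
Qed.

Lemma sq_normE g : (\int[mu]_x (`|g x| ^+ 2)%:E = \int[mu]_x (g x ^+ 2)%:E)%E.
Proof. by apply: eq_integral => x _; rewrite -normrX ger0_norm ?sqr_ge0. Qed.

Lemma I_F_primitive_le g B : sq_le mu g (2 * B) -> \int[mu]_x g x = 0 ->
  (I_F F (primitive g) <= B%:E)%E.
Proof.
move=> sg g0.
have dg : is_derivative_wrt F (primitive g) g.
  by split; [exact: sq_le_integrable sg|move=> t; exact: primitiveE sg].
rewrite /I_F; case: ifPn => [_|/asboolPn[]]; last first.
  split; first by exists g.
    have := primitive_cvgy sg; rewrite g0.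
    by under eq_fun do rewrite sub0r normrN.
  exact: primitive_cvgNy sg.
have -> : (\int[lebesgue_stieltjes_measure F]_x (`|derivative_wrt F (primitive g) x| ^+ 2)%:E)%E
    = (\int[mu]_x (`|g x| ^+ 2)%:E)%E.
  apply: is_derivative_wrt_sq_unique (dg).
  exact: (@xgetPex _ (fun=> 0) [set g' | is_derivative_wrt F (primitive g) g'] (ex_intro _ g dg)).
rewrite sq_normE; have [_ h] := sg.
rewrite -(@lee_pmul2l _ 2%:E)//.
by rewrite muleA -EFinM divff// mul1e.
Qed.

(** The primitive of [g] always vanishes at [-oo], and it tends to the integral
    of [g] at [+oo]; so the limit conditions in [I_F] mean that [g] has
    integral [0]. *)
Lemma I_F_lt alpha B : (I_F F alpha < B%:E)%E ->
  exists g, [/\ sq_le mu g (2 * B), alpha = primitive g & \int[mu]_x g x = 0].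
Proof.
rewrite /I_F; case: ifPn => [/asboolP[ex_g ay aNy]|_]; last by rewrite ltNge leey.
set g := derivative_wrt F alpha => gB.
have [ig ga] : is_derivative_wrt F alpha g by exact: xgetPex ex_g.
have sg : sq_le mu g (2 * B).
  split; first by apply/measurable_EFinP; exact: measurable_int ig.
  rewrite -sq_normE -(@lee_pmul2l _ (2^-1)%:E)//.
  by rewrite -EFinM mulrA mulVf// mul1r; exact: ltW gB.
have ag : alpha = primitive g.
  by apply/funext => t; apply: EFin_inj; rewrite (primitiveE t sg) ga.
exists g; split => //.
have h1 := primitive_cvgy sg; rewrite -ag in h1.
have : `|\int[mu]_x g x| <= 0.
  apply: (@cvg_le_bound _ _ (+oo : set_system R) _ (fun t => `|\int[mu]_x g x| - (`|\int[mu]_x g x - alpha t| + `|alpha t|))).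
    have : `|\int[mu]_x g x| - (`|\int[mu]_x g x - alpha t| + `|alpha t|) @[t --> +oo] -->
      `|\int[mu]_x g x| - (0 + 0).
      by apply: cvgB; [exact: cvg_cst|exact: cvgD].
    by rewrite addr0 subr0.
  apply: nearW => t; rewrite subr_le0.
  by rewrite -{1}(subrK (alpha t) (\int[mu]_x g x)) ler_normD.
by rewrite normr_le0 => /eqP.
Qed.

End energy.

(** * Quantiles, paths and the rate function *)

Section quantile_calculus.
Context {R : realType}.
Implicit Types (G : R -> R) (x y c : R).

Lemma quantile_le G x c : has_lbound [set y | x <= G y] -> x <= G c ->
  quantile G x <= c.
Proof. by move=> lb xc; exact: ge_inf. Qed.

Lemma quantile_ge G x c : {homo G : y z / y <= z} ->
  [set y | x <= G y] !=set0 -> G c < x -> c <= quantile G x.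
Proof.
move=> ndG ne Gcx; apply: lb_le_inf => // y /= xGy.
rewrite leNgt; apply/negP => /ltW/ndG Gyc.
by have := lt_le_trans Gcx (le_trans xGy Gyc); rewrite ltxx.
Qed.

End quantile_calculus.

Section quantile_F.
Context (R : realType) (p q : R) (p_gt0 : 0 < p) (pq : p < q) (q_lt1 : q < 1)
    (F : cumulativeBounded (0 : R) (1 : R)) (f : R -> R)
    (eps : R) (eps_gt0 : 0 < eps)
    (F_derive : forall x : R, x \in `[quantile F p - eps, quantile F q + eps] ->
       is_derive x 1 F (f x))
    (f_cont : {within `[quantile F p - eps, quantile F q + eps]%classic, continuous f})
    (f_gt0 : forall x : R, x \in `[quantile F p - eps, quantile F q + eps] ->
       0 < f x).

Let mu : probability (measurableTypeR R) R := lebesgue_stieltjes_measure F.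

Let F_nd : {homo F : x y / x <= y}.
Proof. exact: cumulative_is_nondecreasing. Qed.

Lemma superlevel_neq0 x : x < 1 -> [set y | x <= F y] !=set0.
Proof.
move=> x1; have /cvgrPdist_lt/(_ (1 - x)) := cumulativey F.
rewrite subr_gt0 => /(_ x1) [M [_ MF]]; exists (M + 1) => /=.
have := MF (M + 1); rewrite ltrDl ltr01 => /(_ isT).
by move=> /(le_lt_trans (ler_norm _)); rewrite ltrD2l ltrN2 => /ltW.
Qed.

Lemma superlevel_lbound x : 0 < x -> has_lbound [set y | x <= F y].
Proof.
move=> x0; have /cvgrPdist_lt/(_ x x0) [M [_ MF]] := cumulativeNy F.
exists M => y /= py; rewrite leNgt; apply/negP => /MF.
by rewrite sub0r normrN => /(le_lt_trans (ler_norm _)); rewrite ltNge py.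
Qed.

Lemma quantile_mono x y : 0 < x -> x <= y -> y < 1 -> quantile F x <= quantile F y.
Proof.
move=> x0 xy y1; apply: lb_le_inf; first exact: superlevel_neq0.
by move=> z /= yz; apply: ge_inf; [exact: superlevel_lbound|exact: le_trans yz].
Qed.

Lemma F_continuous_at y : y \in `[quantile F p - eps, quantile F q + eps] ->
  {for y, continuous F}.
Proof.
move=> /F_derive [dF _]; apply: differentiable_continuous.
exact/derivable1_diffP.
Qed.

Lemma quantile_itv x : p <= x <= q -> quantile F p <= quantile F x <= quantile F q.
Proof.
move=> /andP[px xq]; apply/andP; split; apply: quantile_mono => //.
- exact: le_lt_trans q_lt1.
- exact: lt_le_trans px.
Qed.

(** [F] is continuous at the quantile, so a gap between [x] and its value there
    would persist nearby, which contradicts the infimum. *)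
Lemma F_quantile x : p <= x <= q -> F (quantile F x) = x.
Proof.
move=> xpq; have /andP[px xq] := xpq.
have x0 : 0 < x by exact: lt_le_trans px.
have x1 : x < 1 by exact: le_lt_trans q_lt1.
set y := quantile F x.
have yJ : y \in `[quantile F p - eps, quantile F q + eps].
  rewrite in_itv/=; have := quantile_itv xpq; rewrite -/y => /andP[h1 h2].
  by have e0 := eps_gt0; apply/andP; split; lra.
have cF := F_continuous_at yJ.
have [Fx|xF|->//] := ltgtP (F y) x.
- exfalso; have : 0 < x - F y by rewrite subr_gt0.
  move/cvgrPdist_lt : cF => /[apply] -[e /= e0 He].
  have : y + e / 2 <= y.
    apply: quantile_ge => //; first exact: superlevel_neq0.
    have := He (y + e / 2); rewrite /ball_/= opprD addrA subrr sub0r normrN.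
    rewrite gtr0_norm ?divr_gt0// => /(_ (ltac:(lra))).
    by have := ler_norm (F (y + e / 2) - F y); rewrite distrC; lra.
  lra.
- exfalso; have : 0 < F y - x by rewrite subr_gt0.
  move/cvgrPdist_lt : cF => /[apply] -[e /= e0 He].
  have : y <= y - e / 2.
    apply: quantile_le; first exact: superlevel_lbound.
    have := He (y - e / 2); rewrite /ball_/= opprB addrC subrK.
    rewrite gtr0_norm ?divr_gt0// => /(_ (ltac:(lra))).
    by have := ler_norm (F y - F (y - e / 2)); lra.
  lra.
Qed.

Lemma quantile_pq_le : quantile F p <= quantile F q.
Proof. by have /andP[] := @quantile_itv p (ltac:(by rewrite lexx ltW)). Qed.

Lemma quantile_J x : p <= x <= q ->
  quantile F x \in `[quantile F p - eps, quantile F q + eps].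
Proof.
move=> /quantile_itv/andP[h1 h2]; rewrite in_itv/=; have e0 := eps_gt0; apply/andP; split; lra.
Qed.

Lemma f_bounds : exists m M : R, [/\ 0 < m, 0 < M &
  forall y, y \in `[quantile F p - eps, quantile F q + eps] -> m <= f y <= M].
Proof.
have ab : quantile F p - eps <= quantile F q + eps by have := quantile_pq_le; have := eps_gt0; lra.
have [c cJ cf] := EVT_min ab f_cont; have [e eJ ef] := EVT_max ab f_cont.
exists (f c), (f e); split; [exact: f_gt0|exact: f_gt0|].
by move=> y yJ; rewrite cf// ef.
Qed.

Definition grid (m j : nat) : R := p + (q - p) * (j%:R / m%:R).

Lemma grid_itv m j : (0 < m)%N -> (j <= m)%N -> p <= grid m j <= q.
Proof.
move=> m0 jm; have m0' : 0 < m%:R :> R by rewrite ltr0n.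
have h0 : 0 <= (j%:R / m%:R : R) by rewrite divr_ge0.
have h1 : (j%:R / m%:R : R) <= 1 by rewrite ler_pdivrMr// mul1r ler_nat.
have pq' := pq; rewrite /grid; apply/andP; split; nra.
Qed.

Lemma grid_near m x : (0 < m)%N -> p <= x <= q ->
  exists2 j, (j <= m)%N & `|x - grid m j| <= (q - p) / m%:R.
Proof.
move=> m0 /andP[px xq]; have m0' : 0 < m%:R :> R by rewrite ltr0n.
have pq' : 0 < q - p by rewrite subr_gt0.
pose z := (x - p) / (q - p) * m%:R.
have z0 : 0 <= z by rewrite mulr_ge0// divr_ge0// subr_ge0// ltW.
have /andP[z1 z2] := truncn_itv z0.
exists (Num.truncn z).
  rewrite -(ler_nat R); apply: le_trans z1 _; rewrite /z -[leRHS]mul1r ler_pM2r//.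
  by rewrite ler_pdivrMr// mul1r lerD2r.
have -> : x - grid m (Num.truncn z) = (q - p) / m%:R * (z - (Num.truncn z)%:R).
  rewrite /grid /z; field; by rewrite !gt_eqF.
rewrite normrM ger0_norm; last by rewrite divr_ge0// ltW.
rewrite -[leRHS]mulr1 ler_pM2l ?divr_gt0// ger0_norm ?subr_ge0//.
by move: z2; rewrite -natr1; lra.
Qed.

(** This turns estimates at finitely many points into uniform ones. *)
Lemma close_on_grid (a b : R -> R) (m : nat) (d1 d2 d3 : R) : (0 < m)%N ->
  (forall x y, p <= x <= q -> p <= y <= q -> `|x - y| <= (q - p) / m%:R -> `|a x - a y| <= d1) ->
  (forall x y, p <= x <= q -> p <= y <= q -> `|x - y| <= (q - p) / m%:R -> `|b x - b y| <= d2) ->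
  (forall j, (j <= m)%N -> `|a (grid m j) - b (grid m j)| <= d3) ->
  forall x, p <= x <= q -> `|a x - b x| <= d1 + d2 + d3.
Proof.
move=> m0 ha hb hab x xpq; have [j jm xj] := grid_near m0 xpq.
have h1 := ha _ _ xpq (grid_itv m0 jm) xj.
have h2 := hb _ _ xpq (grid_itv m0 jm) xj.
have h3 := hab _ jm.
rewrite (_ : a x - b x = (a x - a (grid m j)) - (b x - b (grid m j)) + (a (grid m j) - b (grid m j))); last by ring.
apply: le_trans (ler_normD _ _) _; apply: lerD h3.
by apply: le_trans (ler_normB _ _) _; exact: lerD.
Qed.

(** The element of the path space that [I_EQ] associates with the primitive of
    [g]. *)
Definition path_fun g (x : R) : R := - (primitive F g (quantile F x) / f (quantile F x)).

Lemma sqr_le_norm (a b : R) : 0 <= b -> a ^+ 2 <= b -> `|a| <= Num.sqrt b.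
Proof.
move=> b0 ab; rewrite -(@ler_pXn2r _ 2)// ?nnegrE ?sqrtr_ge0//.
by rewrite sqr_sqrtr// -normrX ger0_norm ?sqr_ge0.
Qed.

Lemma path_modulus g B x y : sq_le mu g B -> p <= x <= q -> p <= y <= q ->
  `|primitive F g (quantile F x) - primitive F g (quantile F y)| <= Num.sqrt (`|x - y| * B).
Proof.
move=> sg xpq ypq; apply: sqr_le_norm.
  by rewrite mulr_ge0// (sq_le_ge0 sg).
by rewrite -{2}(F_quantile xpq) -{2}(F_quantile ypq); exact: primitive_modulus.
Qed.

Lemma path_bounded g B : sq_le mu g B ->
  (fun x : `[p, q]%classic => path_fun g (val x)) \in bounded_functions.
Proof.
move=> sg; have [m [M [m0 M0 fmM]]] := f_bounds.
apply/Defs.bounded_funP; exists (Num.sqrt B / m) => -[x /=]; rewrite inE/= in_itv/= => xpq.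
have /andP[mf _] := fmM _ (quantile_J xpq).
rewrite normrN normrM ler_pM//.
  apply: sqr_le_norm; first exact: sq_le_ge0 sg.
  apply: le_trans (primitive_small _ sg) _.
  by rewrite -[leRHS]mul1r ler_wpM2r ?cumulative_le1// (sq_le_ge0 sg).
rewrite normfV lef_pV2 ?posrE ?normr_gt0 ?gt_eqF ?(lt_le_trans m0)//.
by rewrite (le_trans mf)// ler_norm.
Qed.

Lemma I_EQ_lt (phi : linfty R `[p, q]%classic) B : (I_EQ F f phi < B%:E)%E ->
  exists g, [/\ sq_le mu g (2 * B), \int[mu]_x g x = 0 &
    forall x : `[p, q]%classic, path_fun g (val x) = phi x].
Proof.
move=> /ereal_inf_lt[_ [alpha /= aphi <-]] /I_F_lt[g [sg ag g0]].
by exists g; split => // x; rewrite -aphi ag.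
Qed.

Lemma I_EQ_le (phi : linfty R `[p, q]%classic) g B : sq_le mu g (2 * B) ->
  \int[mu]_x g x = 0 ->
  (forall x : `[p, q]%classic, path_fun g (val x) = phi x) ->
  (I_EQ F f phi <= B%:E)%E.
Proof.
move=> sg g0 gphi; apply: le_trans (I_F_primitive_le sg g0).
by apply: ereal_inf_lbound; exists (primitive F g).
Qed.

Lemma I_EQ_ge0 (phi : linfty R `[p, q]%classic) : (0 <= I_EQ F f phi)%E.
Proof.
apply: le_ereal_inf_tmp => _ [alpha _ <-]; rewrite /I_F; case: ifPn => // _.
by rewrite mule_ge0// integral_ge0// => x _; rewrite lee_fin exprn_ge0.
Qed.

(** Along an ultrafilter of paths of rate at most [L], densities of energy at
    most [2 (L + e)] have a weak limit.  Integrating over half-lines, the paths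
    converge pointwise to the path of the limit density, and uniformly by
    [path_modulus].  The slack [e] is there because the infimum in [I_EQ] need
    not be attained a priori; the limit path does not depend on [e], so its
    rate is at most [L]. *)
Lemma rate_function_I_EQ : rate_function (@I_EQ R F f p q).
Proof.
split=> [|L]; first exact: I_EQ_ge0.
rewrite compact_ultra => U UU UL; have UF : ProperFilter U by exact: ultra_proper.
have [m [M [m0 M0 fmM]]] := f_bounds.
have lim_density (e : R) : 0 < e -> exists G : linfty R `[p, q]%classic -> R -> R,
  exists g, [/\ \forall phi \near U, sq_le mu (G phi) (2 * (L + e)) /\
       forall x : `[p, q]%classic, path_fun (G phi) (val x) = phi x,
    sq_le mu g (2 * (L + e)), \int[mu]_x g x = 0 &
    forall t, primitive F (G phi) t @[phi --> U] --> primitive F g t].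
  move=> e0.
  have /choice[G GP] : forall phi : linfty R `[p, q]%classic, exists g,
      (I_EQ F f phi <= L%:E)%E -> [/\ sq_le mu g (2 * (L + e)), \int[mu]_x g x = 0 &
      forall x : `[p, q]%classic, path_fun g (val x) = phi x].
    move=> phi; have [phiL|] := boolP (I_EQ F f phi <= L%:E)%E; last by exists (cst 0).
    have : (I_EQ F f phi < (L + e)%:E)%E.
      by apply: le_lt_trans phiL _; rewrite lte_fin ltrDl.
    by move=> /I_EQ_lt[g ?]; exists g.
  have GL : \forall phi \near U, sq_le mu (G phi) (2 * (L + e)).
    by apply: filterS UL => phi /GP[].
  have [g [sg gG]] := weak_compactness UU GL.
  exists G, g; split => //.
  - by apply: filterS UL => phi /GP[].
  - have := gG setT measurableT => h.
    have h0 : \int[mu]_y G phi y @[phi --> U] --> (0 : R).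
      apply: cvg_near_cst; by apply: filterS UL => phi /GP[].
    exact: (cvg_unique _ h h0).
  - by move=> t; apply: gG; exact: measurable_ray.
have path_lim (G : linfty R `[p, q]%classic -> R -> R) g B x :
    (\forall phi \near U, sq_le mu (G phi) B /\
       forall x : `[p, q]%classic, path_fun (G phi) (val x) = phi x) ->
    (forall t, primitive F (G phi) t @[phi --> U] --> primitive F g t) ->
    (linfty_val phi x) @[phi --> U] --> path_fun g (val x).
  move=> GB Gg.
  have : path_fun (G phi) (val x) @[phi --> U] --> path_fun g (val x).
    by apply: cvgN; apply: cvgM; [exact: Gg|exact: cvg_cst].
  move=> h; apply: cvg_trans h; apply: (@near_eq_cvg _ _ U _ (fun phi => path_fun (G phi) (val x)) (fun phi : linfty R `[p, q]%classic => linfty_val phi x)).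
  by apply: filterS GB => phi [_ ->].
have [G1 [g1 [GB1 sg1 g10 G1g]]] := lim_density 1 ltr01.
pose phi1 : linfty R `[p, q]%classic := Linfty (path_bounded sg1).
exists phi1; split; last first.
  (* pointwise convergence at the points of a grid fine enough for the common
     modulus of the paths *)
  apply/cvgrPdist_le => /= e e0.
  pose B := 2 * (L + 1).
  have B0 : 0 <= B by exact: sq_le_ge0 sg1.
  have em : 0 < e * m / 3 by rewrite divr_gt0 ?mulr_gt0.
  pose k := (Num.truncn ((q - p) * B / (e * m / 3) ^+ 2)).+1.
  have kP : Num.sqrt ((q - p) / k%:R * B) <= e * m / 3.
    rewrite -[leRHS](@ger0_norm _ (e * m / 3)) ?(ltW em)// -sqrtr_sqr.
    rewrite ler_wsqrtr// mulrAC ler_pdivrMr// [leRHS]mulrC -ler_pdivrMr ?exprn_gt0//.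
    by rewrite ltW// truncnS_gt.
  have near_grid : \forall phi \near U, forall j : 'I_k.+1,
     `|primitive F (G1 phi) (quantile F (grid k j)) - primitive F g1 (quantile F (grid k j))| <= e * m / 3.
    apply: filter_forall => j; have := G1g (quantile F (grid k j)).
    move=> /cvgrPdist_le/(_ _ em); apply: filterS => phi.
    by rewrite distrC.
  apply: filterS2 GB1 near_grid => phi [sG Gphi] ng.
  apply: sup_norm_le; first exact: ltW.
  move=> x; have xpq : p <= val x <= q by have := set_valP x; rewrite /= in_itv.
  rewrite -[(phi1 - phi) x]/(path_fun g1 (val x) - phi x) -Gphi.
  rewrite /path_fun opprK addrC -mulrBl normrM normfV.
  have /andP[mf _] := fmM _ (quantile_J xpq).
  rewrite ler_pdivrMr ?normr_gt0 ?gt_eqF ?(lt_le_trans m0)//.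
  apply: (@le_trans _ _ (e * m)); last first.
    by rewrite ler_wpM2l ?(ltW e0)// (le_trans mf)// ler_norm.
  rewrite (_ : e * m = e * m / 3 + e * m / 3 + e * m / 3); last by field.
  have modulus g : sq_le mu g B -> forall x y, p <= x <= q -> p <= y <= q ->
      `|x - y| <= (q - p) / k%:R ->
      `|primitive F g (quantile F x) - primitive F g (quantile F y)| <= e * m / 3.
    move=> sg u v upq vpq uv; apply: le_trans (path_modulus sg upq vpq) (le_trans _ kP).
    by rewrite ler_wsqrtr// ler_wpM2r.
  apply: (@close_on_grid (primitive F (G1 phi) \o quantile F) (primitive F g1 \o quantile F) k) => //=.
  - exact: modulus.
  - exact: modulus.
  - by move=> j jk; exact: (ng (Ordinal (jk : (j < k.+1)%N))).
apply/lee_addgt0Pr => e e0.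
have [G [g [GB sg g0 Gg]]] := lim_density e e0.
rewrite -EFinD; apply: (I_EQ_le sg g0) => x.
exact: (cvg_unique _ (path_lim _ _ _ x GB Gg) (path_lim _ _ _ x GB1 G1g)).
Qed.

End quantile_F.

(** * From the sample to words *)

Section sample_transfer.
Context d (T : measurableType d) (R : realType) (P : probability T R)
  (F : cumulativeBounded (0 : R) (1 : R)) (X : nat -> {RV P >-> R})
  (X_iid : iid_from F X).

Let mu : probability (measurableTypeR R) R := lebesgue_stieltjes_measure F.

(** A law on the line is determined by its distribution function. *)
Lemma sample_law i (B : set R) : measurable B -> P (X i @^-1` B) = mu B.
Proof.
move=> mB; symmetry.
pose nu (A : set (measurableTypeR R)) : \bar R := distribution P (X i) A.
pose nuM : {measure set (measurableTypeR R) -> \bar R} := HB.pack nu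
  (isMeasure.Build _ (measurableTypeR R) R nu (measure0 (distribution P (X i)))
    (measure_ge0 (distribution P (X i)))
    (@measure_semi_sigma_additive _ _ _ (distribution P (X i)))).
suff H : forall A, ocitv A -> lebesgue_stieltjes_measure F A = nuM A.
  exact: (@lebesgue_stieltjes_measure_unique R F nuM H B mB).
move=> _ [[s t] _ /= <-].
have [st|ts] := leP s t; last by rewrite set_itv_ge ?measure0// bnd_simp -leNgt ltW.
transitivity (F t - F s)%:E; first exact: (stieltjes_oc F st).
have [_ cdfE] := X_iid.
rewrite -[RHS]/(distribution P (X i) `]s, t]%classic) -(ray_setD st) measureD//=; last first.
  by apply: le_lt_trans (ltry 1); exact: probability_le1.
rewrite setIidr; last by move=> x /=; rewrite !in_itv/= => xs; exact: le_trans st.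
by rewrite EFinB -!(cdfE i).
Qed.

Context (I : finType) (c : R -> I) (mc : forall j, measurable (c @^-1` [set j])).

Definition sample_word n (t : T) : {ffun 'I_n -> I} := [ffun l : 'I_n => c (X l t)].

Let w j := fine (mu (c @^-1` [set j])).

Lemma sample_word1 n (k : {ffun 'I_n -> I}) :
  measurable [set t | sample_word n t = k] /\
  P [set t | sample_word n t = k] = (\prod_(l < n) w (k l))%:E.
Proof.
pose J := [fset i | i in iota 0 n]%fset.
pose B (i : nat) := if insub i is Some l then c @^-1` [set k l] else setT : set R.
have mB i : measurable (B i) by rewrite /B; case: insubP => [l _ _|_]; [exact: mc|].
have E : [set t | sample_word n t = k] = \bigcap_(i in [set` J]) X i @^-1` B i.
  apply/seteqP; split => t /=.
    move=> kE i /=; rewrite !inE mem_iota /= add0n => i_n.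
    by rewrite /B insubT /= -kE ffunE.
  move=> h; apply/ffunP => l; rewrite ffunE.
  have /h : [set` J] (val l) by rewrite /= !inE mem_iota /= add0n.
  by rewrite /= /B valK.
rewrite E; split.
  apply: fin_bigcap_measurable => [|i _]; first exact: finite_fset.
  by rewrite -[X in measurable X]setTI; exact: measurable_funP.
have [indep _] := X_iid.
rewrite indep// (perm_big (iota 0 n)) /=; last first.
  apply: uniq_perm; [exact: fset_uniq|exact: iota_uniq|].
  by move=> i; rewrite !inE.
rewrite -{1}(subn0 n) big_mkord -prodEFin; apply: eq_bigr => l _.
rewrite sample_law// /w fineK ?fin_num_measure//.
by rewrite /B valK.
exact: mc.
Qed.

(** Events that depend only on the cells of the sample points reduce to finite
    sums over words. *)
Lemma sample_word_prob n (S : pred {ffun 'I_n -> I}) :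
  measurable [set t | S (sample_word n t)] /\
  P [set t | S (sample_word n t)] = (word_prob w S)%:E.
Proof.
have E : [set t | S (sample_word n t)] =
    \big[setU/set0]_(k | S k) [set t | sample_word n t = k].
  apply/seteqP; split => t /=.
    by move=> St; rewrite -bigcup_seq_cond /=; exists (sample_word n t) => //=; rewrite mem_index_enum.
  by rewrite -bigcup_seq_cond => -[k /= /andP[_ Sk] ->].
rewrite E; split.
  by apply: bigsetU_measurable => k _; have [] := sample_word1 k.
rewrite /word_prob -sumEFin -[X in P X]big_filter -[RHS]big_filter.
have : uniq [seq k <- index_enum _ | S k] by rewrite filter_uniq// index_enum_uniq.
elim: [seq k <- index_enum _ | S k] => [|k s IH] /=; first by rewrite !big_nil measure0.
move=> /andP[ks us]; rewrite !big_cons measureU.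
- by congr (_ + _)%E; [exact: (sample_word1 k).2|exact: IH].
- by have [] := sample_word1 k.
- by apply: bigsetU_measurable => j _; have [] := sample_word1 j.
- apply/seteqP; split => // t [/= tk].
  rewrite -bigcup_seq => -[j /= js tj].
  by move: ks; rewrite -tk tj js.
Qed.

Lemma sample_weight_sum : \sum_j w j = 1.
Proof.
have := @sample_word_prob 1%N predT; rewrite /= => -[_].
have -> : [set t : T | true] = setT by apply/seteqP.
rewrite probability_setT => -[]; rewrite /word_prob.
by rewrite word_sum expr1 => <-.
Qed.

End sample_transfer.

Section empirical_deviation.
Context d (T : measurableType d) (R : realType) (P : probability T R)
  (F : cumulativeBounded (0 : R) (1 : R)) (X : nat -> {RV P >-> R})
  (X_iid : iid_from F X).

Let mu : probability (measurableTypeR R) R := lebesgue_stieltjes_measure F.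

Definition dev n t s : R := empirical_cdf X n t s - F s.

Lemma empirical_cdf_nd n t : {homo empirical_cdf X n t : x y / x <= y}.
Proof.
move=> x y xy; rewrite /empirical_cdf ler_wpM2l ?invr_ge0//.
apply: ler_sum => i _; rewrite ler_nat; case: (leP (X i t) x) => //= h.
by rewrite (le_trans h xy).
Qed.

(** [word_bernstein] for the two-letter alphabet that tells whether a sample
    point is in [B]. *)
Lemma dev_bernstein (B : set R) h (D : T -> R) n u tau lam :
  measurable B -> mu B = h%:E ->
  (forall t, n%:R * D t = \sum_(l < n) (`[< B (X l t) >])%:R - n%:R * h) ->
  (0 < n)%N -> 0 <= u -> 0 <= tau -> u * tau <= 1 / 2 ->
  measurable [set t | u * lam <= `|D t|] /\
  (P [set t | (u * lam <= `|D t|)%R] <=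
    (2 * expR (- (n%:R * u ^+ 2 * (tau * lam - tau ^+ 2 * h))))%:E)%E.
Proof.
move=> mB Bh DE n0 u0 t0 ut.
pose c x : bool := `[< B x >].
have cB : c @^-1` [set true] = B.
  by apply/seteqP; split => x /=; rewrite /c => /asboolP.
have cBC : c @^-1` [set false] = ~` B.
  apply/seteqP; split => x /=; rewrite /c; first by move=> /asboolPn.
  by move=> /asboolPn/negbTE.
have mc j : measurable (c @^-1` [set j]).
  by case: j; rewrite ?cB ?cBC//; exact: measurableC.
pose w j := fine (mu (c @^-1` [set j])).
have w0 j : 0 <= w j by exact: fine_ge0.
have w1 : \sum_j w j = 1 by exact: (sample_weight_sum X_iid mc).
have wh : \sum_(j | id j) w j = h.
  rewrite (bigD1 true)//= big1 ?addr0; last by case.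
  by rewrite /w cB Bh.
have E : [set t | u * lam <= `|D t|] = [set t | (fun k : {ffun 'I_n -> bool} =>
    n%:R * u * lam <= `|letter_count k id - n%:R * \sum_(j | id j) w j|)
      (sample_word X c n t)].
  have key t : letter_count (sample_word X c n t) id - n%:R * h = n%:R * D t.
    by rewrite DE; congr (_ - _); apply: eq_bigr => l _; rewrite ffunE.
  by apply/seteqP; split => t /=; rewrite wh key normrM ger0_norm// -mulrA ler_pM2l ?ltr0n.
rewrite E; have [mE ->] := sample_word_prob X_iid mc (n := n) (fun k : {ffun 'I_n -> bool} =>
    n%:R * u * lam <= `|letter_count k id - n%:R * \sum_(j | id j) w j|).
split => //; rewrite lee_fin; apply: le_trans (@word_bernstein R _ w n id u tau lam w0 w1 u0 t0 ut) _.
by rewrite wh.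
Qed.

Lemma dev_oc_bernstein n u tau lam s r : s <= r ->
  (0 < n)%N -> 0 <= u -> 0 <= tau -> u * tau <= 1 / 2 ->
  measurable [set t | u * lam <= `|dev n t r - dev n t s|] /\
  (P [set t | (u * lam <= `|dev n t r - dev n t s|)%R] <=
    (2 * expR (- (n%:R * u ^+ 2 * (tau * lam - tau ^+ 2 * (F r - F s)))))%:E)%E.
Proof.
move=> sr n0; apply: (@dev_bernstein `]s, r]%classic) => //.
- exact: stieltjes_oc.
- move=> t; rewrite /dev /empirical_cdf.
  have n0' : n%:R != 0 :> R by rewrite pnatr_eq0 -lt0n.
  rewrite (_ : _ * _ = \sum_(i < n) (X i t <= r)%R%:R - \sum_(i < n) (X i t <= s)%R%:R - n%:R * (F r - F s)); last by field.
  congr (_ - _); rewrite -sumrB; apply: eq_bigr => i _.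
  rewrite (_ : `[< _ >] = (s < X i t <= r)); last first.
    by apply/asboolP/idP; rewrite /= in_itv.
  by case: (leP (X i t) s) => h /=; rewrite ?(le_trans h sr) ?subrr ?subr0.
Qed.

Lemma dev_ray_bernstein n u tau lam s :
  (0 < n)%N -> 0 <= u -> 0 <= tau -> u * tau <= 1 / 2 ->
  measurable [set t | u * lam <= `|dev n t s|] /\
  (P [set t | (u * lam <= `|dev n t s|)%R] <=
    (2 * expR (- (n%:R * u ^+ 2 * (tau * lam - tau ^+ 2 * F s))))%:E)%E.
Proof.
move=> n0; apply: (@dev_bernstein `]-oo, s]%classic) => //.
- exact: stieltjes_ray.
- move=> t; rewrite /dev /empirical_cdf.
  have n0' : n%:R != 0 :> R by rewrite pnatr_eq0 -lt0n.
  rewrite (_ : _ * _ = \sum_(i < n) (X i t <= s)%R%:R - n%:R * F s); last by field.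
  congr (_ - _); apply: eq_bigr => i _.
  rewrite (_ : `[< _ >] = (X i t <= s))//.
  by apply/asboolP/idP; rewrite /= in_itv.
Qed.

End empirical_deviation.

(** * Oscillations of the empirical process *)

Section chaining.
Context {R : realType}.

Lemma expR_two_quarter : expR (- 2) <= 1 / 4 :> R.
Proof.
have e1 : 2 <= expR 1 :> R by have := expR_ge1Dx (1 : R).
have e2 : 4 <= expR 2 :> R.
  rewrite (_ : 2 = 1 + 1 :> R)// expRD.
  apply: (@le_trans _ _ (2 * 2)); first by lra.
  by apply: ler_pM.
by rewrite expRN mul1r lef_pV2 ?posrE ?expR_gt0//; lra.
Qed.

(** The [i]-th chaining level has [2 ^ i] times as many intervals as the first
    one, but with thresholds decreasing like [(3 / 4) ^ i] and masses like
    [(1 / 2) ^ i] its Bernstein exponent grows like [(9 / 8) ^ i], which wins. *)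
Lemma chaining_level (K N : R) i : 16 <= N * K ->
  2 ^+ i * expR (- (N * (K * (9 / 8) ^+ i))) <= expR (- (N * K)) * (1 / 2) ^+ i.
Proof.
move=> NK.
have pow : 1 + i%:R / 8 <= (9 / 8) ^+ i :> R.
  elim: i => [|i IH]; first by rewrite mul0r addr0 expr0.
  rewrite exprS -natr1; have i0 : 0 <= i%:R :> R by [].
  nra.
apply: (@le_trans _ _ (2 ^+ i * (expR (- (N * K)) * expR (- 2) ^+ i))).
  rewrite ler_pM2l ?exprn_gt0// -expRM_natl -expRD ler_expR.
  have i0 : 0 <= i%:R :> R by [].
  rewrite mulrA; nra.
rewrite mulrCA ler_pM2l ?expR_gt0// -exprMn.
rewrite lerXn2r ?nnegrE ?mulr_ge0 ?expR_ge0//.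
have := expR_two_quarter; lra.
Qed.

Lemma geometric_half_le n : \sum_(i < n) (1 / 2) ^+ i <= 2 :> R.
Proof.
suff -> : \sum_(i < n) (1 / 2) ^+ i = 2 - 2 * (1 / 2) ^+ n :> R.
  by have := @exprn_ge0 R n (1 / 2) (ltac:(lra)); lra.
elim: n => [|n IH]; first by rewrite big_ord0 expr0; ring.
by rewrite big_ord_recr/= IH exprS; field.
Qed.

End chaining.

Section union_bound.
Context d (T : measurableType d) (R : realType) (P : probability T R).

Lemma union_bound (I : finType) (E : I -> set T) (b : I -> R) :
  (forall i, measurable (E i) /\ (P (E i) <= (b i)%:E)%E) ->
  measurable (\big[setU/set0]_i E i) /\
  (P (\big[setU/set0]_i E i) <= (\sum_i b i)%:E)%E.
Proof.
move=> Eb; elim/big_ind2 : _ => [|A x B y [mA Ax] [mB By]|i _]; last exact: Eb.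
- by split => //; rewrite measure0.
- split; first exact: measurableU.
  apply: (@le_trans _ _ (P x + P y)%E); first exact: measureU2.
  by rewrite EFinD; exact: leeD.
Qed.

End union_bound.

Section oscillation.
Context d (T : measurableType d) (R : realType) (P : probability T R)
  (F : cumulativeBounded (0 : R) (1 : R)) (X : nat -> {RV P >-> R})
  (X_iid : iid_from F X) (y1 y2 : R) (y12 : y1 < y2)
  (F_inc : forall s r, y1 <= s -> s < r -> r <= y2 -> F s < F r)
  (F_onto : forall x, F y1 <= x <= F y2 -> exists2 y, y1 <= y <= y2 & F y = x).

Let l := F y2 - F y1.

Let l_gt0 : 0 < l.
Proof. by rewrite subr_gt0 F_inc. Qed.

Let l_le1 : l <= 1.
Proof.
by have := cumulative_le1 F y2; have := cumulative_ge0 F y1; rewrite /l; lra.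
Qed.

Let zpt x := xget y1 [set y | y1 <= y <= y2 /\ F y = x].

Let zptP x : F y1 <= x <= F y2 -> y1 <= zpt x <= y2 /\ F (zpt x) = x.
Proof.
move=> /F_onto[y yy Fy].
exact: (@xgetPex _ y1 [set y | y1 <= y <= y2 /\ F y = x] (ex_intro _ y (conj yy Fy))).
Qed.

(** Left end of the [k]-th interval of level [j]: the levels are dyadic for
    the values of [F]. *)
Let lv (j k : nat) := zpt (F y1 + l * (k%:R / 2 ^+ j)).

Let lvP j k : (k <= 2 ^ j)%N ->
  y1 <= lv j k <= y2 /\ F (lv j k) = F y1 + l * (k%:R / 2 ^+ j).
Proof.
move=> kj; apply: zptP.
have j0 : 0 < 2 ^+ j :> R by rewrite exprn_gt0.
have h0 : 0 <= k%:R / 2 ^+ j :> R by rewrite divr_ge0// ltW.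
have h1 : k%:R / 2 ^+ j <= 1 :> R by rewrite ler_pdivrMr// mul1r -natrX ler_nat.
have := l_gt0; rewrite -(subrK (F y1) (F y2)) -/l => l0.
by apply/andP; split; nra.
Qed.

Let lvS j k : lv j.+1 (k.*2) = lv j k.
Proof.
rewrite /lv; congr (zpt (_ + l * _)).
by rewrite -muln2 natrM exprS; field; rewrite expf_neq0.
Qed.

(** Index of the interval of level [j] that contains [s]. *)
Let kap j s := Num.truncn ((F s - F y1) / l * 2 ^+ j).

Let ratio_ge0 j s : y1 <= s -> 0 <= (F s - F y1) / l * 2 ^+ j.
Proof.
move=> ys; rewrite mulr_ge0 ?exprn_ge0// divr_ge0 ?(ltW l_gt0)// subr_ge0.
exact: cumulative_is_nondecreasing.
Qed.

Let kap_itv j s : y1 <= s -> (kap j s)%:R <= (F s - F y1) / l * 2 ^+ j < (kap j s)%:R + 1.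
Proof. by move=> ys; rewrite natr1; exact: truncn_itv (ratio_ge0 j ys). Qed.

Let kap_le j s : y1 <= s <= y2 -> (kap j s <= 2 ^ j)%N.
Proof.
move=> /andP[ys sy]; rewrite -(ler_nat R) natrX.
have /andP[h _] := kap_itv j ys; apply: le_trans h _.
rewrite -[leRHS]mul1r ler_pM2r ?exprn_gt0// ler_pdivrMr// mul1r lerD2r.
exact: cumulative_is_nondecreasing.
Qed.

Let kapS j s : y1 <= s -> kap j.+1 s = (kap j s).*2 \/ kap j.+1 s = (kap j s).*2.+1.
Proof.
move=> ys; have /andP[a1 a2] := kap_itv j ys; have /andP[b1 b2] := kap_itv j.+1 ys.
rewrite exprS mulrCA in b1 b2.
set z := (F s - F y1) / l * 2 ^+ j in a1 a2 b1 b2.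
have c1 : ((kap j s).*2 < (kap j.+1 s).+1)%N.
  by rewrite -(ltr_nat R) -natr1 -muln2 natrM; lra.
have c2 : (kap j.+1 s < (kap j s).*2.+2)%N.
  by rewrite -(ltr_nat R) -addn2 natrD -muln2 natrM; lra.
move: c1 c2; rewrite !ltnS => c1; rewrite leq_eqVlt => /orP[/eqP|]; first by right.
by rewrite ltnS => c2; left; apply/eqP; rewrite eqn_leq c1 c2.
Qed.

Let lam (lam0 : R) i := lam0 * (3 / 4) ^+ i.

Let lam_le lam0 i : 0 < lam0 -> lam lam0 i <= lam0.
Proof.
move=> l0; rewrite /lam ler_piMr ?(ltW l0)//; apply: exprn_ile1; lra.
Qed.

(** Between two successive levels the left end of the interval of [s] either
    stays or moves by one interval of the finer level. *)
Let chain (D : R -> R) (lam0 u : R) j0 m s : 0 <= lam0 -> 0 <= u -> y1 <= s <= y2 ->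
  (forall i k, (i <= m)%N -> (k < 2 ^ (j0 + i))%N ->
    `|D (lv (j0 + i) k.+1) - D (lv (j0 + i) k)| <= u * lam lam0 i) ->
  `|D (lv (j0 + m) (kap (j0 + m) s)) - D (lv j0 (kap j0 s))| <=
    u * \sum_(i < m) lam lam0 i.+1.
Proof.
move=> l0 u0 sy; have /andP[ys _] := sy; elim: m => [|m IH] H.
  by rewrite addn0 subrr normr0 big_ord0 mulr0.
have {}IH := IH (fun i k im => H i k (leqW im)).
rewrite big_ord_recr/= mulrDr addnS.
rewrite -[X in `|X|](subrKA (D (lv (j0 + m) (kap (j0 + m) s)))) addrC.
apply: le_trans (ler_normD _ _) _; rewrite lerD//.
have := kap_le (j0 + m).+1 sy; have := H m.+1 (kap (j0 + m) s).*2 (leqnn _).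
rewrite addnS; case: (kapS (j0 + m) ys) => ->.
  by rewrite lvS subrr normr0 => _ _; rewrite !mulr_ge0 ?exprn_ge0.
by move=> h kle; have := h kle; rewrite lvS.
Qed.

Let lam_sum lam0 m : 0 <= lam0 -> \sum_(i < m) lam lam0 i.+1 <= 3 * lam0.
Proof.
move=> l0.
suff -> : \sum_(i < m) lam lam0 i.+1 = 3 * lam0 - 3 * lam lam0 m.
  by have : 0 <= lam lam0 m; [rewrite mulr_ge0 ?exprn_ge0//|]; lra.
elim: m => [|m IH]; first by rewrite big_ord0 /lam expr0; ring.
by rewrite big_ord_recr/= IH /lam exprS; field.
Qed.

(** Chaining from the level [j0] down to the last level whose intervals have
    mass at least [lam0 * u]; the thresholds [lam0 * (3 / 4) ^ i] of the levels
    have a finite sum.  Below the last level no probability is needed, since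
    [F_n] and [F] are monotone and [F] moves by less than [2 * lam0 * u]. *)
Lemma oscillation_bound n (u lam0 : R) j0 :
  (0 < n)%N -> 0 < u -> 0 < lam0 -> lam0 * u <= l / 2 ^+ j0 ->
  16 <= n%:R * u ^+ 2 * (lam0 ^+ 2 * 2 ^+ j0 / 4) ->
  exists Bad : set T, [/\ measurable Bad,
    (P Bad <= (2 ^+ (j0 + 2) * expR (- (n%:R * u ^+ 2 * (lam0 ^+ 2 * 2 ^+ j0 / 4))))%:E)%E &
    forall t, ~ Bad t -> forall s r, y1 <= s <= y2 -> y1 <= r <= y2 ->
      `|F s - F r| <= l / 2 ^+ j0 ->
      `|dev F X n t s - dev F X n t r| <= 13 * lam0 * u].
Proof.
move=> n0 u0 lam00 lamu NK; set K := lam0 ^+ 2 * 2 ^+ j0 / 4 in NK *.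
have lu0 : 0 < lam0 * u by rewrite mulr_gt0.
(* [j0 + m] is the last chained level: below it monotonicity takes over *)
have [m lm lmS] : exists2 m, lam0 * u <= l / 2 ^+ (j0 + m) &
    l / 2 ^+ (j0 + m.+1) < lam0 * u.
  have ex : exists m, lam0 * u <= l / 2 ^+ (j0 + m) by exists 0%N; rewrite addn0.
  have bnd m : lam0 * u <= l / 2 ^+ (j0 + m) -> (m <= Num.truncn (l / (lam0 * u)))%N.
    rewrite ler_pdivlMr ?exprn_gt0// mulrC -ler_pdivlMr// => h.
    have : m%:R < (Num.truncn (l / (lam0 * u))).+1%:R :> R.
      apply: le_lt_trans (truncnS_gt _); apply: le_trans h.
      rewrite -natrX ler_nat; apply: leq_trans (ltnW (ltn_expl _ (ltnSn 1))).
      exact: leq_addl.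
    by rewrite ltr_nat ltnS.
  have [m lm mx] := ex_maxnP ex bnd; exists m => //.
  by rewrite ltNge; apply/negP => /mx; rewrite ltnn.
pose E (i : 'I_m.+1) (k : 'I_(2 ^ (j0 + i))) := [set t | u * lam lam0 i <=
  `|dev F X n t (lv (j0 + i) k.+1) - dev F X n t (lv (j0 + i) k)|].
have powle (i : 'I_m.+1) : 2 ^+ (j0 + i) <= 2 ^+ (j0 + m) :> R.
  by rewrite ler_eXn2l// ?ltr1n// leq_add2l -ltnS.
have EP i k : measurable (E i k) /\ (P (E i k) <=
    (2 * expR (- (n%:R * u ^+ 2 * (K * (9 / 8) ^+ i))))%:E)%E.
  have [/andP[z1 z2] Fz] := lvP (ltnW (ltn_ord k)).
  have [/andP[w1 w2] Fw] := lvP (ltn_ord k).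
  have p2 : 0 < 2 ^+ (j0 + i) :> R by rewrite exprn_gt0.
  pose h := l / 2 ^+ (j0 + i).
  have h0 : 0 < h by rewrite divr_gt0.
  have FF : F (lv (j0 + i) k.+1) - F (lv (j0 + i) k) = h.
    by rewrite Fz Fw -natr1 /h; field; rewrite gt_eqF.
  have zw : lv (j0 + i) k <= lv (j0 + i) k.+1.
    rewrite leNgt; apply/negP => /(@ltW _ _)/(cumulative_is_nondecreasing F).
    by rewrite -subr_ge0 -oppr_le0 opprB FF leNgt h0.
  have li0 : 0 <= lam lam0 i by rewrite mulr_ge0 ?exprn_ge0// ltW.
  have lile : lam lam0 i <= lam0.
    exact: lam_le.
  have lih : lam lam0 i * u <= h.
    apply: (@le_trans _ _ (lam0 * u)); first by rewrite ler_pM2r.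
    by apply: le_trans lm _; rewrite ler_pM2l// lef_pV2 ?posrE ?exprn_gt0.
  have tau0 : 0 <= lam lam0 i / (2 * h) by rewrite divr_ge0// mulr_ge0// ltW.
  have tauu : u * (lam lam0 i / (2 * h)) <= 1 / 2.
    rewrite mulrA ler_pdivrMr ?mulr_gt0// mulrC.
    by apply: le_trans lih _; rewrite mulrA; lra.
  have [mE PE] := dev_oc_bernstein X_iid (lam lam0 i) zw n0 (ltW u0) tau0 tauu.
  split => //; apply: le_trans PE _; rewrite lee_fin ler_pM2l// ler_expR lerN2.
  rewrite ler_wpM2l ?mulr_ge0 ?exprn_ge0 ?(ltW u0)// FF.
  rewrite [leRHS](_ : _ = lam lam0 i ^+ 2 / (4 * h)); last by field; rewrite gt_eqF.
  rewrite /lam /K [(lam0 * _) ^+ 2]exprMn.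
  have -> : ((3 / 4) ^+ i) ^+ 2 = (9 / 8) ^+ i / 2 ^+ i :> R.
    by rewrite -exprM mulnC exprM -expr_div_n; congr (_ ^+ i); field.
  rewrite /h exprD.
  rewrite [leRHS](_ : _ = lam0 ^+ 2 * 2 ^+ j0 / 4 * (9 / 8) ^+ i / l); last first.
    by field; rewrite !gt_eqF ?exprn_gt0.
  have K0 : 0 <= lam0 ^+ 2 * 2 ^+ j0 / 4 by rewrite divr_ge0// mulr_ge0 ?exprn_ge0// ltW.
  have p98 : 0 <= (9 / 8) ^+ i :> R by rewrite exprn_ge0.
  by rewrite ler_pdivlMr// ler_piMr// mulr_ge0.
pose bi (i : 'I_m.+1) := (2 ^ (j0 + i))%:R * (2 * expR (- (n%:R * u ^+ 2 * (K * (9 / 8) ^+ i)))).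
have LP (i : 'I_m.+1) : measurable (\big[setU/set0]_k E i k) /\
    (P (\big[setU/set0]_k E i k) <= (bi i)%:E)%E.
  have := union_bound (EP i); rewrite sum_cst card_ord; exact.
have [mBad PBad] := union_bound LP.
exists (\big[setU/set0]_i \big[setU/set0]_k E i k); split => //.
  apply: le_trans PBad _; rewrite lee_fin.
  apply: (@le_trans _ _ (\sum_(i < m.+1) 2 ^+ (j0 + 1) * (expR (- (n%:R * u ^+ 2 * K)) * (1 / 2) ^+ i))).
    apply: ler_sum => i _; have cl := @chaining_level R K (n%:R * u ^+ 2) i NK.
    rewrite /bi natrX; set e := expR _ in cl *.
    rewrite (_ : _ * (2 * e) = 2 ^+ (j0 + 1) * (2 ^+ i * e)); last first.
      by rewrite !exprD expr1; ring.
    by rewrite ler_pM2l ?exprn_gt0.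
  rewrite -mulr_sumr -mulr_sumr; set e := expR _.
  rewrite (_ : 2 ^+ (j0 + 2) * e = 2 ^+ (j0 + 1) * (e * 2)); last first.
    by rewrite !exprD expr1 expr2; ring.
  by rewrite ler_pM2l ?exprn_gt0// ler_pM2l ?expR_gt0// geometric_half_le.
move=> t nBad s r sy ry Fsr; set D := dev F X n t.
have small i k : (i <= m)%N -> (k < 2 ^ (j0 + i))%N ->
    `|D (lv (j0 + i) k.+1) - D (lv (j0 + i) k)| <= u * lam lam0 i.
  move=> im ki; rewrite leNgt; apply/negP => /ltW Eik; apply: nBad.
  rewrite -bigcup_seq; exists (Ordinal (im : (i < m.+1)%N)); first by rewrite /= mem_index_enum.
  by rewrite -bigcup_seq; exists (Ordinal ki); first by rewrite /= mem_index_enum.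
have coarse x : y1 <= x <= y2 -> `|D x - D (lv j0 (kap j0 x))| <= 6 * lam0 * u.
  move=> xy; have /andP[yx _] := xy.
  have c1 := chain (ltW lam00) (ltW u0) xy small.
  have c2 : u * \sum_(i < m) lam lam0 i.+1 <= u * (3 * lam0).
    by rewrite ler_pM2l// lam_sum// ltW.
  suff c3 : `|D x - D (lv (j0 + m) (kap (j0 + m) x))| <= 3 * lam0 * u.
    rewrite -(subrKA (D (lv (j0 + m) (kap (j0 + m) x)))).
    apply: le_trans (ler_normD _ _) _; apply: le_trans (lerD c3 c1) _; lra.
  set j := (j0 + m)%N; set k := kap j x.
  pose h := l / 2 ^+ j.
  have p2 : 0 < 2 ^+ j :> R by rewrite exprn_gt0.
  have h2 : h < 2 * (lam0 * u).
    move: lmS; rewrite addnS exprS -/j => lmS.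
    rewrite (_ : h = 2 * (l / (2 * 2 ^+ j))); last by rewrite /h; field; rewrite gt_eqF.
    by rewrite ltr_pM2l.
  have [/andP[z1 z2] Fz] := lvP (kap_le j xy).
  have /andP[k1 k2] := kap_itv j yx.
  have Fx1 : F (lv j k) <= F x.
    rewrite Fz; have : l * ((kap j x)%:R / 2 ^+ j) <= F x - F y1; last by lra.
    by rewrite mulrC -ler_pdivlMr// ler_pdivrMr.
  have lx : lv j k <= x.
    rewrite leNgt; apply/negP => xl; have := F_inc yx xl z2; lra.
  have [keq|kne] := eqVneq k (2 ^ j)%N.
    have -> : x = lv j k.
      apply/eqP; rewrite eq_le lx andbT leNgt; apply/negP => lx'.
      have /andP[_ xy2] := xy; have := F_inc z1 lx' xy2.
      rewrite Fz -/k keq natrX divff ?gt_eqF// mulr1 /l.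
      have : F x <= F y2 by exact: cumulative_is_nondecreasing.
      lra.
    by rewrite subrr normr0 !mulr_ge0// ltW.
  have klt : (k < 2 ^ j)%N by rewrite ltn_neqAle kne kap_le.
  have [/andP[w1 w2] Fw] := lvP klt.
  have Fx2 : F x < F (lv j k.+1).
    rewrite Fw -natr1; have : F x - F y1 < l * ((k%:R + 1) / 2 ^+ j); last by lra.
    by rewrite [ltRHS]mulrC -ltr_pdivrMr// ltr_pdivlMr.
  have xl2 : x <= lv j k.+1.
    rewrite leNgt; apply/negP => /ltW lx2.
    have : F (lv j k.+1) <= F x by exact: cumulative_is_nondecreasing.
    lra.
  have FwFz : F (lv j k.+1) - F (lv j k) = h.
    by rewrite Fz Fw -natr1 /h -/k; field; rewrite gt_eqF.
  have inc := small m k (leqnn m) klt.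
  have lml : lam lam0 m <= lam0 by exact: lam_le.
  have inc' : D (lv j k.+1) - D (lv j k) <= lam0 * u.
    apply: le_trans (ler_norm _) (le_trans inc _); by rewrite mulrC ler_pM2r.
  have e1 := empirical_cdf_nd X n t lx; have e2 := empirical_cdf_nd X n t xl2.
  rewrite ler_norml; move: inc'; rewrite /D /dev => inc'.
  by apply/andP; split; lra.
(* points that are close have neighbouring coarse grid points *)
have neigh x y : y1 <= x <= y2 -> y1 <= y <= y2 -> `|F x - F y| <= l / 2 ^+ j0 ->
    (kap j0 x <= kap j0 y)%N -> `|D (lv j0 (kap j0 x)) - D (lv j0 (kap j0 y))| <= lam0 * u.
  move=> xy yy Fxy; rewrite leq_eqVlt => /predU1P[->|kxy].
    by rewrite subrr normr0 ltW.
  suff -> : kap j0 y = (kap j0 x).+1.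
    rewrite distrC; have := @small 0%N (kap j0 x) (leq0n _).
    rewrite addn0 /lam expr0 mulr1 (mulrC lam0); apply.
    by apply: leq_trans kxy (kap_le _ _).
  have /andP[yx _] := xy; have /andP[yy' _] := yy.
  have /andP[a1 a2] := kap_itv j0 yx; have /andP[b1 b2] := kap_itv j0 yy'.
  apply/eqP; rewrite eqn_leq kxy andbT -ltnS -(ltr_nat R) -addn2 natrD.
  have : (F y - F y1) / l * 2 ^+ j0 <= (F x - F y1) / l * 2 ^+ j0 + 1; last by lra.
  rewrite -lerBlDl -mulrBl -mulrBl -ler_pdivlMr ?exprn_gt0// ler_pdivrMr// div1r mulrC.
  apply: le_trans Fxy; rewrite distrC; apply: le_trans (ler_norm _); lra.
have nb : `|D (lv j0 (kap j0 s)) - D (lv j0 (kap j0 r))| <= lam0 * u.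
  have [h|h] := leqP (kap j0 s) (kap j0 r); first exact: neigh.
  by rewrite distrC; apply: neigh => //; [rewrite distrC|exact: ltnW].
have cs := coarse _ sy; have cr := coarse _ ry.
rewrite (_ : D s - D r = (D s - D (lv j0 (kap j0 s))) + (D (lv j0 (kap j0 s)) - D (lv j0 (kap j0 r)))
  - (D r - D (lv j0 (kap j0 r)))); last by ring.
apply: le_trans (ler_normB _ _) _; apply: le_trans (lerD (ler_normD _ _) cr) _.
lra.
Qed.

End oscillation.

(** * The quantile process as a function of the empirical process *)

Section uniform_continuity.
Context {R : realType}.

Lemma segment_uniform_continuity (f : R -> R) (c d e : R) : 0 < e ->
  {within `[c, d], continuous f} ->
  exists2 r, 0 < r & forall x y, c <= x <= d -> c <= y <= d -> `|x - y| <= r ->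
    `|f x - f y| <= e.
Proof.
move=> e0 /subspace_continuousP fc.
have cov := (compact_near_coveringP `[c, d]%classic).1 (@segment_compact R c d).
pose Q (r : R) x := forall y, c <= y <= d -> `|x - y| <= r -> c <= x <= d -> `|f x - f y| <= e.
have [|r0 /= r00 Hr] := cov R 0^'+ Q _.
  move=> x xcd; have /cvgrPdist_lt/(_ (e / 2)) := fc _ xcd.
  rewrite divr_gt0// => /(_ isT) [r /= r0 Hr].
  have cx : `|f x - f x| < e / 2 by rewrite subrr normr0 divr_gt0.
  exists (ball x (r / 2), [set z | 0 < z < r / 2]) => /=.
    split; first by apply: nbhsx_ballx; rewrite divr_gt0.
    exists (r / 2); first by rewrite /= divr_gt0.
    move=> z /=; rewrite sub0r normrN => zr z0; rewrite z0/=.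
    by rewrite (le_lt_trans (ler_norm z)).
  move=> [x' r'] /= [xx' /andP[r'0 r'r]] y ycd x'y x'cd.
  have h1 : `|f x - f x'| < e / 2.
    apply: Hr; last by rewrite /= in_itv.
    by apply: lt_trans xx' _; lra.
  have h2 : `|f x - f y| < e / 2.
    apply: Hr; last by rewrite /= in_itv.
    have := ler_distD x' x y; move: xx'; rewrite /ball/=; lra.
  have := ler_distD (f x) (f x') (f y); rewrite (distrC (f x') (f x)); lra.
have /Hr : ball_ (@Num.norm R R) 0 r0 (r0 / 2).
  by rewrite /ball_/= sub0r normrN gtr0_norm ?divr_gt0//; lra.
move=> /(_ _) h; exists (r0 / 2); first by rewrite divr_gt0.
by move=> x y xcd ycd xy; apply: (h _ x _ y) => //; rewrite divr_gt0.
Qed.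

End uniform_continuity.

Section empirical_process.
Context (R : realType) (d : measure_display) (T : measurableType d) (P : probability T R)
    (p q : R) (p_gt0 : 0 < p) (pq : p < q) (q_lt1 : q < 1)
    (F : cumulativeBounded (0 : R) (1 : R)) (f : R -> R)
    (eps : R) (eps_gt0 : 0 < eps)
    (F_derive : forall x : R, x \in `[quantile F p - eps, quantile F q + eps] ->
       is_derive x 1 F (f x))
    (f_cont : {within `[quantile F p - eps, quantile F q + eps]%classic, continuous f})
    (f_gt0 : forall x : R, x \in `[quantile F p - eps, quantile F q + eps] ->
       0 < f x)
    (X : nat -> {RV P >-> R}) (X_iid : iid_from F X)
    (a : nat -> R) (a_gt0 : forall n, (0 < n)%N -> 0 < a n)
    (a_cvg : a n @[n --> \oo] --> +oo)
    (a_small : a n / Num.sqrt n%:R @[n --> \oo] --> 0).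

Let mu : probability (measurableTypeR R) R := lebesgue_stieltjes_measure F.

Definition scale n : R := a n / Num.sqrt n%:R.

Lemma scale_gt0 n : (0 < n)%N -> 0 < scale n.
Proof. by move=> n0; rewrite divr_gt0 ?a_gt0// sqrtr_gt0 ltr0n. Qed.

Lemma scale_sqr n : (0 < n)%N -> n%:R * scale n ^+ 2 = a n ^+ 2.
Proof.
move=> n0; rewrite expr_div_n sqr_sqrtr//; field.
by rewrite pnatr_eq0 -lt0n.
Qed.

Lemma near_speed (C : R) : \forall n \near \oo, C <= a n ^+ 2.
Proof.
have /cvgryPge/(_ (Num.max 1 C)) := a_cvg.
apply: filterS => n; rewrite ge_max => /andP[h1 h2]; nra.
Qed.

Lemma near_scale (r : R) : 0 < r -> \forall n \near \oo, scale n <= r.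
Proof.
move=> r0; have /cvgrPdist_le/(_ _ r0) := a_small.
by apply: filterS => n; rewrite sub0r normrN; apply: le_trans; exact: ler_norm.
Qed.

(** [Q n] fails with probability at most [exp (- M a(n)^2)] for large [n].  The
    exceptional event is named because the set where [Q n] holds need not be
    measurable. *)
Definition ev_exp (M : R) (Q : nat -> T -> Prop) : Prop :=
  \forall n \near \oo, exists Bad : set T, [/\ measurable Bad,
    (P Bad <= (expR (- (a n ^+ 2 * M)))%:E)%E & forall t, ~ Bad t -> Q n t].

Lemma ev_exp_mono M M' (Q Q' : nat -> T -> Prop) : M' <= M ->
  (\forall n \near \oo, forall t, Q n t -> Q' n t) -> ev_exp M Q -> ev_exp M' Q'.
Proof.
move=> MM QQ' MQ; near=> n.
have [Bad [mB PB HB]] : exists Bad : set T, [/\ measurable Bad,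
    (P Bad <= (expR (- (a n ^+ 2 * M)))%:E)%E & forall t, ~ Bad t -> Q n t] by near: n.
exists Bad; split => //.
  by apply: le_trans PB _; rewrite lee_fin ler_expR lerN2 ler_wpM2l ?sqr_ge0.
have H : forall t, Q n t -> Q' n t by near: n.
by move=> t /HB /H.
Unshelve. all: by end_near. Qed.

Lemma ev_exp_le M M' (Q : nat -> T -> Prop) : M' <= M -> ev_exp M Q -> ev_exp M' Q.
Proof. by move=> MM; apply: ev_exp_mono MM _; exact: nearW. Qed.

(** Constant factors are absorbed by any gap between the exponents, as [a]
    tends to infinity. *)
Lemma ev_exp_bound (M M' C : R) (Q : nat -> T -> Prop) : M < M' ->
  (\forall n \near \oo, exists Bad : set T, [/\ measurable Bad,
    (P Bad <= (C * expR (- (a n ^+ 2 * M')))%:E)%E & forall t, ~ Bad t -> Q n t]) ->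
  ev_exp M Q.
Proof.
move=> MM H; have sp := near_speed (C / (M' - M)).
apply: filterS2 sp H => n sn [Bad [mB PB HB]]; exists Bad; split => //.
apply: le_trans PB _; rewrite lee_fin.
rewrite (_ : M' = (M' - M) + M); last by rewrite subrK.
rewrite mulrDr opprD expRD mulrA ler_piMl ?expR_ge0//.
rewrite expRN ler_pdivrMr ?expR_gt0// mul1r.
apply: (@le_trans _ _ (a n ^+ 2 * (M' - M))).
  by rewrite -ler_pdivrMr// subr_gt0.
by apply: le_trans (expR_ge1Dx _); rewrite lerDr.
Qed.

Lemma ev_exp_forall (I : finType) M M' (Q : I -> nat -> T -> Prop) : M < M' ->
  (forall i, ev_exp M' (Q i)) -> ev_exp M (fun n t => forall i, Q i n t).
Proof.
move=> MM H; apply: (@ev_exp_bound M M' #|I|%:R) => //.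
have : \forall n \near \oo, forall i, exists Bad : set T, [/\ measurable Bad,
    (P Bad <= (expR (- (a n ^+ 2 * M')))%:E)%E & forall t, ~ Bad t -> Q i n t].
  exact: filter_forall.
apply: filterS => n /choice[B HB].
have [mU PU] := @union_bound _ _ _ P I B (fun=> expR (- (a n ^+ 2 * M')))
  (fun i => let: And3 m1 m2 _ := HB i in conj m1 m2).
exists (\big[setU/set0]_i B i); split => //; first by rewrite -sum_cst.
move=> t nB i; have [_ _] := HB i; apply => Bit; apply: nB.
by rewrite -bigcup_seq; exists i => //; rewrite /= mem_index_enum.
Qed.

Lemma ev_exp_and M M' (Q Q' : nat -> T -> Prop) : M < M' ->
  ev_exp M' Q -> ev_exp M' Q' -> ev_exp M (fun n t => Q n t /\ Q' n t).
Proof.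
move=> MM H H'; have := @ev_exp_forall bool M M' (fun b => if b then Q else Q') MM.
move=> /(_ _) h; apply: (ev_exp_mono (lexx M) _ (h _)); last by case.
by apply: nearW => n t b; split; [exact: (b true)|exact: (b false)].
Qed.

Local Notation J := `[quantile F p - eps, quantile F q + eps].

Let y1 := quantile F p - eps.
Let y2 := quantile F q + eps.

Let y12 : y1 < y2.
Proof.
by have := quantile_pq_le p_gt0 pq q_lt1 F; have := eps_gt0; rewrite /y1 /y2; lra.
Qed.

Let F_cont_seg c e : y1 <= c -> e <= y2 -> {within `[c, e], continuous F}.
Proof.
move=> yc ey; apply: derivable_within_continuous => x; rewrite in_itv/= => /andP[h1 h2].
have /F_derive [] // : x \in J.
by rewrite in_itv/= (le_trans yc h1) (le_trans h2 ey).
Qed.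

Lemma F_MVT s r : y1 <= s -> s <= r -> r <= y2 ->
  exists2 c, s <= c <= r & F r - F s = f c * (r - s).
Proof.
move=> ys sr ry; apply: mean_value => // x /andP[h1 h2]; apply: F_derive.
by rewrite in_itv/= (le_trans ys h1) (le_trans h2 ry).
Qed.

Lemma F_inc s r : y1 <= s -> s < r -> r <= y2 -> F s < F r.
Proof.
move=> ys sr ry; have [c /andP[h1 h2] FF] := F_MVT ys (ltW sr) ry.
rewrite -subr_gt0 FF mulr_gt0 ?subr_gt0// f_gt0//.
by rewrite in_itv/= (le_trans ys h1) (le_trans h2 ry).
Qed.

Lemma F_onto x : F y1 <= x <= F y2 -> exists2 y, y1 <= y <= y2 & F y = x.
Proof.
move=> /andP[h1 h2]; have FF : F y1 <= F y2 by exact: le_trans h2.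
have [|c] := @IVT R F y1 y2 x (ltW y12) (F_cont_seg (lexx _) (lexx _)).
  by rewrite (min_idPl FF) (max_idPr FF) h1.
by rewrite in_itv/= => ? ?; exists c.
Qed.

Local Notation dv := (dev F X).

(** The exponent in [oscillation_bound] is proportional to [2 ^ j0], so it
    exceeds any [M] for a large [j0]; the price is the smaller modulus
    [(F y2 - F y1) / 2 ^ j0]. *)
Lemma ev_modulus (M eta : R) : 0 < eta -> exists2 del, 0 < del &
  ev_exp M (fun n t => forall s r, y1 <= s <= y2 -> y1 <= r <= y2 ->
    `|F s - F r| <= del -> `|dv n t s - dv n t r| <= eta * scale n).
Proof.
move=> e0; pose lam0 := eta / 13; have lam00 : 0 < lam0 by rewrite divr_gt0.
have Fl : 0 < F y2 - F y1 by rewrite subr_gt0 (F_inc (lexx _) y12 (lexx _)).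
pose C := 4 * (`|M| + 1 + 1) / lam0 ^+ 2.
pose j0 := Num.truncn C.
pose K := lam0 ^+ 2 * 2 ^+ j0.+1 / 4.
have KM : `|M| + 1 + 1 <= K.
  rewrite /K ler_pdivlMr// [leLHS]mulrC.
  have : C <= 2 ^+ j0.+1.
    apply: le_trans (ltW (truncnS_gt C)) _.
    by rewrite -natrX ler_nat; exact: (ltnW (ltn_expl _ (ltnSn 1))).
  by rewrite /C ler_pdivrMr ?exprn_gt0// [leRHS]mulrC.
have M0 := normr_ge0 M.
exists ((F y2 - F y1) / 2 ^+ j0.+1); first by rewrite divr_gt0.
apply: (ev_exp_le (ler_norm M)); apply: (@ev_exp_bound `|M| (`|M| + 1) (2 ^+ (j0.+1 + 2))); first by rewrite ltrDl.
have s1 := near_speed 16.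
have s2 : \forall n \near \oo, scale n <= (F y2 - F y1) / 2 ^+ j0.+1 / lam0.
  by apply: near_scale; rewrite !divr_gt0.
near=> n.
have n0 : (0 < n)%N by near: n; exact: nbhs_infty_gt.
have [||Bad [mB PB HB]] := oscillation_bound X_iid y12 F_inc F_onto n0 (scale_gt0 n0) lam00 (j0 := j0.+1).
- by rewrite mulrC -ler_pdivlMr//; near: n.
- rewrite scale_sqr// -/K.
  have : 16 <= a n ^+ 2 by near: n.
  by nra.
exists Bad; split => //.
  apply: le_trans PB _; rewrite lee_fin ler_pM2l ?exprn_gt0// ler_expR lerN2 scale_sqr//.
  rewrite -/K ler_wpM2l ?sqr_ge0//; lra.
move=> t nB s r sy ry Fsr; apply: le_trans (HB t nB s r sy ry Fsr) _.
by rewrite /lam0 [13 * _]mulrC divfK.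
Unshelve. all: by end_near. Qed.

Lemma ev_point (M : R) z : 0 <= M ->
  ev_exp M (fun n t => `|dv n t z| <= (M + 2) * scale n).
Proof.
move=> M0; apply: (@ev_exp_bound M (M + 1) 2); first by rewrite ltrDl.
near=> n; have n0 : (0 < n)%N by near: n; exact: nbhs_infty_gt.
have u0 := scale_gt0 n0.
have u1 : scale n * 1 <= 1 / 2 by rewrite mulr1; near: n; apply: near_scale.
have [mB PB] := dev_ray_bernstein X_iid (M + 2) z n0 (ltW u0) ler01 u1.
exists [set t | scale n * (M + 2) <= `|dv n t z|]; split => //.
  apply: le_trans PB _; rewrite lee_fin ler_pM2l// ler_expR lerN2 scale_sqr//.
  rewrite ler_wpM2l ?sqr_ge0// expr1n !mul1r.
  have := cumulative_le1 F z; lra.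
by move=> t /negP; rewrite -ltNge => /ltW; rewrite mulrC.
Unshelve. all: by end_near. Qed.

Lemma yJ x : p <= x <= q -> y1 <= quantile F x <= y2.
Proof.
by move=> xpq; have := quantile_J p_gt0 q_lt1 F eps_gt0 xpq; rewrite in_itv.
Qed.

Lemma grid_mesh (del : R) : 0 < del -> exists2 m, (0 < m)%N & (q - p) / m%:R <= del.
Proof.
move=> d0; exists (Num.truncn ((q - p) / del)).+1 => //.
by rewrite ler_pdivrMr// mulrC -ler_pdivrMr// ltW// truncnS_gt.
Qed.

Lemma ev_bounded (M : R) : exists2 C, 0 < C &
  ev_exp M (fun n t => forall x, p <= x <= q -> `|dv n t (quantile F x)| <= C * scale n).
Proof.
have [del d0 Hm] := @ev_modulus (`|M| + 1) 1 ltr01.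
have [m m0 mdel] := grid_mesh d0.
have M0 : 0 <= `|M| + 2 by rewrite addr_ge0.
exists (`|M| + 2 + 2 + 1); first by lra.
have Hp : ev_exp (`|M| + 1) (fun n t => forall i : 'I_m.+1,
    `|dv n t (quantile F (grid p q m i))| <= (`|M| + 2 + 2) * scale n).
  apply: (@ev_exp_forall _ _ (`|M| + 2)) => [|i]; first by rewrite ltrD2l ltr1n.
  exact: ev_point.
apply: (ev_exp_mono (ler_norm M) _ (ev_exp_and _ Hm Hp)); last by rewrite ltrDl.
apply: nearW => n t [h1 h2] x xpq.
have [j jm xj] := grid_near pq m0 xpq.
have jpq := grid_itv pq m0 jm.
have := h2 (Ordinal (jm : (j < m.+1)%N)) => /= h3.
have := h1 _ _ (yJ xpq) (yJ jpq).
rewrite !(F_quantile p_gt0 q_lt1 eps_gt0 F_derive)// => /(_ (le_trans xj mdel)) h4.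
rewrite -(subrK (dv n t (quantile F (grid p q m j))) (dv n t (quantile F x))).
apply: le_trans (ler_normD _ _) _; apply: le_trans (lerD h4 h3) _.
by rewrite -mulrDl addrC.
Qed.

Lemma empirical_superlevel_neq0 n t x : (0 < n)%N -> x <= 1 ->
  [set y | x <= empirical_cdf X n t y] !=set0.
Proof.
move=> n0 x1; exists (\sum_(i < n) `|X i t|) => /=; rewrite /empirical_cdf.
have XM (i : 'I_n) : X i t <= \sum_(i < n) `|X i t|.
  by rewrite (le_trans (ler_norm _))// (bigD1 i)//= lerDl sumr_ge0.
rewrite (eq_bigr (fun=> 1)); last by move=> i _; rewrite XM.
by rewrite sumr_const card_ord mulVf ?pnatr_eq0 -?lt0n.
Qed.

Lemma empirical_superlevel_lbound n t x : 0 < x ->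
  has_lbound [set y | x <= empirical_cdf X n t y].
Proof.
move=> x0; exists (- \sum_(i < n) `|X i t|) => y /= xy.
rewrite leNgt; apply/negP => yM.
move: xy; rewrite /empirical_cdf big1 ?mulr0 ?leNgt ?x0// => i _.
have XM : `|X i t| <= \sum_(i < n) `|X i t|.
  by rewrite (bigD1 i)//= lerDl sumr_ge0.
rewrite leNgt (lt_le_trans yM)// lerNl (le_trans _ XM)//.
by rewrite -normrN ler_norm.
Qed.

Local Notation W := (quantile_process F X a p_gt0 q_lt1).

(** Mean value theorem and uniform continuity of [f]. *)
Lemma F_linear (C tau : R) : 0 < C -> 0 < tau -> \forall n \near \oo,
  forall x c, p <= x <= q -> `|c| <= C ->
    `|F (quantile F x + c * scale n) - F (quantile F x) - c * scale n * f (quantile F x)|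
      <= tau * scale n.
Proof.
move=> C0 tau0.
have [r r0 Hr] := segment_uniform_continuity (divr_gt0 tau0 C0) f_cont.
near=> n => x c xpq cC.
have n0 : (0 < n)%N by near: n; exact: nbhs_infty_gt.
have u0 := scale_gt0 n0.
have uC1 : scale n * C <= eps.
  by rewrite -ler_pdivlMr//; near: n; apply: near_scale; rewrite divr_gt0.
have uC2 : scale n * C <= r.
  by rewrite -ler_pdivlMr//; near: n; apply: near_scale; rewrite divr_gt0.
set y := quantile F x; set z := y + c * scale n.
have yy : y1 <= y <= y2 by exact: yJ.
have zy : `|z - y| <= scale n * C.
  by rewrite /z addrC addKr normrM (gtr0_norm u0) mulrC ler_pM2l.
have /andP[q1 q2] : quantile F p <= y <= quantile F q by exact: quantile_itv.
have zy' := le_trans zy uC1.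
have zJ : y1 <= z <= y2.
  by move: zy'; rewrite ler_norml /y1 /y2 => /andP[h1 h2]; apply/andP; split; lra.
have [e [ey Fe]] : exists e, [/\ y1 <= e <= y2 /\ `|e - y| <= r & F z - F y = f e * (z - y)].
  have /andP[ya yb] := yy; have /andP[za zb] := zJ.
  have zr := le_trans zy uC2.
  have [yz|/ltW zy2] := leP y z.
    have [e /andP[e1 e2] Fe] := F_MVT ya yz zb; exists e; split => //; split.
      by rewrite (le_trans ya e1) (le_trans e2 zb).
    apply: le_trans zr; rewrite !ger0_norm ?subr_ge0//; lra.
  have [e /andP[e1 e2] Fe] := F_MVT za zy2 yb; exists e; split.
    split; first by rewrite (le_trans za e1) (le_trans e2 yb).
    apply: le_trans zr; rewrite distrC (distrC z) !ger0_norm ?subr_ge0//; lra.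
  by rewrite -opprB Fe -mulrN opprB.
have -> : F z - F y - c * scale n * f y = (f e - f y) * (c * scale n).
  by rewrite Fe /z [y + _ - y]addrC addKr; ring.
have [eJ er] := ey.
have fe := Hr e y eJ yy er.
rewrite normrM normrM (gtr0_norm u0) mulrA ler_pM2r//.
by rewrite -(divfK (lt0r_neq0 C0) tau) ler_pM.
Unshelve. all: by end_near. Qed.

(** A deterministic consequence of [ev_modulus] and [ev_bounded]: if [A_n]
    oscillates little and is bounded, then uniformly for bounded [c] the value of
    [F_n] at [y + c u_n] is [x + (c f(y) + A_n(y)) u_n] up to a small multiple
    of [u_n].  So [F_n] crosses the level [x] at a [c] within [kap] of
    [- A_n(y) / f(y)]. *)
Lemma ev_bahadur (M kap : R) : 0 < kap ->
  ev_exp M (fun n t => forall x : `[p, q]%classic,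
    `|W n t x + dv n t (quantile F (val x)) / scale n / f (quantile F (val x))| <= kap).
Proof.
move=> kap0.
have [m [Mf [m0 M0 fmM]]] := f_bounds p_gt0 pq q_lt1 eps_gt0 f_cont f_gt0.
have km0 : 0 < kap * m / 4 by rewrite divr_gt0 ?mulr_gt0.
have [del d0 Hm] := ev_modulus (M + 1) km0.
have [C C0 Hb] := ev_bounded (M + 1).
pose C' := C / m + kap.
have C'0 : 0 < C' by rewrite addr_gt0 ?divr_gt0.
apply: (ev_exp_mono (lexx M) _ (ev_exp_and _ Hm Hb)); last by rewrite ltrDl.
have lin := F_linear C'0 km0.
have D0 : 0 < C' * Mf + kap * m / 4 by rewrite addr_gt0 ?mulr_gt0.
near=> n => t [h1 h2] x.
have n0 : (0 < n)%N by near: n; exact: nbhs_infty_gt.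
have u0 := scale_gt0 n0.
have xpq : p <= val x <= q by have := set_valP x; rewrite /= in_itv.
have := yJ xpq; set y := quantile F (val x) => yy.
have Fy : F y = val x by rewrite (F_quantile p_gt0 q_lt1 eps_gt0 F_derive).
have yJ' : y \in J by rewrite in_itv.
have /andP[fm fM] := fmM _ yJ'.
have fy0 : 0 < f y by exact: lt_le_trans fm.
have uC1 : scale n * C' <= eps.
  by rewrite -ler_pdivlMr//; near: n; apply: near_scale; rewrite divr_gt0.
have uC2 : scale n * (C' * Mf + kap * m / 4) <= del.
  by rewrite -ler_pdivlMr//; near: n; apply: near_scale; rewrite divr_gt0.
set u := scale n in u0 uC1 uC2 *.
set D := dv n t y.
pose c0 := - (D / u / f y).
have c0C : `|c0| <= C / m.
  rewrite normrN !normrM !normfV (gtr0_norm u0) (gtr0_norm fy0).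
  have h3 : `|D| / u <= C by rewrite ler_pdivrMr//; exact: h2.
  apply: ler_pM => //; first by rewrite divr_ge0// ltW.
    by rewrite invr_ge0 ltW.
  by rewrite lef_pV2 ?posrE.
have linn : forall c, `|c| <= C' -> `|F (y + c * u) - F y - c * u * f y| <= kap * m / 4 * u.
  move=> c cC; have H : forall x c, p <= x <= q -> `|c| <= C' ->
    `|F (quantile F x + c * scale n) - F (quantile F x) - c * scale n * f (quantile F x)|
      <= kap * m / 4 * scale n by near: n.
  exact: H.
have [/andP[q1 q2]] : quantile F p <= y <= quantile F q /\ True by split => //; exact: quantile_itv.
move=> _.
have emp (c : R) : `|c| <= C' ->
    `|empirical_cdf X n t (y + c * u) - (val x + c * u * f y + D)| <= kap * m / 2 * u.
  move=> cC; have L := linn c cC.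
  have zJ : y1 <= y + c * u <= y2.
    have : `|c * u| <= eps.
      by apply: le_trans uC1; rewrite normrM (gtr0_norm u0) mulrC ler_pM2l.
    by rewrite ler_norml /y1 /y2 => /andP[e1 e2]; apply/andP; split; lra.
  have near : `|F (y + c * u) - F y| <= del.
    apply: le_trans uC2.
    rewrite -(subrK (c * u * f y) (_ - _)); apply: le_trans (ler_normD _ _) _.
    rewrite (_ : u * _ = kap * m / 4 * u + C' * Mf * u); last by ring.
    apply: lerD => //.
    rewrite normrM (normrM c u) (gtr0_norm u0) (gtr0_norm fy0) mulrAC ler_pM2r//.
    by rewrite ler_pM// ltW.
  have := h1 _ _ zJ yy near; rewrite -/D /dev => h3.
  have -> : empirical_cdf X n t (y + c * u) - (val x + c * u * f y + D) =
     (empirical_cdf X n t (y + c * u) - F (y + c * u) - D) + (F (y + c * u) - F y - c * u * f y).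
    by rewrite Fy; ring.
  apply: le_trans (ler_normD _ _) _; apply: le_trans (lerD h3 L) _.
  by rewrite -mulrDl ler_pM2r//; lra.
have c0E : c0 * u * f y = - D.
  by rewrite /c0; field; rewrite !gt_eqF.
have x0 : 0 < val x by have /andP[h _] := xpq; exact: lt_le_trans h.
have x1 : val x <= 1 by have /andP[_ h] := xpq; apply: le_trans h _; exact: ltW.
have kf : kap * m <= kap * f y by rewrite ler_pM2l.
(* [F_n] has reached the level [x] at the upper point, not yet at the lower *)
have up : quantile (empirical_cdf X n t) (val x) <= y + (c0 + kap) * u.
  apply: quantile_le; first exact: empirical_superlevel_lbound.
  have b : `|c0 + kap| <= C'.
    by apply: le_trans (ler_normD _ _) _; rewrite (gtr0_norm kap0) lerD2r.
  have e : (c0 + kap) * u * f y = - D + kap * f y * u.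
    by rewrite mulrDl mulrDl c0E; ring.
  have := emp _ b; rewrite e ler_norml => /andP[h3 _].
  have : kap * m * u <= kap * f y * u by rewrite ler_pM2r.
  have : 0 < kap * m * u by apply: mulr_gt0 => //; exact: mulr_gt0.
  lra.
have lo : y + (c0 - kap) * u <= quantile (empirical_cdf X n t) (val x).
  apply: quantile_ge.
  - by move=> s r; exact: empirical_cdf_nd.
  - exact: empirical_superlevel_neq0.
  have b : `|c0 - kap| <= C'.
    by apply: le_trans (ler_normB _ _) _; rewrite (gtr0_norm kap0) lerD2r.
  have e : (c0 - kap) * u * f y = - D - kap * f y * u.
    by rewrite mulrBl mulrBl c0E; ring.
  have := emp _ b; rewrite e ler_norml => /andP[_ h3].
  have : kap * m * u <= kap * f y * u by rewrite ler_pM2r.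
  have : 0 < kap * m * u by apply: mulr_gt0 => //; exact: mulr_gt0.
  lra.
have WE : W n t x = (quantile (empirical_cdf X n t) (val x) - y) / u.
  by rewrite /= -/y mulrC; congr (_ * _); rewrite /u /scale invf_div.
rewrite -/y -/D WE.
have -> : (quantile (empirical_cdf X n t) (val x) - y) / u + D / u / f y =
   (quantile (empirical_cdf X n t) (val x) - y - c0 * u) / u.
  by rewrite /c0; field; rewrite !gt_eqF.
rewrite normrM normfV (gtr0_norm u0) ler_pdivrMr// ler_norml.
by apply/andP; split; lra.
Unshelve. all: by end_near. Qed.

End empirical_process.

(** * Cells between consecutive grid quantiles *)

Lemma count_le_threshold (b : nat -> bool) (m i : nat) :
  (forall j k, (j <= k <= m)%N -> b k -> b j) -> (i <= m)%N ->
  (\sum_(j < m.+1) b j <= i)%N = ~~ b i.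
Proof.
move=> bn im; rewrite -(big_mkord xpredT (fun j => nat_of_bool (b j))).
have [bi|nbi] /= := boolP (b i); last first.
  rewrite (big_cat_nat (n := i))//=; last exact: ltnW.
  rewrite [X in (_ + X <= _)%N]big1_seq ?addn0; last first.
    move=> j; rewrite mem_index_iota /= => /andP[ij jm]; case bj: (b j) => //.
    by rewrite (bn i j) ?ij// in nbi.
  apply: (@leq_trans (\sum_(0 <= j < i) 1)%N); last by rewrite sum_nat_const_nat muln1 subn0.
  by apply: leq_sum => j _; case: (b j).
apply/negbTE; rewrite -ltnNge (big_cat_nat (n := i.+1))//=.
apply: leq_trans (leq_addr _ _).
rewrite (eq_big_nat _ _ (F2 := fun=> 1%N)) ?sum_nat_const_nat ?muln1 ?subn0//.
by move=> j /andP[_ ji]; rewrite (bn j i)//; rewrite -ltnS ji.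
Qed.

Lemma telescope_ord_le (R : zmodType) (m : nat) (V : nat -> R) (i : nat) : (i <= m)%N ->
  \sum_(j < m.+1 | (j <= i)%N) (V j.+1 - V j) = V i.+1 - V 0%N.
Proof.
move=> im; rewrite -(big_mkord (fun j => (j <= i)%N) (fun j => V j.+1 - V j)).
rewrite big_mkcond (big_cat_nat (n := i.+1))//=.
rewrite [X in _ + X]big1_seq ?addr0; last first.
  by move=> j; rewrite mem_index_iota /= => /andP[ij _]; rewrite leqNgt ij.
rewrite -telescope_sumr//; apply: eq_big_nat => j /andP[_ ji].
by rewrite -ltnS ji.
Qed.

Section cells.
Context {R : realType} {p q : R} (p_gt0 : 0 < p) (pq : p < q) (q_lt1 : q < 1)
  {F : cumulativeBounded (0 : R) (1 : R)}
  (FQ : forall x, p <= x <= q -> F (quantile F x) = x)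
  {m : nat} (m_gt0 : (0 < m)%N).

Let mu : probability (measurableTypeR R) R := lebesgue_stieltjes_measure F.

Definition knot (i : nat) : R := quantile F (grid p q m i).

(** Number of knots on the left of [x]; the two tails are cells too.  There are
    [m.+1] knots, so [inord] never meets its default value. *)
Definition cell (x : R) : 'I_m.+2 := inord (\sum_(i < m.+1) (knot i < x)%R).

Lemma knot_le i j : (i <= j <= m)%N -> knot i <= knot j.
Proof.
move=> /andP[ij jm].
have ii := grid_itv pq m_gt0 (leq_trans ij jm).
have jj := grid_itv pq m_gt0 jm.
have gij : grid p q m i <= grid p q m j.
  rewrite lerD2l ler_wpM2l ?subr_ge0 ?(ltW pq)// ler_wpM2r ?invr_ge0//.
  by rewrite ler_nat.
have [jp jq] := andP jj.
have /quantile_itv : p <= grid p q m i <= grid p q m j by rewrite gij; have /andP[->] := ii.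
by move=> /(_ p_gt0 (le_lt_trans jq q_lt1) F)/andP[].
Qed.

Lemma cell_le x i : (i <= m)%N -> (cell x <= i)%N = (x <= knot i).
Proof.
move=> im; rewrite /cell inordK; last first.
  rewrite ltnS -[leqRHS](_ : (\sum_(i < m.+1) 1)%N = _); last first.
    by rewrite sum_nat_const card_ord muln1.
  by apply: leq_sum => j _; case: (_ < _).
rewrite (@count_le_threshold (fun i => knot i < x)) ?leNgt//.
by move=> j k jk; apply: le_lt_trans; exact: knot_le.
Qed.

(** Everything about cells is obtained by telescoping over these unions of
    cells, which are half-lines. *)
Definition below (k : nat) : set R := [set x | (cell x < k)%N].

Lemma below0 : below 0 = set0.
Proof. by apply/seteqP; split. Qed.

Lemma belowS i : (i <= m)%N -> below i.+1 = `]-oo, knot i]%classic.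
Proof.
by move=> im; apply/seteqP; split => x; rewrite /below /= in_itv/= ltnS cell_le.
Qed.

Lemma belowT : below m.+2 = setT.
Proof. by apply/seteqP; split => // x _; exact: ltn_ord. Qed.

Lemma measurable_below k : measurable (below k : set (measurableTypeR R)).
Proof.
case: k => [|i]; first by rewrite below0.
have [im|mi] := leqP i m; first by rewrite belowS//; exact: measurable_ray.
rewrite (_ : below _ = setT)//; apply/seteqP; split => // x _.
exact: leq_trans (ltn_ord _) _.
Qed.

Lemma cellE (j : 'I_m.+2) : cell @^-1` [set j] = below j.+1 `\` below j.
Proof.
apply/seteqP; split => x; rewrite /below/=.
  by move=> ->; split; [exact: ltnSn|rewrite ltnn].
move=> [h1 /negP h2]; apply/val_inj/eqP => /=.
by rewrite eqn_leq -ltnS h1/= leqNgt.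
Qed.

Lemma measurable_cell (j : 'I_m.+2) :
  measurable (cell @^-1` [set j] : set (measurableTypeR R)).
Proof. by rewrite cellE; apply: measurableD; exact: measurable_below. Qed.

Lemma below_sub k : below k `<=` below k.+1.
Proof. by move=> x; rewrite /below/= => /ltnW. Qed.

Lemma Rintegral_cell (g : R -> R) (j : 'I_m.+2) :
  mu.-integrable setT (EFin \o g) ->
  \int[mu]_(x in cell @^-1` [set j]) g x =
    \int[mu]_(x in below j.+1) g x - \int[mu]_(x in below j) g x.
Proof.
move=> ig; have ib k : mu.-integrable (below k) (EFin \o g).
  by apply: integrableS ig => //; exact: measurable_below.
rewrite -[X in \int[mu]_(x in X) _ - _](setDUK (@below_sub j)).
rewrite Rintegral_setU//.
- by rewrite cellE [X in X - _]addrC addrK.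
- exact: measurable_below.
- by rewrite -cellE; exact: measurable_cell.
- by rewrite setDUK; [exact: ib|exact: below_sub].
- by apply/disj_setPS => x [h [_ nh]].
Qed.

Definition weight (j : 'I_m.+2) : R := fine (mu (cell @^-1` [set j])).

Lemma Rintegral_below_cells (g : R -> R) i : (i <= m.+1)%N ->
  mu.-integrable setT (EFin \o g) ->
  \int[mu]_(x in below i.+1) g x =
    \sum_(j < m.+2 | (j <= i)%N) \int[mu]_(x in cell @^-1` [set j]) g x.
Proof.
move=> im ig; under eq_bigr do rewrite Rintegral_cell//.
rewrite (telescope_ord_le (fun k => \int[mu]_(x in below k) g x))//.
by rewrite below0 Rintegral_set0 subr0.
Qed.

Lemma primitive_knot (g : R -> R) i : (i <= m)%N ->
  mu.-integrable setT (EFin \o g) ->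
  primitive F g (knot i) = \sum_(j < m.+2 | (j <= i)%N) \int[mu]_(x in cell @^-1` [set j]) g x.
Proof.
by move=> im ig; rewrite -Rintegral_below_cells// ?(leqW im)// belowS.
Qed.

Lemma Rintegral_cells (g : R -> R) : mu.-integrable setT (EFin \o g) ->
  \int[mu]_x g x = \sum_(j < m.+2) \int[mu]_(x in cell @^-1` [set j]) g x.
Proof.
move=> ig; rewrite -[in LHS]belowT Rintegral_below_cells//.
by apply: eq_bigl => j; rewrite -ltnS ltn_ord.
Qed.

Lemma weight_gt0 j : 0 < weight j.
Proof.
have gi i : (i <= m)%N -> p <= grid p q m i <= q by exact: grid_itv.
have fin A : measurable (A : set (measurableTypeR R)) -> mu A \is a fin_num by move=> mA; exact: fin_num_measure.
have mb k : mu (below k) \is a fin_num by apply: fin; exact: measurable_below.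
have -> : weight j = fine (mu (below j.+1)) - fine (mu (below j)).
  rewrite /weight cellE measureD; [|exact: measurable_below|exact: measurable_below|by rewrite ltey_eq mb].
  have /setIidPr -> : below j `<=` below j.+1 by exact: below_sub.
  by rewrite fineB//; exact: mb.
have bS i : (i <= m)%N -> fine (mu (below i.+1)) = grid p q m i.
  by move=> im; rewrite belowS// stieltjes_ray/= FQ// gi.
case: j => -[|j] jm /=.
  rewrite below0 measure0 subr0 bS//.
  by have /andP[h _] := gi 0%N (leq0n _); exact: lt_le_trans h.
rewrite (bS j)//; have [jm'|mj] := ltnP j m.
  rewrite bS// /grid opprD addrACA subrr add0r -mulrBr -mulrBl mulr_gt0 ?subr_gt0//.
  by rewrite mulr_gt0 ?invr_gt0 ?ltr0n// subr_gt0 ltr_nat.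
have -> : j = m by apply/eqP; rewrite eqn_leq mj andbT -ltnS.
rewrite belowT probability_setT subr_gt0/=.
by have /andP[_ h] := gi m (leqnn _); exact: le_lt_trans q_lt1.
Qed.

Lemma Rintegral_step (h : 'I_m.+2 -> R) j :
  \int[mu]_(x in cell @^-1` [set j]) h (cell x) = h j * weight j.
Proof.
rewrite -Rintegral_cst; last exact: measurable_cell.
by apply: eq_Rintegral => x; rewrite inE/= => ->.
Qed.

Lemma measurable_step (h : 'I_m.+2 -> R) :
  measurable_fun setT (fun x : measurableTypeR R => h (cell x)).
Proof.
move=> _ B mB; rewrite setTI.
rewrite (_ : _ @^-1` _ = \bigcup_(j in [set j | B (h j)]) cell @^-1` [set j]).
  by apply: fin_bigcup_measurable => // j _; exact: measurable_cell.
apply/seteqP; split => [x Bx|x [j Bj /= xj]]; first by exists (cell x).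
by rewrite /= xj.
Qed.

Lemma integrable_step (h : 'I_m.+2 -> R) :
  mu.-integrable setT (EFin \o (fun x => h (cell x))).
Proof.
apply: measurable_bounded_integrable => //.
- by apply: (@le_lt_trans _ _ 1%E); [exact: probability_le1|exact: ltry].
- exact: measurable_step.
exists (\sum_j `|h j|); split; first exact: num_real.
move=> M HM x _ /=; apply: le_trans (ltW HM).
by rewrite (bigD1 (cell x))//= lerDl sumr_ge0.
Qed.

Lemma step_Rintegral (h : 'I_m.+2 -> R) :
  \int[mu]_x h (cell x) = \sum_j h j * weight j.
Proof.
rewrite Rintegral_cells; last exact: integrable_step.
by apply: eq_bigr => j _; rewrite Rintegral_step.
Qed.

Lemma step_sq_le (h : 'I_m.+2 -> R) (B : R) : \sum_j h j ^+ 2 * weight j <= B ->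
  sq_le mu (fun x => h (cell x)) B.
Proof.
move=> hB; split; first exact: measurable_step.
have i2 := integrable_step (fun j => h j ^+ 2).
rewrite -(fineK (integrable_fin_num measurableT i2)) lee_fin.
by apply: le_trans hB; rewrite -step_Rintegral.
Qed.

Lemma step_primitive_knot (h : 'I_m.+2 -> R) i : (i <= m)%N ->
  primitive F (fun x => h (cell x)) (knot i) = \sum_(j < m.+2 | (j <= i)%N) h j * weight j.
Proof.
move=> im; rewrite primitive_knot//; last exact: integrable_step.
by apply: eq_bigr => j _; rewrite Rintegral_step.
Qed.

(** Averaging over the cells does not increase the energy, by Cauchy-Schwarz
    on each cell. *)
Lemma cell_averages_sq (g : R -> R) (B : R) : sq_le mu g B ->
  \sum_j weight j * ((\int[mu]_(x in cell @^-1` [set j]) g x) / weight j) ^+ 2 <= B.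
Proof.
move=> gB; apply: le_trans (@sum_Rintegral_sq_le _ _ _ mu g B 'I_m.+2 (fun j => cell @^-1` [set j]) measurable_cell _ gB); last first.
  apply/trivIsetP => i j _ _ /eqP ij; apply/seteqP; split => // x [/= xi xj].
  by apply: ij; rewrite -xi -xj.
apply: ler_sum => j _; have w0 := weight_gt0 j.
have := cauchy_schwarz (measurable_cell j) gB; rewrite -/(weight j) => h.
rewrite (_ : weight j * _ = (\int[mu]_(x in cell @^-1` [set j]) g x) ^+ 2 / weight j).
  by rewrite ler_pdivrMr// mulrC.
by field; rewrite gt_eqF.
Qed.

Section empirical.
Context {d : measure_display} {T : measurableType d} {P : probability T R}
  (X : nat -> {RV P >-> R}).

(** At the knots the empirical process is a function of the letter counts. *)
Lemma dev_knot n t i : (0 < n)%N -> (i <= m)%N ->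
  n%:R * dev F X n t (knot i) = \sum_(j < m.+2 | (j <= i)%N)
    (letter_count (sample_word X cell n t) (pred1 j) - n%:R * weight j).
Proof.
move=> n0 im; have n0' : n%:R != 0 :> R by rewrite pnatr_eq0 -lt0n.
have gi : p <= grid p q m i <= q by exact: grid_itv.
rewrite sumrB -mulr_sumr.
have -> : \sum_(j < m.+2 | (j <= i)%N) weight j = F (knot i).
  have := @primitive_knot (fun=> 1) i im (integrable_cstP mu 1 measurableT).
  have -> : primitive F (fun=> 1) (knot i) = F (knot i).
    have mr : measurable (`]-oo, knot i]%classic : set (measurableTypeR R)).
      exact: measurable_ray.
    rewrite /primitive (Rintegral_cst mu mr) mul1r.
    by have /= -> := congr1 fine (stieltjes_ray F (knot i)).
  move=> ->; apply: eq_bigr => j _.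
  by rewrite (Rintegral_cst mu (measurable_cell j)) mul1r.
rewrite /dev mulrBr; congr (_ - _).
rewrite /empirical_cdf mulrA mulfV// mul1r /letter_count exchange_big/=.
apply: eq_bigr => l _; rewrite ffunE -(cell_le _ im).
have [ci|ci] := boolP (cell (X l t) <= i)%N.
  rewrite (bigD1 (cell (X l t)))//= eqxx big1 ?addr0// => j /andP[_ jc].
  by rewrite eq_sym (negbTE jc).
rewrite big1// => j ji; case: eqP => // cj.
by rewrite cj ji in ci.
Qed.

End empirical.
End cells.

Arguments knot {R} p q F m i.
Arguments cell {R} p q F m x.
Arguments weight {R} p q F m j.

(** * Large deviation bounds near a path *)

Lemma probability_setD_ge (R : realType) d (T : measurableType d) (P : probability T R)
    (A B : set T) (x y : R) : measurable A -> measurable B ->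
  (x%:E <= P A)%E -> (P B <= y%:E)%E -> ((x - y)%:E <= P (A `\` B))%E.
Proof.
move=> mA mB xA By; rewrite measureD//; last by rewrite ltey_eq fin_num_measure.
rewrite EFinB leeB//; apply: le_trans By; apply: le_measure; rewrite ?inE//.
exact: measurableI.
Qed.

Section bounds.
Context (R : realType) (d : measure_display) (T : measurableType d) (P : probability T R)
    (p q : R) (p_gt0 : 0 < p) (pq : p < q) (q_lt1 : q < 1)
    (F : cumulativeBounded (0 : R) (1 : R)) (f : R -> R)
    (eps : R) (eps_gt0 : 0 < eps)
    (F_derive : forall x : R, x \in `[quantile F p - eps, quantile F q + eps] ->
       is_derive x 1 F (f x))
    (f_cont : {within `[quantile F p - eps, quantile F q + eps]%classic, continuous f})
    (f_gt0 : forall x : R, x \in `[quantile F p - eps, quantile F q + eps] ->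
       0 < f x)
    (X : nat -> {RV P >-> R}) (X_iid : iid_from F X)
    (a : nat -> R) (a_gt0 : forall n, (0 < n)%N -> 0 < a n)
    (a_cvg : a n @[n --> \oo] --> +oo)
    (a_small : a n / Num.sqrt n%:R @[n --> \oo] --> 0).

Let mu : probability (measurableTypeR R) R := lebesgue_stieltjes_measure F.
Local Notation W := (quantile_process F X a p_gt0 q_lt1).
Local Notation dv := (dev F X).
Let FQ x : p <= x <= q -> F (quantile F x) = x.
Proof. exact: (F_quantile p_gt0 q_lt1 eps_gt0 F_derive). Qed.

(** [ev_bahadur] replaces the quantile process by the empirical process, whose
    modulus ([ev_modulus]) and that of the paths ([path_modulus]) reduce the
    comparison to the knots of a fine grid. *)
Lemma ev_close_on_knots (M B r : R) : 0 <= B -> 0 < r ->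
  exists (m : nat) (tau : R), [/\ (0 < m)%N, 0 < tau & ev_exp P a M (fun n t =>
    forall g, sq_le mu g B ->
      (forall i, (i <= m)%N ->
         `|dv n t (knot p q F m i) / scale a n - primitive F g (knot p q F m i)| <= tau) ->
      forall x : `[p, q]%classic, `|W n t x - path_fun F f g (val x)| < r)].
Proof.
move=> B0 r0.
have [m1 [Mf [m10 M0 fmM]]] := f_bounds p_gt0 pq q_lt1 eps_gt0 f_cont f_gt0.
pose tau := r * m1 / 8; have tau0 : 0 < tau by rewrite divr_gt0 ?mulr_gt0.
have [del d0 Hm] := ev_modulus p_gt0 pq q_lt1 eps_gt0 F_derive f_gt0 X_iid a_gt0 a_cvg a_small (M + 1) tau0.
pose del2 := tau ^+ 2 / (B + 1).
have B1 : 0 < B + 1 by rewrite ltr_wpDl.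
have d20 : 0 < del2 by rewrite divr_gt0// exprn_gt0.
have dd : 0 < Num.min del del2 by rewrite lt_min d0.
have [m m0 mdel] := grid_mesh p q dd.
exists m, tau; split => //.
have r40 : 0 < r / 4 by rewrite divr_gt0.
have Hb := ev_bahadur p_gt0 pq q_lt1 eps_gt0 F_derive f_cont f_gt0 X_iid a_gt0 a_cvg a_small (M + 1) r40.
have MM : M < M + 1 by rewrite ltrDl.
apply: (ev_exp_mono (lexx M) _ (ev_exp_and a_cvg MM Hm Hb)).
near=> n => t [h1 h2] g gB hk x.
have n0 : (0 < n)%N by near: n; exact: nbhs_infty_gt.
have u0 : 0 < scale a n by exact: scale_gt0.
have xpq : p <= val x <= q by have := set_valP x; rewrite /= in_itv.
have ydel (x1 x2 : R) : `|x1 - x2| <= (q - p) / m%:R -> `|x1 - x2| <= del /\ `|x1 - x2| <= del2.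
  move=> h; have := le_trans h mdel; rewrite le_min => /andP[]; by split.
have clo : `|dv n t (quantile F (val x)) / scale a n - primitive F g (quantile F (val x))| <= tau + tau + tau.
  apply: (@close_on_grid _ _ _ pq (fun x => dv n t (quantile F x) / scale a n)
    (fun x => primitive F g (quantile F x)) m tau tau tau m0 _ _ hk _ xpq).
  - move=> x1 x2 x1pq x2pq /ydel[xd _].
    rewrite -mulrBl normrM normfV (gtr0_norm u0) ler_pdivrMr//.
    have y1 := quantile_J p_gt0 q_lt1 F eps_gt0 x1pq.
    have y2 := quantile_J p_gt0 q_lt1 F eps_gt0 x2pq.
    rewrite in_itv/= in y1; rewrite in_itv/= in y2.
    by apply: h1 => //; rewrite !FQ.
  - move=> x1 x2 x1pq x2pq /ydel[_ xd].
    apply: le_trans (path_modulus p_gt0 q_lt1 eps_gt0 F_derive gB x1pq x2pq) _.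
    rewrite -[leRHS](gtr0_norm tau0) -(sqrtr_sqr tau).
    rewrite ler_sqrt ?sqr_ge0//; apply: (@le_trans _ _ (del2 * B)); first by rewrite ler_wpM2r.
    rewrite /del2 mulrAC ler_pdivrMr// ler_wpM2l ?sqr_ge0//; lra.
have yJ := quantile_J p_gt0 q_lt1 F eps_gt0 xpq.
have /andP[fm _] := fmM _ yJ.
have fy0 : 0 < f (quantile F (val x)) by exact: lt_le_trans fm.
have := h2 x.
set y := quantile F (val x) in clo fm fy0 *; set D := dv n t y / scale a n in clo *.
move=> h3.
have -> : W n t x - path_fun F f g (val x) =
    (W n t x + D / f y) - (D - primitive F g y) / f y.
  by rewrite /path_fun -/y; field; rewrite gt_eqF.
apply: le_lt_trans (ler_normB _ _) _.
have h4 : `|(D - primitive F g y) / f y| <= 3 * r / 8.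
  rewrite normrM normfV (gtr0_norm fy0) ler_pdivrMr//; apply: le_trans clo _.
  have : r * m1 <= r * f y by rewrite ler_pM2l.
  rewrite /tau; lra.
by apply: le_lt_trans (lerD h3 h4) _; lra.
Unshelve. all: by end_near. Qed.

(** The letters are tilted by the cell averages of [g], which have at most the
    energy of [g]; then the increments of the empirical process over the cells
    are typically the integrals of [g].  The exceptional event of
    [ev_close_on_knots] is removed, having a strictly larger rate. *)
Lemma lower_bound (L e r : R) (g : R -> R) : 0 <= L -> 0 < e -> 0 < r ->
  sq_le mu g (2 * L) -> \int[mu]_x g x = 0 ->
  \forall n \near \oo, exists G : set T, [/\ measurable G,
    ((expR (- (a n ^+ 2 * (L + e))))%:E <= P G)%E &
    forall t, G t -> forall x : `[p, q]%classic, `|W n t x - path_fun F f g (val x)| < r].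
Proof.
move=> L0 e0 r0 gL g0.
have L20 : 0 <= 2 * L by rewrite mulr_ge0.
have [m [tau [m0 tau0 tr]]] := ev_close_on_knots (L + e + 1) L20 r0.
have mc := @measurable_cell _ _ _ p_gt0 pq q_lt1 F _ m0.
have ig : mu.-integrable setT (EFin \o g) by exact: sq_le_integrable gL.
pose w := weight p q F m.
pose v j := \int[mu]_(x in cell p q F m @^-1` [set j]) g x.
pose h j := v j / w j.
have wgt j : 0 < w j by exact: (weight_gt0 p_gt0 pq q_lt1 FQ m0).
have w0 j : 0 <= w j by exact: ltW.
have w1 : \sum_j w j = 1 by exact: (sample_weight_sum X_iid mc).
have wh j : w j * h j = v j by rewrite /h mulrC divfK// gt_eqF.
have v0 : \sum_j w j * h j = 0.
  rewrite (eq_bigr v) => [|j _]; last exact: wh.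
  by rewrite -[RHS]g0 (Rintegral_cells p_gt0 pq q_lt1 m0 ig).
have h2 : \sum_j w j * h j ^+ 2 <= 2 * L.
  exact: (cell_averages_sq p_gt0 pq q_lt1 FQ m0 gL).
pose G : R := \sum_j `|h j|.
have G0 : 0 <= G by apply: sumr_ge0.
have hG j : `|h j| <= G by rewrite /G (bigD1 j)//= lerDl sumr_ge0.
pose K : R := #|'I_m.+2|%:R.
have K0 : 0 < K by rewrite /K card_ord ltr0n.
have KG0 : 0 <= K * G by rewrite mulr_ge0// ltW.
(* small enough for the values at the knots, and for the exponent *)
pose e' := Num.min (tau / K) (e / 8 / (K * G + 1)).
have e'0 : 0 < e'.
  by rewrite /e' lt_min !divr_gt0//= ltr_wpDl.
have e'1 : e' * K <= tau by rewrite -ler_pdivlMr// /e' ge_min lexx.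
have e'2 : e' * (K * G) <= e / 8.
  apply: (@le_trans _ _ (e' * (K * G + 1))); first by rewrite ler_wpM2l ?(ltW e'0)//; lra.
  by rewrite -ler_pdivlMr ?ltr_wpDl// /e' ge_min lexx orbT.
pose Z : R := 2 * G ^+ 3 + e' * (K * G ^+ 2).
have Z0 : 0 <= Z.
  by rewrite addr_ge0// mulr_ge0 ?exprn_ge0// ?mulr_ge0 ?exprn_ge0// ltW.
have n1 : \forall n \near \oo, scale a n <= 1 / 2 / (G + 1).
  by apply: (near_scale a_small); rewrite divr_gt0// ltr_wpDl.
have n2 : \forall n \near \oo, scale a n <= 1 / e' by apply: (near_scale a_small); rewrite divr_gt0.
have n3 : \forall n \near \oo, scale a n <= e / 8 / (Z + 1).
  by apply: (near_scale a_small); rewrite !divr_gt0// ltr_wpDl.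
have n4 := near_speed a_cvg (4 * K / (e' ^+ 2 / 4)).
have n5 := near_speed a_cvg (4 / (e / 2)).
near=> n.
have n0 : (0 < n)%N by near: n; exact: nbhs_infty_gt.
have u0 : 0 < scale a n by exact: scale_gt0.
have [Bad [mB PB HB]] : exists Bad : set T, [/\ measurable Bad,
    (P Bad <= (expR (- (a n ^+ 2 * (L + e + 1))))%:E)%E & forall t, ~ Bad t ->
    forall g, sq_le mu g (2 * L) ->
      (forall i, (i <= m)%N ->
         `|dv n t (knot p q F m i) / scale a n - primitive F g (knot p q F m i)| <= tau) ->
      forall x : `[p, q]%classic, `|W n t x - path_fun F f g (val x)| < r] by near: n.
have uG : scale a n * G <= 1 / 2.
  apply: (@le_trans _ _ (scale a n * (G + 1))); first by rewrite ler_pM2l// lerDl.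
  by rewrite -ler_pdivlMr ?ltr_wpDl//; near: n.
have ue : scale a n * e' <= 1 by rewrite -ler_pdivlMr//; near: n.
have uZ : scale a n * Z <= e / 8.
  apply: (@le_trans _ _ (scale a n * (Z + 1))); first by rewrite ler_pM2l// lerDl.
  by rewrite -ler_pdivlMr ?ltr_wpDl//; near: n.
have a1 : 4 * K <= a n ^+ 2 * (e' ^+ 2 / 4).
  by rewrite -ler_pdivrMr ?divr_gt0 ?exprn_gt0//; near: n.
have a2 : 4 <= a n ^+ 2 * (e / 2) by rewrite -ler_pdivrMr ?divr_gt0//; near: n.
have := word_tilt n w0 w1 v0 G0 hG (ltW u0) uG (ltW e'0) ue.
rewrite scale_sqr// -/K -/Z.
pose S := fun k : {ffun 'I_n -> 'I_m.+2} =>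
    [forall j, `|letter_count k (pred1 j) - n%:R * (w j * (1 + scale a n * h j))| <= n%:R * scale a n * e'].
have [mS PS] := sample_word_prob X_iid mc S.
rewrite -[word_prob _ _]/(word_prob w S) => tilt.
have half : 1 / 2 <= 1 - K * (2 * expR (- (a n ^+ 2 * (e' ^+ 2 / 4)))).
  have /(le_trans a1) : a n ^+ 2 * (e' ^+ 2 / 4) <= expR (a n ^+ 2 * (e' ^+ 2 / 4)).
    by apply: le_trans (expR_ge1Dx _); rewrite lerDr.
  rewrite expRN; set E := expR _ => KE.
  have E0 : 0 < E by exact: expR_gt0.
  have : K * (2 / E) <= 1 / 2.
    by rewrite mulrA ler_pdivrMr//; lra.
  lra.
pose y := expR (- (a n ^+ 2 * (L + e))).
have y0 : 0 < y by exact: expR_gt0.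
exists ([set t | S (sample_word X (cell p q F m) n t)] `\` Bad); split.
- exact: measurableD.
(* the tilted words have probability at least [2 * y], and the exceptional
   event at most [y] *)
- apply: (@le_trans _ _ (2 * y - y)%:E); first by rewrite lee_fin -/y; lra.
  apply: probability_setD_ge => //; last first.
    apply: le_trans PB _; rewrite lee_fin /y ler_expR lerN2 ler_wpM2l ?sqr_ge0//.
    by rewrite lerDl.
  rewrite [X in (_ <= X)%E]PS lee_fin; apply: le_trans tilt.
  apply: (@le_trans _ _ (1 / 2 * expR (- (a n ^+ 2 * (L + e / 2))))).
    have -> : expR (- (a n ^+ 2 * (L + e / 2))) = y * expR (a n ^+ 2 * (e / 2)).
      by rewrite /y -expRD; congr expR; field.
    have : 4 <= expR (a n ^+ 2 * (e / 2)).
      by apply: le_trans a2 (le_trans _ (expR_ge1Dx _)); rewrite lerDr.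
    nra.
  apply: ler_pM => //.
  rewrite ler_expR lerN2 ler_wpM2l ?sqr_ge0//; lra.
move=> t [/forallP St nB]; apply: (HB t nB g gL) => i im.
have k0 : n%:R != 0 :> R by rewrite pnatr_eq0 -lt0n.
have nu0 : 0 < n%:R * scale a n by rewrite mulr_gt0// ltr0n.
rewrite (primitive_knot p_gt0 pq q_lt1 m0 im ig).
rewrite (_ : dv n t _ = n%:R^-1 * (n%:R * dv n t (knot p q F m i))); last by rewrite mulKf.
rewrite (dev_knot p_gt0 pq q_lt1 m0 X t n0 im).
set lc := letter_count _.
have -> : n%:R^-1 * (\sum_(j < m.+2 | (j <= i)%N) (lc (pred1 j) - n%:R * weight p q F m j)) / scale a n
   - \sum_(j < m.+2 | (j <= i)%N) v j =
  \sum_(j < m.+2 | (j <= i)%N) ((lc (pred1 j) - n%:R * (w j * (1 + scale a n * h j))) / (n%:R * scale a n)).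
  rewrite mulrAC mulr_sumr -sumrB; apply: eq_bigr => j _.
  by rewrite -wh -/(w j); field; rewrite k0 gt_eqF.
apply: le_trans (ler_norm_sum _ _ _) _; apply: le_trans e'1.
apply: (@le_trans _ _ (\sum_(j < m.+2) e')); last by rewrite sumr_const -/K mulr_natr.
rewrite big_mkcond; apply: ler_sum => j _; case: ifP => // _; last exact: ltW.
rewrite normrM normfV (gtr0_norm nu0) ler_pdivrMr// [leRHS]mulrC; exact: St.
Unshelve. all: by end_near. Qed.

Lemma ev_letters m (M : R) : (0 < m)%N -> 0 <= M ->
  ev_exp P a M (fun n t => forall j,
    `|letter_count (sample_word X (cell p q F m) n t) (pred1 j) - n%:R * weight p q F m j|
      <= n%:R * scale a n * (M + 3)).
Proof.
move=> m0 M0; apply: (@ev_exp_forall _ _ _ _ _ a_cvg _ M (M + 1)) => [|j]; first by rewrite ltrDl.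
apply: (@ev_exp_bound _ _ _ _ _ a_cvg (M + 1) (M + 2) 2); first by rewrite ltrD2l ltr1n.
near=> n; have n0 : (0 < n)%N by near: n; exact: nbhs_infty_gt.
have u0 : 0 < scale a n by exact: scale_gt0.
have u1 : scale a n * 1 <= 1 / 2 by rewrite mulr1; near: n; apply: (near_scale a_small).
have n0' : 0 < n%:R :> R by rewrite ltr0n.
have mj := @measurable_cell _ _ _ p_gt0 pq q_lt1 F _ m0 j.
have wj : mu (cell p q F m @^-1` [set j]) = (weight p q F m j)%:E.
  by rewrite /weight fineK// fin_num_measure.
pose D t := n%:R^-1 * (letter_count (sample_word X (cell p q F m) n t) (pred1 j) - n%:R * weight p q F m j).
have DE t : n%:R * D t = \sum_(l < n) (`[< (cell p q F m @^-1` [set j]) (X l t) >])%:R - n%:R * weight p q F m j.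
  rewrite /D mulVKf ?gt_eqF//; congr (_ - _); apply: eq_bigr => l _.
  by rewrite ffunE /=; congr (_ %:R); congr nat_of_bool; apply/eqP/asboolP.
have [mB PB] := dev_bernstein X_iid (M + 3) mj wj DE n0 (ltW u0) ler01 u1.
exists [set t | scale a n * (M + 3) <= `|D t|]; split => //.
  apply: le_trans PB _; rewrite lee_fin ler_pM2l// ler_expR lerN2 scale_sqr//.
  rewrite ler_wpM2l ?sqr_ge0// expr1n !mul1r.
  have : weight p q F m j <= 1 by rewrite -lee_fin -wj probability_le1.
  lra.
move=> t /negP; rewrite -ltNge => /ltW; rewrite /D normrM normfV (gtr0_norm n0').
by rewrite mulrC ler_pdivrMr// => h; apply: le_trans h _; rewrite mulrC mulrA.
Unshelve. all: by end_near. Qed.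

(** Let [V] be the cell increments of the rescaled empirical process and
    [Q(V) = sum_j V_j^2 / w_j].  If [Q(V) <= 2 L], the step function
    [V_j / w_j] is the wanted density: its primitive agrees with the empirical
    process at the knots.  Otherwise round [V] to a point [c] of a finite grid:
    as [2 sum_j c_j V_j / w_j - Q(c) = Q(V) - Q(V - c)] is nearly [2 L] at
    least, [V] lies in one of finitely many half-spaces, each of probability
    at most [exp (- a(n)^2 (L - e / 2))]. *)
Lemma upper_bound (L e r : R) : 0 <= L -> 0 < e -> 0 < r ->
  ev_exp P a (L - e) (fun n t => exists g : R -> R, [/\ sq_le mu g (2 * L),
    \int[mu]_x g x = 0 &
    forall x : `[p, q]%classic, `|W n t x - path_fun F f g (val x)| < r]).
Proof.
move=> L0 e0 r0; have L20 : 0 <= 2 * L by rewrite mulr_ge0.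
have [m [tau [m0 tau0 tr]]] := ev_close_on_knots L L20 r0.
have mc := @measurable_cell _ _ _ p_gt0 pq q_lt1 F _ m0.
pose w := weight p q F m.
have wgt j : 0 < w j by exact: (weight_gt0 p_gt0 pq q_lt1 FQ m0).
have w0 j : 0 <= w j by exact: ltW.
have w1 : \sum_j w j = 1 by exact: (sample_weight_sum X_iid mc).
pose D : R := L + 3; have D0 : 0 < D by rewrite ltr_wpDl.
pose Y : R := \sum_j (w j)^-1.
have Y0 : 0 <= Y by apply: sumr_ge0 => j _; rewrite invr_ge0.
(* the finite grid of step [rho] in [-D, D] for the rounding of increments:
   [N] makes [Q(V - c)] at most [e / 2] *)
have [N N0 Nle] : exists2 N, (0 < N)%N & D ^+ 2 * Y / N%:R <= e / 2.
  pose N := (Num.truncn (D ^+ 2 * Y / (e / 2))).+1; exists N => //.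
  rewrite ler_pdivrMr ?ltr0n// [leRHS]mulrC -ler_pdivrMr ?divr_gt0//.
  by rewrite ltW// truncnS_gt.
have N0' : 0 < N%:R :> R by rewrite ltr0n.
have N1 : 1 <= N%:R :> R by rewrite ler1n.
pose rho : R := D / N%:R; have rho0 : 0 < rho by rewrite divr_gt0.
have rhoY : rho ^+ 2 * Y <= e / 2.
  apply: le_trans Nle.
  have -> : rho ^+ 2 * Y = D ^+ 2 * Y / N%:R / N%:R by rewrite /rho; field; rewrite gt_eqF.
  by rewrite ler_pdivrMr// ler_peMr// divr_ge0 ?mulr_ge0// ?sqr_ge0// ltW.
pose c (k : {ffun 'I_m.+2 -> 'I_(2 * N).+1}) j : R := D * ((k j)%:R / N%:R - 1).
pose gg k j : R := c k j / w j.
pose s k : R := L - e / 4 + (\sum_j w j * gg k j ^+ 2) / 2.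
pose V n t j : R := (letter_count (sample_word X (cell p q F m) n t) (pred1 j) - n%:R * w j) / (n%:R * scale a n).
have Hk k : ev_exp P a (L - e / 2) (fun n t => \sum_j gg k j * V n t j < s k).
  pose G : R := \sum_j `|gg k j|.
  have G0 : 0 <= G by apply: sumr_ge0.
  have gG j : `|gg k j| <= G by rewrite /G (bigD1 j)//= lerDl sumr_ge0.
  have n1 : \forall n \near \oo, scale a n <= 1 / (G + 1).
    by apply: (near_scale a_small); rewrite divr_gt0// ltr_wpDl.
  have n2 : \forall n \near \oo, scale a n <= e / 4 / (G ^+ 3 + 1).
    by apply: (near_scale a_small); rewrite !divr_gt0// ltr_wpDl// exprn_ge0.
  near=> n; have n0 : (0 < n)%N by near: n; exact: nbhs_infty_gt.
  have u0 : 0 < scale a n by exact: scale_gt0.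
  have n0' : 0 < n%:R :> R by rewrite ltr0n.
  have uG : scale a n * G <= 1.
    apply: (@le_trans _ _ (scale a n * (G + 1))); first by rewrite ler_pM2l// lerDl.
    by rewrite -ler_pdivlMr ?ltr_wpDl//; near: n.
  have uG3 : scale a n * G ^+ 3 <= e / 4.
    apply: (@le_trans _ _ (scale a n * (G ^+ 3 + 1))); first by rewrite ler_pM2l// lerDl.
    by rewrite -ler_pdivlMr ?ltr_wpDl ?exprn_ge0//; near: n.
  pose S (l : {ffun 'I_n -> 'I_m.+2}) :=
    n%:R * (\sum_j w j * gg k j) + n%:R * scale a n * s k <= \sum_(i < n) gg k (l i).
  have [mS PS] := sample_word_prob X_iid mc S.
  exists [set t | S (sample_word X (cell p q F m) n t)]; split => //.
    rewrite [X in (X <= _)%E]PS lee_fin.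
    apply: le_trans (word_halfspace w0 w1 gG (ltW u0) uG (fun l (Sl : S l) => Sl)) _.
    rewrite ler_expR lerN2 scale_sqr// ler_wpM2l ?sqr_ge0// /s; lra.
  move=> t /negP; rewrite -ltNge letter_countE.
  set lc := letter_count _ => lcs.
  have nu : 0 < n%:R * scale a n by rewrite mulr_gt0.
  rewrite -(ltr_pM2l nu) -(ltrD2l (n%:R * \sum_j w j * gg k j)).
  apply: le_lt_trans lcs; rewrite le_eqVlt; apply/orP; left; apply/eqP.
  rewrite !mulr_sumr -big_split/=; apply: eq_bigr => j _.
  by rewrite /V -/lc; field; rewrite !gt_eqF.
have M1 : L - 3 / 4 * e < L - e / 2 by lra.
have M2 : L - 3 / 4 * e < L by lra.
have M3 : L - e < L - 3 / 4 * e by lra.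
have HH := ev_exp_and a_cvg M3 (ev_exp_forall a_cvg M1 Hk)
  (ev_exp_and a_cvg M2 (ev_letters m0 L0) tr).
apply: (ev_exp_mono (lexx _) _ HH).
near=> n => t [halves [letters close]].
have n0 : (0 < n)%N by near: n; exact: nbhs_infty_gt.
have u0 : 0 < scale a n by exact: scale_gt0.
have n0' : 0 < n%:R :> R by rewrite ltr0n.
have nu0 : 0 < n%:R * scale a n by rewrite mulr_gt0.
have VD j : `|V n t j| <= D.
  by rewrite /V normrM normfV (gtr0_norm nu0) ler_pdivrMr// [leRHS]mulrC; exact: letters.
have sumV : \sum_j V n t j = 0.
  rewrite -mulr_suml sumrB -mulr_sumr w1 mulr1.
  have := letter_countE (sample_word X (cell p q F m) n t) (fun=> 1 : R).
  rewrite sumr_const card_ord => E.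
  by under eq_bigr do rewrite -[letter_count _ _]mulr1; rewrite -E subrr mul0r.
have [QL|QL] := leP (\sum_j V n t j ^+ 2 / w j) (2 * L); last first.
  exfalso.
  pose x j : R := (V n t j / D + 1) * N%:R.
  have xI j : 0 <= x j <= (2 * N)%:R.
    have := VD j; rewrite ler_norml => /andP[h1 h2].
    rewrite /x mulr_ge0//=; last by rewrite -lerBlDr sub0r ler_pdivlMr// mulN1r.
    rewrite natrM ler_pM2r// -lerBrDr ler_pdivrMr//; lra.
  pose k : {ffun 'I_m.+2 -> 'I_(2 * N).+1} := [ffun j => inord (Num.truncn (x j))].
  have kx j : `|x j - (k j)%:R| <= 1.
    have /andP[x0 x2] := xI j.
    have /andP[t1 t2] := truncn_itv x0.
    rewrite ffunE inordK; last by rewrite ltnS -(ler_nat R); exact: le_trans t1 x2.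
    rewrite ger0_norm ?subr_ge0// lerBlDr addrC -natr1 in t2 *.
    exact: ltW.
  have Vc j : (V n t j - c k j) ^+ 2 <= rho ^+ 2.
    have -> : V n t j - c k j = rho * (x j - (k j)%:R).
      by rewrite /c /x /rho; field; rewrite !gt_eqF.
    rewrite exprMn ler_piMr ?sqr_ge0//.
    by have := kx j; rewrite ler_norml => /andP[]; nra.
  have := halves k; rewrite ltNge => /negP; apply.
  rewrite /s -lerBrDr.
  have : L - e / 4 <= \sum_j (gg k j * V n t j - w j * gg k j ^+ 2 / 2).
    apply: (@le_trans _ _ (\sum_j (V n t j ^+ 2 / w j / 2 - rho ^+ 2 / 2 * (w j)^-1))).
      rewrite sumrB -mulr_suml -mulr_sumr -/Y.
      have : rho ^+ 2 / 2 * Y = rho ^+ 2 * Y / 2 by rewrite mulrAC.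
      lra.
    apply: ler_sum => j _.
    have -> : gg k j * V n t j - w j * gg k j ^+ 2 / 2 =
      V n t j ^+ 2 / w j / 2 - (V n t j - c k j) ^+ 2 / 2 * (w j)^-1.
      by rewrite /gg; field; rewrite gt_eqF.
    by rewrite lerD2l lerN2 ler_wpM2r ?invr_ge0// ler_pM2r// invr_gt0.
  by rewrite sumrB -mulr_suml.
pose h j : R := V n t j / w j.
have hw j : h j * w j = V n t j by rewrite /h divfK// gt_eqF.
have gL : sq_le mu (fun x => h (cell p q F m x)) (2 * L).
  apply: (step_sq_le p_gt0 pq q_lt1 m0).
  apply: le_trans QL; apply: ler_sum => j _; rewrite -/(w j).
  rewrite le_eqVlt; apply/orP; left; apply/eqP.
  by rewrite /h; field; rewrite gt_eqF.
exists (fun x => h (cell p q F m x)); split => //.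
  by rewrite (step_Rintegral p_gt0 pq q_lt1 m0) -[RHS]sumV; apply: eq_bigr => j _; exact: hw.
apply: close => // i im.
rewrite (step_primitive_knot p_gt0 pq q_lt1 m0)//.
rewrite (_ : dv n t _ = n%:R^-1 * (n%:R * dv n t (knot p q F m i))); last by rewrite mulKf// gt_eqF.
rewrite (dev_knot p_gt0 pq q_lt1 m0 X t n0 im).
rewrite [X in X - _](_ : _ = \sum_(j < m.+2 | (j <= i)%N) h j * weight p q F m j); last first.
  rewrite mulrAC mulr_sumr; apply: eq_bigr => j _; rewrite -/(w j) hw /V -/(w j).
  by field; rewrite !gt_eqF.
by rewrite subrr normr0 ltW.
Unshelve. all: by end_near. Qed.

End bounds.

(** * The large deviation principle *)

Section ereal_limits.
Context {R : realType}.
Implicit Types (u : nat -> \bar R) (x y : \bar R).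
Local Open Scope ereal_scope.

Lemma limn_esup_le_near u x : (\forall n \near \oo, u n <= x) -> limn_esup u <= x.
Proof.
move=> ux; apply: (@le_trans _ _ (ereal_sup (u @` [set n | u n <= x]))).
  by apply: ereal_inf_lbound; exists [set n | u n <= x].
by apply: ge_ereal_sup => _ [n /= h <-].
Qed.

Lemma limn_einf_ge_near u x : (\forall n \near \oo, x <= u n) -> x <= limn_einf u.
Proof.
move=> ux; rewrite /limn_einf leeNr; apply: limn_esup_le_near.
by apply: filterS ux => n h /=; rewrite leeN2.
Qed.

Lemma lee_real_below x y : (forall r : R, r%:E < x -> r%:E <= y) -> x <= y.
Proof.
move=> h; rewrite leNgt; apply/negP => yx.
have [r [yr rx]] : exists r : R, y < r%:E /\ r%:E < x.
  case: x y yx {h} => [s| |] [s'| |]// yx.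
  - by exists ((s' + s) / 2)%R; rewrite !lte_fin in yx *; split; lra.
  - by exists (s - 1)%R; rewrite ltNyr lte_fin; split=> //; lra.
  - by exists (s' + 1)%R; rewrite ltry lte_fin; split=> //; lra.
  - by exists 0%R; rewrite ltNy0 lt0y.
by have := lt_le_trans yr (h _ rx); rewrite ltxx.
Qed.

Lemma speed_lne_ge (lam c : R) x : (0 < lam)%R ->
  (expR (- (lam * c)))%:E <= x -> (- c)%:E <= lam^-1%:E * lne x.
Proof.
move=> l0; case: x => [r| |]// h; last first.
  by rewrite /= gt0_muley ?leey// lte_fin invr_gt0.
rewrite lee_fin in h; have r0 := lt_le_trans (expR_gt0 _) h.
rewrite lne_EFin// -EFinM lee_fin ler_pdivlMl// mulrN.
by rewrite -ler_expR lnK.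
Qed.

Lemma speed_lne_le (lam c : R) x : (0 < lam)%R ->
  x <= (expR (- (lam * c)))%:E -> lam^-1%:E * lne x <= (- c)%:E.
Proof.
move=> l0 xe; have [x0|x0] := leP x 0.
  by rewrite le0_lneNy// gt0_muleNy ?leNye// lte_fin invr_gt0.
case: x xe x0 => [r| |]// h r0; rewrite lee_fin in h; rewrite lte_fin in r0.
rewrite lne_EFin// -EFinM lee_fin ler_pdivrMl// mulrN.
by rewrite -ler_expR lnK.
Qed.

End ereal_limits.

Lemma compact_closed_separation (R : realType) (M : metricType R) (C K : set M) :
  compact C -> closed K -> C `&` K = set0 ->
  exists2 r : R, 0 < r & forall x y, C x -> ball x r y -> ~ K y.
Proof.
move=> cC cK CK.
have cov := (compact_near_coveringP C).1 cC.
pose Q (r : R) x := forall y, ball x r y -> C x -> ~ K y.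
have [|r0 /= r00 Hr] := cov R 0^'+ Q _.
  move=> x Cx; have : nbhs x (~` K).
    apply: open_nbhs_nbhs; split; first exact: closed_openC.
    by move=> Kx; have : (C `&` K) x by []; rewrite CK.
  move=> /nbhs_ballP[r /= r0 Hr].
  have r20 : 0 < r / 2 by rewrite divr_gt0.
  exists (ball x (r / 2), [set z | 0 < z < r / 2]) => /=.
    split; first exact: nbhsx_ballx.
    exists (r / 2) => //.
    move=> z /=; rewrite sub0r normrN => zr z0; rewrite z0/=.
    by rewrite (le_lt_trans (ler_norm z)).
  move=> [x' r'] /= [xx' /andP[r'0 r'r]] y x'y _.
  apply: Hr; apply: (@le_ball _ _ x (r / 2 + r') r); first by lra.
  exact: ball_triangle xx' x'y.
have /Hr : ball_ (@Num.norm R R) 0 r0 (r0 / 2).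
  by rewrite /ball_/= sub0r normrN gtr0_norm ?divr_gt0//; lra.
move=> /(_ _) h; exists (r0 / 2); first by rewrite divr_gt0.
by move=> x y Cx xy; apply: (h _ x Cx) => //; rewrite divr_gt0.
Qed.

(** The factor [1 / 2] leaves room for the supremum. *)
Lemma ball_linfty (R : realType) (T : Type) (phi psi : linfty R T) (r : R) : 0 < r ->
  (forall t, `|phi t - psi t| < r / 2) -> ball phi r psi.
Proof.
move=> r0 h; rewrite ball_sup_normE /=.
have r2 : 0 <= r / 2 by rewrite divr_ge0// ltW.
apply: (@le_lt_trans _ _ (r / 2)); last by lra.
by apply: sup_norm_le => // t; exact: ltW (h t).
Qed.

Theorem theorem4p5 (R : realType)
    (d : measure_display) (T : measurableType d) (P : probability T R)
    (p q : R) (p_gt0 : 0 < p) (pq : p < q) (q_lt1 : q < 1)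
    (F : cumulativeBounded (0 : R) (1 : R)) (f : R -> R)
    (eps : R) (eps_gt0 : 0 < eps)
    (F_derive : forall x : R, x \in `[quantile F p - eps, quantile F q + eps] ->
       is_derive x 1 F (f x))
    (f_cont : {within `[quantile F p - eps, quantile F q + eps]%classic, continuous f})
    (f_gt0 : forall x : R, x \in `[quantile F p - eps, quantile F q + eps] ->
       0 < f x)
    (X : nat -> {RV P >-> R}) (X_iid : iid_from F X)
    (a : nat -> R) (a_gt0 : forall n, (0 < n)%N -> 0 < a n)
    (a_cvg : a n @[n --> \oo] --> +oo)
    (a_small : a n / Num.sqrt n%:R @[n --> \oo] --> 0) :
  large_deviation_principle P (@ball_coord_sigma R `[p, q]%classic)
    (quantile_process F X a p_gt0 q_lt1)
    (fun n => a n ^+ 2) (I_EQ F f (p := p) (q := q)).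
Proof.
have rate := rate_function_I_EQ p_gt0 pq q_lt1 eps_gt0 F_derive f_cont f_gt0.
have [I0 Icompact] := rate.
have lam0 : \forall n \near \oo, 0 < a n ^+ 2.
  by near=> n; rewrite exprn_gt0// a_gt0//; near: n; exact: nbhs_infty_gt.
split => //.
- by move=> n n0; rewrite exprn_gt0// a_gt0.
- by apply/cvgryPge => C; exact: near_speed.
- move=> U oU _; rewrite leeNl; apply: le_ereal_inf_tmp => _ [phi Uphi <-].
  have := I0 phi; set y := (X in (0 <= X)%E) => y0; rewrite -[leRHS]/y.
  case: {-2}y (erefl y) y0 => [L| |] E // y0; last by rewrite leey.
  rewrite lee_fin in y0; apply/lee_addgt0Pr => e e0.
  rewrite -EFinD leeNl; apply: limn_einf_ge_near.
  have e2 : 0 < e / 2 by rewrite divr_gt0.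
  have IL : (I_EQ F f phi < (L + e / 2)%:E)%E by rewrite -[ltLHS]/y -E lte_fin ltrDl.
  have [g [gL g0 gphi]] := I_EQ_lt IL.
  have /nbhs_ballP[r /= r0 rU] : nbhs phi U by apply: open_nbhs_nbhs.
  have r2 : 0 < r / 2 by rewrite divr_gt0.
  have Le : 0 <= L + e / 2 by rewrite addr_ge0// ltW.
  have := lower_bound p_gt0 pq q_lt1 eps_gt0 F_derive f_cont f_gt0 X_iid a_gt0 a_cvg a_small
    Le e2 r2 gL g0.
  apply: filterS2 lam0 => n l0 [G [mG PG HG]].
  apply: speed_lne_ge => //.
  rewrite (_ : L + e = L + e / 2 + e / 2); last by field.
  apply: le_trans PG _; apply: ereal_sup_ubound; exists G => //; split => //.
  move=> t Gt /=; apply: rU; apply: ball_linfty => // x.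
  by rewrite distrC -gphi; exact: HG.
- move=> K cK _; rewrite leeNr; apply: lee_real_below => L LK.
  have [L0|L0] := leP 0 L; last first.
    (* probabilities are at most [1], so the upper limit is at most [0] *)
    apply: (@le_trans _ _ 0%E); first by rewrite lee_fin ltW.
    rewrite leeNr oppe0; apply: limn_esup_le_near.
    apply: filterS lam0 => n l0; rewrite -[leRHS]oppe0 -EFinN.
    apply: speed_lne_le => //; rewrite mulr0 oppr0 expR0.
    by apply: ereal_inf_lbound; exists setT; rewrite ?probability_setT.
  (* the sublevel set is compact and does not meet [K] *)
  have [r r0 Hr] : exists2 r : R, 0 < r &
      forall x y, (I_EQ F f x <= L%:E)%E -> ball x r y -> ~ K y.
    apply: (compact_closed_separation (Icompact L) cK).
    apply/seteqP; split => // phi [/= IL Kphi].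
    have : (ereal_inf [set I_EQ F f phi | phi in K] <= I_EQ F f phi)%E.
      by apply: ereal_inf_lbound; exists phi.
    by move=> /le_trans /(_ IL) /(lt_le_trans LK); rewrite ltxx.
  apply/lee_addgt0Pr => e e0; rewrite -leeBlDr// -EFinB leeNr.
  apply: limn_esup_le_near.
  have r2 : 0 < r / 2 by rewrite divr_gt0.
  have := upper_bound p_gt0 pq q_lt1 eps_gt0 F_derive f_cont f_gt0 X_iid a_gt0 a_cvg a_small
    L0 e0 r2.
  apply: filterS2 lam0 => n l0 [Bad [mB PB HB]].
  apply: speed_lne_le => //; apply: le_trans PB.
  apply: ereal_inf_lbound; exists Bad => //; split => // t /= Kt.
  apply: contrapT => /HB[g [gL g0 gW]].
  pose phi := Linfty (path_bounded p_gt0 pq q_lt1 eps_gt0 f_cont f_gt0 gL).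
  have Iphi : (I_EQ F f phi <= L%:E)%E by apply: (I_EQ_le (gL) g0).
  apply: (Hr _ _ Iphi _ Kt); apply: ball_linfty => // x.
  by rewrite distrC; exact: gW.
Unshelve. all: by end_near. Qed.
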